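(* If $f\in L^1(\mathbb{H})$ and $\epsilon>0$, then for all $n\in\mathbb{Z}\setminus\{0\}$ and all $\lambda>0$, $$\mathcal{F}_{\mathbb{H}/\Gamma^\epsilon_\lambda}\left(I^\epsilon_\lambda f\right)(n)=\frac{2\pi}{\lambda}\,\mathcal{J}_n\left(\frac{1}{\sqrt{1+2\epsilon^2\lambda^2}}\right)\circ\left(\mathcal{F}_{\mathbb{H}}f\right)\left(\frac{n\lambda^2}{1+2\epsilon^2\lambda^2}\right)$$ as operators on $\mathcal{H}$.
   Context: The Heisenberg group is $\mathbb{H}=\mathbb{C}\times\mathbb{R}$ with group law $(x+iy,t)(u+iv,s)=\left(x+u+i(y+v),\,t+s+\tfrac12(xv-yu)\right)$ and Haar measure equal to Lebesgue measure. For $\epsilon>0$, $\lambda>0$, $R=1/\lambda$, put $\gamma^\epsilon_\lambda(s)=\left(Re^{is/R},\,s\frac{R^2+2\epsilon^2}{2R}\right)$ (a geodesic, with projection to $\mathbb{C}$ of unit speed, of the left-invariant Riemannian metric $g_\epsilon=dx^2+dy^2+\epsilon^{-2}\Theta^2$, $\Theta=dt-\tfrac12(x\,dy-y\,dx)$), and $\Gamma^\epsilon_\lambda=\{(0,k\pi(R^2+2\epsilon^2)):k\in\mathbb{Z}\}$, a central subgroup. $\mathbb{H}/\Gamma^\epsilon_\lambda$ carries the Haar measure $dx\,dy\,dt$ (Lebesgue measure on $\mathbb{C}\times[0,\pi(R^2+2\epsilon^2))$). For $f\in C_c(\mathbb{H})$, $I^\epsilon_\lambda f(z,t)=\int_{\mathbb{R}}f\left((z,t)\gamma^\epsilon_\lambda(s)\right)ds$,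 a function on $\mathbb{H}/\Gamma^\epsilon_\lambda$; $I^\epsilon_\lambda:L^1(\mathbb{H})\to L^1(\mathbb{H}/\Gamma^\epsilon_\lambda)$ is the bounded extension. Bargmann-Fock space is $\mathcal{H}=\{F:\mathbb{C}\to\mathbb{C}\text{ holomorphic}:\tfrac1\pi\int_{\mathbb{C}}|F(\zeta)|^2e^{-|\zeta|^2}d\zeta<\infty\}$ with the corresponding inner product. For $h>0$, $\beta_h(z,t)F(\zeta)=e^{2iht-\sqrt h\,\zeta\overline z-\frac h2|z|^2}F(\zeta+\sqrt h z)$, and $\beta_h(z,t)=\beta_{|h|}(\overline z,-t)$ for $h<0$; these are strongly continuous unitary representations of $\mathbb{H}$ on $\mathcal{H}$. For $f\in L^1(\mathbb{H})$, $h\in\mathbb{R}\setminus\{0\}$: $\mathcal{F}_{\mathbb{H}}f(h)=\int_{\mathbb{H}}f(q)\beta_h(q)^*dq$. For $g\in L^1(\mathbb{H}/\Gamma^\epsilon_\lambda)$, $n\in\mathbb{Z}\setminus\{0\}$: $\mathcal{F}_{\mathbb{H}/\Gamma^\epsilon_\lambda}(g)(n)=\int_{\mathbb{H}/\Gamma^\epsilon_\lambda}g(q)\,\beta_{n\lambda^2/(1+2\epsilon^2\lambda^2)}(q)^*dq$. (These are bounded operators on $\mathcal{H}$; Bochner integrals.) For $n\in\mathbb{Z}\setminus\{0\}$ and $r>0$, $\mathcal{J}_n(r)=\frac1{2\pi}\int_0^{2\pi}\beta_n\left(re^{i\theta},\theta/2\right)d\theta$, an operator on $\mathcal{H}$.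 *)

(* Defs.v *)
From HB Require Import structures.
From mathcomp Require Import all_boot all_order all_algebra.
From mathcomp Require Import complex.
From mathcomp Require Import all_classical all_reals all_analysis.

Set Implicit Arguments.
Unset Strict Implicit.
Unset Printing Implicit Defensive.

Import Order.TTheory GRing.Theory Num.Theory.
Import numFieldNormedType.Exports.

Local Open Scope classical_set_scope.
Local Open Scope ring_scope.
Local Open Scope complex_scope.

Definition cexp (R : realType) (z : R[i]) : R[i] :=
  (expR (complex.Re z) * cos (complex.Im z)) +i*
  (expR (complex.Re z) * sin (complex.Im z)).

(* The modulus as an element of R; the library's `|z| lies in R[i]. *)
Definition cmod (R : realType) (z : R[i]) : R :=
  Num.sqrt (complex.Re z ^+ 2 + complex.Im z ^+ 2).

Section complex_integral.
Context d (T : measurableType d) (R : realType).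
Variables (mu : {measure set T -> \bar R}) (D : set T).

Definition cintegrable (f : T -> R[i]) : Prop :=
  mu.-integrable D (EFin \o (fun x => complex.Re (f x))) /\
  mu.-integrable D (EFin \o (fun x => complex.Im (f x))).

Definition cintegral (f : T -> R[i]) : R[i] :=
  Rintegral mu D (fun x => complex.Re (f x)) +i*
  Rintegral mu D (fun x => complex.Im (f x)).

Definition L1dist (f g : T -> R[i]) : \bar R :=
  (\int[mu]_(x in D) (cmod (f x - g x))%:E)%E.

End complex_integral.

Definition leb1 (R : realType) : {measure set (measurableTypeR R) -> \bar R} :=
  @lebesgue_measure R.

Definition leb2 (R : realType) :
    {measure set (measurableTypeR R * measurableTypeR R) -> \bar R} :=
  (@lebesgue_measure R \x @lebesgue_measure R)%E.

Definition leb3 (R : realType) :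
    {measure set (measurableTypeR R * measurableTypeR R * measurableTypeR R)
       -> \bar R} :=
  (leb2 R \x @lebesgue_measure R)%E.

Section fock.
Variable R : realType.
Local Notation C := R[i].

Definition holomorphic (F : C -> C) : Prop :=
  forall z : C^o, derivable (F : C^o -> C^o) z 1.

Definition gauss_weight (z : R * R) : R := expR (- (z.1 ^+ 2 + z.2 ^+ 2)).

Definition fock (F : C -> C) : Prop :=
  holomorphic F /\
  ((pi^-1)%:E * \int[leb2 R]_z
     (cmod (F (z.1 +i* z.2)) ^+ 2 * gauss_weight z)%:E < +oo)%E.

Definition fock_inner (F G : C -> C) : C :=
  (pi^-1)%:C * cintegral (leb2 R) setT
    (fun z => F (z.1 +i* z.2) * conjc (G (z.1 +i* z.2)) * (gauss_weight z)%:C).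

Definition fock_norm (F : C -> C) : R :=
  Num.sqrt (complex.Re (fock_inner F F)).

(* Operators on the Fock space are maps on C -> C, of which only the values on
   [fock] matter. *)
Definition is_adjoint_value (A : (C -> C) -> (C -> C)) (G G' : C -> C) : Prop :=
  fock G' /\ forall F, fock F -> fock_inner (A F) G = fock_inner F G'.

Definition adjoint (A : (C -> C) -> (C -> C)) (G : C -> C) : C -> C :=
  xget (fun=> 0) [set G' | is_adjoint_value A G G'].

End fock.

(* Bochner integral over D of a function with values in the Fock space. *)
Section bochner.
Context d (T : measurableType d) (R : realType).
Variables (mu : {measure set T -> \bar R}) (D : set T).
Local Notation C := R[i].

Record step := Step {
  step_size : nat;
  step_set : 'I_step_size -> set T;
  step_val : 'I_step_size -> (C -> C);
  step_measurable : forall i, measurable (step_set i);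
  step_finite : forall i, (mu (D `&` step_set i) < +oo)%E;
  step_fock : forall i, fock (step_val i) }.

Definition step_fun (s : step) (x : T) : C -> C :=
  fun z => \sum_(i < step_size s) (\1_(step_set i) x : R)%:C * step_val i z.

Definition step_integral (s : step) : C -> C :=
  fun z => \sum_(i < step_size s)
    (fine (mu (D `&` step_set i)))%:C * step_val i z.

(* The a.e. convergence is strong measurability of u: without it the integral
   in the next clause, which is total, would be a mere lower integral. *)
Definition is_bochner (u : T -> C -> C) (v : C -> C) : Prop :=
  [/\ forall x, D x -> fock (u x), fock v &
   exists s : nat -> step,
   [/\ {ae mu, forall x, D x ->
         (fun k => fock_norm (fun z => u x z - step_fun (s k) x z))
           @ \oo --> (0 : R)},
       (fun k => (\int[mu]_(x in D)
           (fock_norm (fun z => u x z - step_fun (s k) x z))%:E)%E)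
         @ \oo --> (0 : \bar R)%E &
       (fun k => fock_norm (fun z => step_integral (s k) z - v z))
         @ \oo --> (0 : R)]].

Definition bochner (u : T -> C -> C) : C -> C :=
  xget (fun=> 0) [set v | is_bochner u v].

End bochner.

Section heisenberg.
Variable R : realType.
Local Notation C := R[i].

(* ((x, y), t) stands for (x + i y, t) in C x R; this makes Haar measure the
   product Lebesgue measure [leb3]. *)
Definition heis : Type := (R * R * R)%type.

Definition hmul (p q : heis) : heis :=
  ((p.1.1 + q.1.1, p.1.2 + q.1.2),
   p.2 + q.2 + 2^-1 * (p.1.1 * q.1.2 - p.1.2 * q.1.1)).

Definition beta_pos (h : R) (z : C) (t : R) (F : C -> C) : C -> C :=
  fun zeta =>
    cexp (2 * 'i%C * h%:C * t%:C - (Num.sqrt h)%:C * zeta * conjc z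
            - (h / 2)%:C * (cmod z ^+ 2)%:C)
    * F (zeta + (Num.sqrt h)%:C * z).

Definition beta (h : R) (q : heis) : (C -> C) -> (C -> C) :=
  let z := q.1.1 +i* q.1.2 in
  if 0 < h then beta_pos h z q.2 else beta_pos `|h| (conjc z) (- q.2).

Definition heis_L1 (f : heis -> C) : Prop := cintegrable (leb3 R) setT f.

Definition heis_fourier (f : heis -> C) (h : R) : (C -> C) -> (C -> C) :=
  fun F => bochner (leb3 R) setT
    (fun (q : heis) zeta => f q * adjoint (beta h q) F zeta).

Definition Jop (n : int) (r : R) : (C -> C) -> (C -> C) :=
  fun F zeta => ((2 * pi)^-1)%:C *
    bochner (leb1 R) `[0, 2 * pi]
      (fun theta : R =>
         beta n%:~R ((r * cos theta, r * sin theta), theta / 2) F) zeta.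

Section geodesic.
Variables (eps lam : R).
Let r : R := lam^-1.

Definition geodesic (s : R) : heis :=
  ((r * cos (s / r), r * sin (s / r)),
   s * ((r ^+ 2 + 2 * eps ^+ 2) / (2 * r))).

Definition period : R := pi * (r ^+ 2 + 2 * eps ^+ 2).

Definition Gam : set heis := [set ((0, 0), k%:~R * period) | k in [set: int]].

(* Functions on the quotient by [Gam] are [Gam]-invariant functions on the
   group; they are integrated over the fundamental domain [quot_dom]. *)
Definition quot_dom : set heis := [set q | 0 <= q.2 < period].

Definition quot_fun (g : heis -> C) : Prop :=
  forall q c, Gam c -> g (hmul q c) = g q.

Definition quot_L1 (g : heis -> C) : Prop :=
  quot_fun g /\ cintegrable (leb3 R) quot_dom g.

Definition quot_fourier (g : heis -> C) (n : int) : (C -> C) -> (C -> C) :=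
  fun F => bochner (leb3 R) quot_dom
    (fun (q : heis) zeta => g q *
       adjoint (beta (n%:~R * lam ^+ 2 / (1 + 2 * eps ^+ 2 * lam ^+ 2)) q)
         F zeta).

Definition Cc (f : heis -> C) : Prop :=
  continuous (f : R * R * R -> C^o) /\
  compact (closure [set q : R * R * R | f q != 0]).

Definition geo_int (f : heis -> C) (q : heis) : C :=
  cintegral (leb1 R) setT (fun s => f (hmul q (geodesic s))).

(* Graph of the extension by continuity of [geo_int] from Cc to L1. *)
Definition is_geo_transform (f g : heis -> C) : Prop :=
  quot_L1 g /\
  exists fk : nat -> heis -> C,
  [/\ forall k, Cc (fk k),
      (fun k => L1dist (leb3 R) setT (fk k) f) @ \oo --> (0 : \bar R)%E &
      (fun k => L1dist (leb3 R) quot_dom (geo_int (fk k)) g)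
        @ \oo --> (0 : \bar R)%E].

Definition geo_transform (f : heis -> C) : heis -> C :=
  xget (fun=> 0) [set g | is_geo_transform f g].

End geodesic.
End heisenberg.

(* Main.v *)
Require Import Defs.
From HB Require Import structures.
From mathcomp Require Import all_boot all_order all_algebra.
From mathcomp Require Import complex.
From mathcomp Require Import all_classical all_reals all_analysis.
From mathcomp Require Import measurable_realfun ring lra.
Import Order.TTheory GRing.Theory Num.Theory.
Import numFieldNormedType.Exports.
Local Open Scope classical_set_scope.
Local Open Scope ring_scope.
Local Open Scope complex_scope.

Set Implicit Arguments.
Unset Strict Implicit.
Unset Printing Implicit Defensive.

(** Write L = 2 pi / lam, P = [period], D = 1 + 2 eps^2 lam^2, h = n lam^2 / D, and gamma for the
    geodesic. The parameter h satisfies h P = n pi, so beta_h is trivial on the central subgroup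
    generated by (0, P), and q -> beta_h(q^-1), the adjoint of beta_h(q), descends to the quotient.
    One turn of the geodesic gives gamma(s + L) = gamma(s) (0, P) ([geodesic_periodic]). Hence (q,
    s) -> f(q gamma(s)) beta_h(q^-1) is invariant under the action of the integers by (q, s) -> (q
    (0, jP), s - jL). The quotient domain times the line, and the group times [0, L), are two
    fundamental domains of this action, so integrating over one or the other gives the same result
    ([ge0_fundamental_integral], [geodesic_unfold], [geo_int_weight]). The substitution p = q
    gamma(s) preserves Haar measure and turns beta_h(q^-1) into beta_h(gamma(s)) beta_h(p^-1). What
    results is the integral over [0, L) of beta_h(gamma(s)) applied to the Fourier transform of f at
    h ([quot_fourierE]). For s = theta / lam the operator beta_h(gamma(s)) equals beta_n(rho e^(i
    theta), theta / 2) with rho = 1 / sqrt D ([beta_geodesic]), and the dilation by 1 / lam produces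
    2 pi / lam times J_n(rho) ([arc_integral], [JopE]).

    All these manipulations are scalar: operators are applied to F and evaluated at a point zeta.
    This is legitimate because point evaluations are bounded on Fock space ([fock_eval_le]), so that
    a Bochner integral, when it exists, is the pointwise integral ([bochner_eval]). Boundedness of
    evaluation and the reproducing formula come from the mean value property over circles, that is,
    from Goursat's theorem ([goursat], [circle_mean], [gauss_mean], [fock_reproducing]).

    The terms [adjoint], [bochner] and [geo_transform] are chosen values, so each needs existence
    and uniqueness. The adjoint of beta_h(q) is beta_h(q^-1) ([adjoint_beta]). Bochner integrals
    exist by [bochner_exists]: the scalar factor and the group element are approximated by simple
    maps, unitarity makes the norms converge, pointwise convergence plus convergence of norms gives
    norm convergence ([fock_scheffe]), and dominated convergence concludes; the pointwise integral
    lies in Fock space because it inherits the reproducing formula ([fock_fock_integral]). The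
    geodesic transform exists by density of Cc in L1 ([Cc_dense]) and the L1 bound [geo_int_L1_le],
    and it agrees almost everywhere with the orbital integral ([is_geo_transform_ae]). *)

Local Notation Re := complex.Re.
Local Notation Im := complex.Im.

                        

(** * Complex arithmetic in coordinates *)

Section complex_arith.
Context {R : realType}.
Implicit Types z w : R[i].

Lemma complex_ext z w : Re z = Re w -> Im z = Im w -> z = w.
Proof. by case: z w => a b [c d] /= -> ->. Qed.

Lemma ReD z w : Re (z + w) = Re z + Re w.
Proof. by case: z w => a b []. Qed.

Lemma ImD z w : Im (z + w) = Im z + Im w.
Proof. by case: z w => a b []. Qed.

Lemma ReN z : Re (- z) = - Re z. Proof. by case: z. Qed.

Lemma ImN z : Im (- z) = - Im z. Proof. by case: z. Qed.

Lemma ReB z w : Re (z - w) = Re z - Re w. Proof. by rewrite ReD ReN. Qed.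

Lemma ImB z w : Im (z - w) = Im z - Im w. Proof. by rewrite ImD ImN. Qed.

Lemma ReM z w : Re (z * w) = Re z * Re w - Im z * Im w.
Proof. by case: z w => a b []. Qed.

Lemma ImM z w : Im (z * w) = Re z * Im w + Im z * Re w.
Proof. by case: z w => a b []. Qed.

Lemma ReJ z : Re (conjc z) = Re z. Proof. by case: z. Qed.

Lemma ImJ z : Im (conjc z) = - Im z. Proof. by case: z. Qed.

Definition ReImE := (ReD, ImD, ReN, ImN, ReM, ImM, ReJ, ImJ).

Lemma cmod_ge0 z : 0 <= cmod z. Proof. exact: sqrtr_ge0. Qed.

Lemma cmod_sqr z : cmod z ^+ 2 = Re z ^+ 2 + Im z ^+ 2.
Proof. by rewrite sqr_sqrtr// addr_ge0// sqr_ge0. Qed.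

Lemma normc_cmod z : `|z| = (cmod z)%:C. Proof. exact: normc_def. Qed.

Lemma cmodE z : cmod z = Normc.normc z. Proof. by case: z. Qed.

Lemma cmodM z w : cmod (z * w) = cmod z * cmod w.
Proof. by rewrite !cmodE Normc.normcM. Qed.

Lemma cmodD z w : cmod (z + w) <= cmod z + cmod w.
Proof. by rewrite !cmodE; exact: le_normcD. Qed.

Lemma cmodN z : cmod (- z) = cmod z.
Proof. by rewrite /cmod ReN ImN !sqrrN. Qed.

Lemma cmodB z w : cmod (z - w) = cmod (w - z).
Proof. by rewrite -cmodN opprB. Qed.

Lemma cmod0 : cmod (0 : R[i]) = 0.
Proof. by rewrite cmodE Normc.normc0. Qed.

Lemma cmod1 : cmod (1 : R[i]) = 1.
Proof. by rewrite cmodE Normc.normc1. Qed.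

Lemma cmod_eq0 z : cmod z = 0 -> z = 0.
Proof. by rewrite cmodE; exact: Normc.eq0_normc. Qed.

Lemma cmodJ z : cmod (conjc z) = cmod z.
Proof. by rewrite /cmod ReJ ImJ sqrrN. Qed.

Lemma cmodR (x : R) : cmod (x%:C) = `|x|.
Proof. by rewrite /cmod /= expr0n addr0 sqrtr_sqr. Qed.

Lemma cmod_i : cmod ('i : R[i]) = 1.
Proof. by rewrite /cmod /= expr0n add0r expr1n sqrtr1. Qed.

Lemma normr_Re_le z : `|Re z| <= cmod z.
Proof.
rewrite -(@ler_pXn2r _ 2)// ?nnegrE ?cmod_ge0//.
by rewrite cmod_sqr real_normK ?num_real// lerDl sqr_ge0.
Qed.

Lemma normr_Im_le z : `|Im z| <= cmod z.
Proof.
rewrite -(@ler_pXn2r _ 2)// ?nnegrE ?cmod_ge0//.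
by rewrite cmod_sqr real_normK ?num_real// lerDr sqr_ge0.
Qed.

Lemma cmod_le_ReIm z : cmod z <= `|Re z| + `|Im z|.
Proof.
rewrite [in leLHS](complexE z) (le_trans (cmodD _ _))// cmodM !cmodR.
by rewrite cmod_i mul1r.
Qed.

Lemma cmodD_sqr z w : cmod (z + w) ^+ 2 <= 2 * cmod z ^+ 2 + 2 * cmod w ^+ 2.
Proof.
rewrite !cmod_sqr !ReImE; set a := Re z; set b := Im z; set c := Re w.
set d := Im w; have := sqr_ge0 (a - c); have := sqr_ge0 (b - d); nra.
Qed.

Lemma conjcM z w : conjc (z * w) = conjc z * conjc w.
Proof. by apply: complex_ext; rewrite !ReImE; ring. Qed.

Lemma mulJc z : z * conjc z = (cmod z ^+ 2)%:C.
Proof. by apply: complex_ext; rewrite !ReImE ?cmod_sqr /=; ring. Qed.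

Lemma cexpD z w : cexp (z + w) = cexp z * cexp w.
Proof.
by apply: complex_ext; rewrite ?ReM ?ImM /= ?ReD ?ImD expRD ?cosD ?sinD; ring.
Qed.

Lemma cexp0 : cexp (0 : R[i]) = 1.
Proof. by apply: complex_ext; rewrite /= expR0 ?cos0 ?sin0 mul1r. Qed.

Lemma cexpN z : cexp (- z) * cexp z = 1.
Proof. by rewrite -cexpD addNr cexp0. Qed.

Lemma cmod_cexp z : cmod (cexp z) = expR (Re z).
Proof.
rewrite /cmod /= !exprMn -mulrDr cos2Dsin2 mulr1 sqrtr_sqr.
by rewrite ger0_norm// expR_ge0.
Qed.

Lemma cexpJ z : conjc (cexp z) = cexp (conjc z).
Proof. by apply: complex_ext; rewrite !ReImE /= ?ReJ ?ImJ ?cosN ?sinN ?mulrN. Qed.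

Lemma cexp_i2pi (x : R) : cexp (2 * 'i%C * x%:C) = cos (2 * x) +i* sin (2 * x).
Proof.
have -> : 2 * 'i%C * x%:C = 0 +i* (2 * x) :> R[i].
  have -> : (2 : R[i]) = (2 : R)%:C by rewrite rmorphMn.
  by apply: complex_ext; rewrite !ReImE/=; ring.
by rewrite /cexp /= expR0 !mul1r.
Qed.

Lemma cexp_2piZ (n : int) : cexp (2 * 'i%C * (n%:~R * pi)%:C) = 1 :> R[i].
Proof.
have H m : cexp (2 * 'i%C * ((m%:R : R) * pi)%:C) = 1 :> R[i].
  elim: m => [|m IH]; first by rewrite mul0r mulr0 cexp0.
  have -> : 2 * 'i%C * (m.+1%:R * pi)%:C
      = 2 * 'i%C * (m%:R * pi)%:C + 2 * 'i%C * pi%:C :> R[i].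
    by rewrite -natr1; apply: complex_ext; rewrite !ReImE/=; ring.
  by rewrite cexpD IH mul1r cexp_i2pi mulr_natl cos2pi sin2pi.
case: n => m; first exact: H.
have -> : 2 * 'i%C * ((Negz m)%:~R * pi)%:C
    = - (2 * 'i%C * (m.+1%:R * pi)%:C) :> R[i].
  by rewrite NegzE; apply: complex_ext; rewrite !ReImE/=; ring.
by rewrite -[RHS](cexpN (2 * 'i%C * (m.+1%:R * pi)%:C)) (H m.+1) mulr1.
Qed.

End complex_arith.

                                 

(** * Measurability and integration of complex-valued functions *)

Section cintegral_theory.
Context d (T : measurableType d) (R : realType).
Implicit Types (D : set T) (f g : T -> R[i]).

Definition cmeasurable D f :=
  measurable_fun D (fun x => Re (f x)) /\ measurable_fun D (fun x => Im (f x)).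

Lemma cmeasurable_cst D (c : R[i]) : cmeasurable D (fun=> c).
Proof. by split; exact: measurable_cst. Qed.

Lemma eq_cmeasurable D f g : (forall x, D x -> f x = g x) ->
  cmeasurable D f -> cmeasurable D g.
Proof.
move=> fg [mf mf']; split; [apply: eq_measurable_fun mf|apply: eq_measurable_fun mf'].
  by move=> x /set_mem Dx /=; rewrite fg.
by move=> x /set_mem Dx /=; rewrite fg.
Qed.

Lemma cmeasurableD D f g : cmeasurable D f -> cmeasurable D g ->
  cmeasurable D (fun x => f x + g x).
Proof.
move=> [mf mf'] [mg mg']; split.
  by under eq_fun do rewrite ReD; exact: measurable_funD.
by under eq_fun do rewrite ImD; exact: measurable_funD.
Qed.

Lemma cmeasurableB D f g : cmeasurable D f -> cmeasurable D g ->
  cmeasurable D (fun x => f x - g x).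
Proof.
move=> [mf mf'] [mg mg']; split.
  by under eq_fun do rewrite ReB; exact: measurable_funB.
by under eq_fun do rewrite ImB; exact: measurable_funB.
Qed.

Lemma cmeasurableM D f g : cmeasurable D f -> cmeasurable D g ->
  cmeasurable D (fun x => f x * g x).
Proof.
move=> [mf mf'] [mg mg']; split.
  by under eq_fun do rewrite ReM; apply: measurable_funB; exact: measurable_funM.
by under eq_fun do rewrite ImM; apply: measurable_funD; exact: measurable_funM.
Qed.

Lemma cmeasurable_sum D n (f : 'I_n -> T -> R[i]) :
  (forall i, cmeasurable D (f i)) -> cmeasurable D (fun x => \sum_(i < n) f i x).
Proof.
elim: n f => [|n IH] f mf.
  by apply: eq_cmeasurable (cmeasurable_cst D 0) => x _; rewrite big_ord0.
apply: (@eq_cmeasurable _ (fun x => \sum_(i < n) f (widen_ord (leqnSn n) i) x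
    + f ord_max x)); first by move=> x _; rewrite big_ord_recr.
by apply: cmeasurableD => //; exact: IH.
Qed.

Lemma cmeasurableJ D f : cmeasurable D f -> cmeasurable D (fun x => conjc (f x)).
Proof.
move=> [mf mf']; split.
  by under eq_fun do rewrite ReJ.
by under eq_fun do rewrite ImJ; exact: measurable_funN.
Qed.

Lemma cmeasurableR D (f : T -> R) : measurable_fun D f ->
  cmeasurable D (fun x => (f x)%:C).
Proof. by move=> mf; split => //=; exact: measurable_cst. Qed.

Lemma measurable_cmod D f : cmeasurable D f ->
  measurable_fun D (fun x => cmod (f x)).
Proof.
move=> [mf mf']; rewrite /cmod.
apply: (@measurableT_comp _ _ _ _ _ _ (@Num.sqrt R)).
  by apply: continuous_measurable_fun; exact: sqrt_continuous.
by apply: measurable_funD; exact: measurable_funX.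
Qed.

Lemma cmeasurableS D (E : set T) f : measurable E -> D `<=` E ->
  cmeasurable E f -> cmeasurable D f.
Proof. by move=> mE DE [mf mf']; split; exact: measurable_funS mf || exact: measurable_funS mf'. Qed.

Lemma cmeasurableT D f : cmeasurable setT f -> cmeasurable D f.
Proof. by move=> mf; exact: cmeasurableS mf. Qed.

Section measure.
Variable mu : {measure set T -> \bar R}.

Lemma cintegrableP D f : measurable D ->
  cintegrable mu D f <->
  cmeasurable D f /\ (\int[mu]_(x in D) (cmod (f x))%:E < +oo)%E.
Proof.
move=> mD; split=> [[/integrableP[mf If] /integrableP[mf' If']]|[[mf mf'] If]].
  have [rf rf'] : cmeasurable D f by split; exact/measurable_EFinP.
  have mc := measurable_cmod (conj rf rf'); split; first by [].
  apply: (@le_lt_trans _ _ (\int[mu]_(x in D) (`|(Re (f x))%:E| + `|(Im (f x))%:E|))%E).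
    apply: ge0_le_integral => //.
    - by move=> x _; rewrite lee_fin cmod_ge0.
    - exact/measurable_EFinP.
    - by apply: emeasurable_funD; apply: measurableT_comp.
    - by move=> x _; rewrite !abse_EFin -EFinD lee_fin cmod_le_ReIm.
  rewrite ge0_integralD//; first exact: lte_add_pinfty.
  - by apply: measurableT_comp.
  - by apply: measurableT_comp.
have mc := measurable_cmod (conj mf mf').
split; apply/integrableP; split; try exact/measurable_EFinP.
- apply: le_lt_trans If; apply: ge0_le_integral => //.
  + by apply: measurableT_comp => //; exact/measurable_EFinP.
  + exact/measurable_EFinP.
  + by move=> x _; rewrite lee_fin normr_Re_le.
- apply: le_lt_trans If; apply: ge0_le_integral => //.
  + by apply: measurableT_comp => //; exact/measurable_EFinP.
  + exact/measurable_EFinP.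
  + by move=> x _; rewrite lee_fin normr_Im_le.
Qed.

Lemma le_cintegrable D f (g : T -> R) : measurable D -> cmeasurable D f ->
  mu.-integrable D (EFin \o g) -> (forall x, D x -> cmod (f x) <= g x) ->
  cintegrable mu D f.
Proof.
move=> mD mf ig fg; have /integrableP[mg Ig] := ig.
apply/cintegrableP => //; split => //.
apply: le_lt_trans Ig; apply: ge0_le_integral => //.
- by move=> x _; rewrite lee_fin cmod_ge0.
- by apply/measurable_EFinP; exact: measurable_cmod.
- by apply: measurableT_comp.
- by move=> x Dx; rewrite lee_fin (le_trans (fg _ Dx))// ler_norm.
Qed.

Lemma eq_cintegral D f g : (forall x, D x -> f x = g x) ->
  cintegral mu D f = cintegral mu D g.
Proof.
move=> fg; rewrite /cintegral.
by congr (_ +i* _); apply: eq_Rintegral => x /set_mem Dx; rewrite fg.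
Qed.

Lemma eq_cintegrable D f g : measurable D -> (forall x, D x -> f x = g x) ->
  cintegrable mu D f -> cintegrable mu D g.
Proof.
move=> mD fg [mf mf']; split;
  [apply: eq_integrable mf => //|apply: eq_integrable mf' => //];
by move=> x /set_mem Dx /=; rewrite fg.
Qed.

Lemma cintegrableD D f g : measurable D -> cintegrable mu D f ->
  cintegrable mu D g -> cintegrable mu D (fun x => f x + g x).
Proof.
move=> mD [f1 f2] [g1 g2]; split.
  apply: eq_integrable (integrableD mD f1 g1) => // x _ /=.
  by rewrite ReD.
apply: eq_integrable (integrableD mD f2 g2) => // x _ /=.
by rewrite ImD.
Qed.

Lemma cintegrableB D f g : measurable D -> cintegrable mu D f ->
  cintegrable mu D g -> cintegrable mu D (fun x => f x - g x).
Proof.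
move=> mD [f1 f2] [g1 g2]; split.
  apply: eq_integrable (integrableB mD f1 g1) => // x _ /=.
  by rewrite ReB.
apply: eq_integrable (integrableB mD f2 g2) => // x _ /=.
by rewrite ImB.
Qed.

Lemma cintegrableZl D f (c : R[i]) : measurable D -> cintegrable mu D f ->
  cintegrable mu D (fun x => c * f x).
Proof.
move=> mD [f1 f2]; split.
  apply: eq_integrable (integrableB mD (integrableZl mD (Re c) f1)
    (integrableZl mD (Im c) f2)) => // x _ /=.
  by rewrite ReM EFinB !EFinM.
apply: eq_integrable (integrableD mD (integrableZl mD (Re c) f2)
    (integrableZl mD (Im c) f1)) => // x _ /=.
by rewrite ImM EFinD !EFinM.
Qed.

Lemma cintegralD D f g : measurable D -> cintegrable mu D f ->
  cintegrable mu D g ->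
  cintegral mu D (fun x => f x + g x) = cintegral mu D f + cintegral mu D g.
Proof.
move=> mD [f1 f2] [g1 g2]; apply: complex_ext; rewrite ?ReD ?ImD /=.
  by rewrite -RintegralD//; apply: eq_Rintegral => x _; rewrite ReD.
by rewrite -RintegralD//; apply: eq_Rintegral => x _; rewrite ImD.
Qed.

Lemma cintegralB D f g : measurable D -> cintegrable mu D f ->
  cintegrable mu D g ->
  cintegral mu D (fun x => f x - g x) = cintegral mu D f - cintegral mu D g.
Proof.
move=> mD [f1 f2] [g1 g2]; apply: complex_ext; rewrite ?ReB ?ImB /=.
  by rewrite -RintegralB//; apply: eq_Rintegral => x _; rewrite ReB.
by rewrite -RintegralB//; apply: eq_Rintegral => x _; rewrite ImB.
Qed.

Lemma cintegralZl D f (c : R[i]) : measurable D -> cintegrable mu D f ->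
  cintegral mu D (fun x => c * f x) = c * cintegral mu D f.
Proof.
move=> mD [f1 f2]; apply: complex_ext; rewrite ?ReM ?ImM /=.
  rewrite -!RintegralZl// -RintegralB//; first last.
  - by apply: eq_integrable (integrableZl mD (Im c) f2).
  - by apply: eq_integrable (integrableZl mD (Re c) f1).
  by apply: eq_Rintegral => x _; rewrite ReM.
rewrite -!RintegralZl// -RintegralD//; first last.
- by apply: eq_integrable (integrableZl mD (Im c) f1).
- by apply: eq_integrable (integrableZl mD (Re c) f2).
by apply: eq_Rintegral => x _; rewrite ImM.
Qed.

Lemma cintegral_sum D n (f : 'I_n -> T -> R[i]) : measurable D ->
  (forall i, cintegrable mu D (f i)) ->
  cintegrable mu D (fun x => \sum_(i < n) f i x) /\
  cintegral mu D (fun x => \sum_(i < n) f i x)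
    = \sum_(i < n) cintegral mu D (f i).
Proof.
move=> mD; elim: n f => [|n IH] f If.
  rewrite big_ord0; split.
    apply: (eq_cintegrable (f := fun=> 0)) => //; first by move=> x _; rewrite big_ord0.
    by split; exact: integrable0.
  rewrite (@eq_cintegral _ _ (fun=> 0)); last by move=> x _; rewrite big_ord0.
  by rewrite /cintegral /Rintegral !integral0.
have [I1 I2] := IH (fun i => f (widen_ord (leqnSn n) i)) (fun i => If _).
split.
  apply: (eq_cintegrable (f := fun x => \sum_(i < n) f (widen_ord (leqnSn n) i) x
    + f ord_max x)) => //; first by move=> x _; rewrite big_ord_recr.
  exact: cintegrableD.
rewrite big_ord_recr /= -I2 -cintegralD//.
by apply: eq_cintegral => x _; rewrite big_ord_recr.
Qed.

(** The factor 2 comes from bounding the real and imaginary parts separately; it propagates into the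
    norm estimates on Fock space. *)
Lemma cmod_cintegral_le D f : measurable D -> cmeasurable D f ->
  ((cmod (cintegral mu D f))%:E <= 2%:E * \int[mu]_(x in D) (cmod (f x))%:E)%E.
Proof.
move=> mD mf.
have [If|] := ltP (\int[mu]_(x in D) (cmod (f x))%:E)%E +oo%E; last first.
  by rewrite leye_eq => /eqP ->; rewrite mulry gtr0_sg// mul1e leey.
have [i1 i2] : cintegrable mu D f by apply/cintegrableP.
have ic : mu.-integrable D (EFin \o (fun x => cmod (f x))).
  apply/integrableP; split; first by apply/measurable_EFinP; exact: measurable_cmod.
  under eq_integral do rewrite /= ger0_norm ?cmod_ge0//.
  exact: If.
have -> : (\int[mu]_(x in D) (cmod (f x))%:E)%E =
    (Rintegral mu D (fun x => cmod (f x)))%:E.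
  by rewrite /Rintegral fineK//; exact: integrable_fin_num.
rewrite -EFinM lee_fin (le_trans (cmod_le_ReIm _))//= mulr_natl mulr2n.
apply: lerD; rewrite (le_trans (le_normr_Rintegral _ _))//.
  apply: le_Rintegral => //; first exact: integrable_norm.
  by move=> x _; exact: normr_Re_le.
apply: le_Rintegral => //; first exact: integrable_norm.
by move=> x _; exact: normr_Im_le.
Qed.

(** Extension by zero: it reduces integrals over D to integrals over the whole space, where Fubini
    and the transport lemmas are stated. *)
Definition crestrict D f : T -> R[i] := fun x => if x \in D then f x else 0.

Lemma cintegral_mkcond D f : cintegral mu D f = cintegral mu setT (crestrict D f).
Proof.
rewrite /cintegral [in LHS]Rintegral_mkcond [X in _ +i* X]Rintegral_mkcond.
by congr (_ +i* _); apply: eq_Rintegral => x _; rewrite patchE /crestrict;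
  case: ifP.
Qed.

Lemma cintegrable_mkcond D f : measurable D ->
  cintegrable mu D f <-> cintegrable mu setT (crestrict D f).
Proof.
move=> mD; rewrite /cintegrable !(integrable_mkcond _ mD).
rewrite (_ : (_ \_ D) = EFin \o (fun x => Re (crestrict D f x))); last first.
  by apply/funext => x /=; rewrite patchE /crestrict; case: ifP.
rewrite (_ : (_ \_ D) = EFin \o (fun x => Im (crestrict D f x)))//.
by apply/funext => x /=; rewrite patchE /crestrict; case: ifP.
Qed.

Lemma cmeasurable_mkcond D f : measurable D ->
  cmeasurable D f <-> cmeasurable setT (crestrict D f).
Proof.
move=> mD; rewrite /cmeasurable.
rewrite (_ : (fun x => Re (crestrict D f x)) = (fun x => Re (f x)) \_ D); last first.
  by apply/funext => x /=; rewrite patchE /crestrict; case: ifP.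
rewrite (_ : (fun x => Im (crestrict D f x)) = (fun x => Im (f x)) \_ D); last first.
  by apply/funext => x /=; rewrite patchE /crestrict; case: ifP.
by rewrite -!(measurable_restrictT _ mD).
Qed.

Lemma ae_eq_cintegral D f g : measurable D -> cmeasurable D f ->
  cmeasurable D g -> ae_eq mu D f g -> cintegral mu D f = cintegral mu D g.
Proof.
move=> mD [f1 f2] [g1 g2] fg; rewrite /cintegral /Rintegral.
congr (fine _ +i* fine _); apply: ae_eq_integral => //;
  try exact/measurable_EFinP; by apply: filterS fg => x + Dx => /= ->.
Qed.

Lemma cmeasurable_ae_eq0 D f : measurable D -> cmeasurable D f ->
  (\int[mu]_(x in D) (cmod (f x))%:E = 0)%E -> ae_eq mu D f (fun=> 0).
Proof.
move=> mD mf f0; have mc := measurable_cmod mf.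
have /ae_eq_integral_abs : measurable_fun D (EFin \o (fun x => cmod (f x))).
  exact/measurable_EFinP.
move=> /(_ mu mD)[+ _]; under eq_integral do rewrite /= ger0_norm ?cmod_ge0//.
by move=> /(_ f0); apply: filterS => x + Dx => /(_ Dx) [/cmod_eq0].
Qed.

End measure.
End cintegral_theory.

Lemma cmeasurable_comp d d' (T : measurableType d) (T' : measurableType d')
    (R : realType) (f : T' -> R[i]) (phi : T -> T') (D : set T) :
  cmeasurable setT f -> measurable_fun D phi -> cmeasurable D (fun x => f (phi x)).
Proof. by move=> [f1 f2] mphi; split; [exact: measurableT_comp f1 mphi|exact: measurableT_comp f2 mphi]. Qed.

(** * Measure-preserving maps, Fubini, and rotations of the plane *)

Section measure_preserving.
Context d d' (X : measurableType d) (Y : measurableType d') (R : realType).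
Variables (mu : {measure set X -> \bar R}) (nu : {measure set Y -> \bar R}).

(** Stated through integrals of nonnegative functions instead of measures of sets, so that
    composites and skew products follow from Tonelli without a generating-class argument. *)
Definition mpres (phi : X -> Y) : Prop :=
  measurable_fun setT phi /\
  forall g : Y -> \bar R, measurable_fun setT g -> (forall y, 0 <= g y)%E ->
    (\int[mu]_x g (phi x) = \int[nu]_y g y)%E.

Variable phi : X -> Y.
Hypothesis pphi : mpres phi.

Lemma mpres_integral (g : Y -> \bar R) : measurable_fun setT g ->
  (\int[mu]_x g (phi x) = \int[nu]_y g y)%E.
Proof.
move=> mg; have [_ hphi] := pphi; rewrite integralE [RHS]integralE.
rewrite -(hphi g^\+)%E//; last exact: measurable_funepos.
rewrite -(hphi g^\-)%E//; last exact: measurable_funeneg.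
by congr (_ - _)%E; apply: eq_integral => x _; rewrite ?funeposE ?funenegE.
Qed.

Lemma mpres_cintegral (g : Y -> R[i]) : cmeasurable setT g ->
  cintegral mu setT (fun x => g (phi x)) = cintegral nu setT g.
Proof.
move=> [g1 g2]; rewrite /cintegral /Rintegral; congr (fine _ +i* fine _).
  by rewrite (mpres_integral (g := fun y => (Re (g y))%:E))//; exact/measurable_EFinP.
by rewrite (mpres_integral (g := fun y => (Im (g y))%:E))//; exact/measurable_EFinP.
Qed.

Lemma mpres_cintegrable (g : Y -> R[i]) : cintegrable nu setT g ->
  cintegrable mu setT (fun x => g (phi x)).
Proof.
move=> /cintegrableP -/(_ measurableT)[mg Ig]; apply/cintegrableP => //.
split; first by apply: (cmeasurable_comp mg); exact: pphi.1.
rewrite (pphi.2 (fun y => (cmod (g y))%:E))//.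
  by apply/measurable_EFinP; exact: measurable_cmod.
by move=> y; rewrite lee_fin cmod_ge0.
Qed.

End measure_preserving.

Lemma mpres_comp d1 d2 d3 (X : measurableType d1) (Y : measurableType d2)
    (Z : measurableType d3) (R : realType) (m1 : {measure set X -> \bar R})
    (m2 : {measure set Y -> \bar R}) (m3 : {measure set Z -> \bar R})
    (phi : X -> Y) (psi : Y -> Z) :
  mpres m1 m2 phi -> mpres m2 m3 psi -> mpres m1 m3 (fun x => psi (phi x)).
Proof.
move=> [mphi hphi] [mpsi hpsi]; split; first exact: measurableT_comp mpsi mphi.
move=> g mg g0; rewrite (hphi (fun y => g (psi y)))//; first exact: hpsi.
exact: measurableT_comp mg mpsi.
Qed.

Section product_preserving.
Context d1 d2 (X : measurableType d1) (Y : measurableType d2) (R : realType).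
Variables (m1 : {sigma_finite_measure set X -> \bar R}).
Variables (m2 : {sigma_finite_measure set Y -> \bar R}).

Lemma mpres_swap : mpres (m1 \x m2)%E (m2 \x m1)%E (fun p => (p.2, p.1)).
Proof.
split; first by apply/measurable_fun_pairP; split => //=; exact: measurable_snd || exact: measurable_fst.
move=> g mg g0.
have ms : measurable_fun setT (fun p : X * Y => (p.2, p.1)).
  by apply/measurable_fun_pairP; split => //=; exact: measurable_snd || exact: measurable_fst.
rewrite fubini_tonelli1//; last exact: measurableT_comp mg ms.
by rewrite fubini_tonelli2.
Qed.

(** Tonelli reduces the claim to the fibres: each [psi x] preserves [m2], and then [phi] preserves
    [m1]. Shears, right multiplication in the Heisenberg group and the action used for unfolding are
    all of this form. *)
Lemma mpres_skew (phi : X -> X) (psi : X -> Y -> Y) :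
  mpres m1 m1 phi -> (forall x, mpres m2 m2 (psi x)) ->
  measurable_fun setT (fun p : X * Y => psi p.1 p.2) ->
  mpres (m1 \x m2)%E (m1 \x m2)%E (fun p => (phi p.1, psi p.1 p.2)).
Proof.
move=> [mphi hphi] hpsi mpsi.
have m : measurable_fun setT (fun p : X * Y => (phi p.1, psi p.1 p.2)).
  by apply/measurable_fun_pairP; split => //=; exact: measurableT_comp mphi _.
split=> // g mg g0; rewrite fubini_tonelli1//; last exact: measurableT_comp mg m.
rewrite [RHS]fubini_tonelli1//.
have mF : measurable_fun setT (fubini_F m2 g).
  exact: measurable_fun_fubini_tonelli_F.
have F0 x : (0 <= fubini_F m2 g x)%E by exact: integral_ge0.
rewrite -(hphi _ mF F0).
apply: eq_integral => x _; rewrite /fubini_F /=.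
rewrite ((hpsi x).2 (fun y => g (phi x, y)))//.
exact: measurableT_comp mg _.
Qed.

Lemma Rintegral_fubini (f : X * Y -> R) :
  (m1 \x m2)%E.-integrable setT (EFin \o f) ->
  m1.-integrable setT (EFin \o (fun x => Rintegral m2 setT (fun y => f (x, y)))) /\
  Rintegral m1 setT (fun x => Rintegral m2 setT (fun y => f (x, y))) =
  Rintegral (m1 \x m2)%E setT f.
Proof.
move=> If; have IF := integrable_fubini_F If; have mF := measurable_fubini_F If.
(* The inner integral may be infinite on a null set, where [fine] returns 0, so the two sides agree
   only almost everywhere. *)
have E : ae_eq m1 setT (fubini_F m2 (EFin \o f))
    (EFin \o (fun x => Rintegral m2 setT (fun y => f (x, y)))).
  have := integrable_ae measurableT IF.
  by apply: filterS => x /= + _ => /(_ I) /fineK ->.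
have mR : measurable_fun setT
    (EFin \o (fun x => Rintegral m2 setT (fun y => f (x, y)))).
  by apply/measurable_EFinP; exact: measurableT_comp mF.
split; last first.
  rewrite /Rintegral -(integral12_prod_meas1 If); congr fine.
  by apply: ae_eq_integral => //; apply: filterS E => x + Dx => /(_ Dx).
apply/integrableP; split => //; case/integrableP : IF => _.
apply: le_lt_trans; rewrite le_eqVlt; apply/orP; left; apply/eqP.
apply: ae_eq_integral => //; try exact: measurableT_comp.
by apply: filterS E => x + Dx => /(_ Dx) /= ->.
Qed.

Lemma cintegral_fubini (f : X * Y -> R[i]) :
  cintegrable (m1 \x m2)%E setT f ->
  cintegrable m1 setT (fun x => cintegral m2 setT (fun y => f (x, y))) /\
  cintegral m1 setT (fun x => cintegral m2 setT (fun y => f (x, y))) =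
  cintegral (m1 \x m2)%E setT f.
Proof.
by move=> [/Rintegral_fubini[I1 E1] /Rintegral_fubini[I2 E2]]; split => //;
  rewrite /cintegral E1 E2.
Qed.

End product_preserving.

Lemma cintegral_fubini_swap d1 d2 (X : measurableType d1) (Y : measurableType d2)
    (R : realType) (m1 : {sigma_finite_measure set X -> \bar R})
    (m2 : {sigma_finite_measure set Y -> \bar R}) (f : X * Y -> R[i]) :
  cintegrable (m1 \x m2)%E setT f ->
  cintegrable m2 setT (fun y => cintegral m1 setT (fun x => f (x, y))) /\
  cintegral m2 setT (fun y => cintegral m1 setT (fun x => f (x, y))) =
  cintegral (m1 \x m2)%E setT f.
Proof.
move=> If; have sw := mpres_swap m2 m1.
have [I1 E1] := cintegral_fubini (mpres_cintegrable sw If).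
split => //; rewrite -(mpres_cintegral sw) ?E1//.
by have /cintegrableP -/(_ measurableT)[] := If.
Qed.

Section lebesgue_preserving.
Variable R : realType.
Let mu := @lebesgue_measure R.

Lemma mpres_translation (a : R) :
  mpres mu mu (fun x : measurableTypeR R => x + a : measurableTypeR R).
Proof.
have mt : measurable_fun setT (fun x : measurableTypeR R => x + a : measurableTypeR R).
  by apply: measurable_funD => //; exact: measurable_cst.
pose phi : {mfun measurableTypeR R >-> measurableTypeR R} :=
  HB.pack (fun x : measurableTypeR R => x + a : measurableTypeR R)
    (isMeasurableFun.Build _ _ _ _ _ mt).
(* A measure with the right value on half-open intervals is Lebesgue measure. *)
have E A : measurable A -> mu A = pushforward mu phi A.
  apply: lebesgue_measure_unique => //= _ [[b c]] _ <-.
  rewrite /pushforward /=.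
  rewrite (_ : _ @^-1` _ = `]b - a, c - a]%classic); last first.
    by apply/seteqP; split => x /=; rewrite !in_itv/= ltrBlDr lerBrDr.
  rewrite !lebesgue_measure_itv/= !lte_fin ltrD2r.
  by case: ifP => // _; rewrite -!EFinB; congr EFin; ring.
split=> // g mg g0.
rewrite [RHS](@eq_measure_integral _ _ _ _ (pushforward mu phi)).
  by rewrite ge0_integral_pushforward//= preimage_setT.
by move=> A mA _; exact: E.
Qed.

Lemma mpres_translation2 (a : R * R) :
  mpres (leb2 R) (leb2 R) (fun z => (z.1 + a.1, z.2 + a.2)).
Proof.
apply: (@mpres_skew _ _ _ _ _ mu mu (fun x => x + a.1) (fun _ y => y + a.2)).
- exact: mpres_translation.
- by move=> _; exact: mpres_translation.
- by apply: measurable_funD => //; exact: measurable_cst.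
Qed.

Lemma mpres_shear2 (c : R) :
  mpres (leb2 R) (leb2 R) (fun z => (z.1, z.2 + c * z.1)).
Proof.
apply: (@mpres_skew _ _ _ _ _ mu mu id (fun x y => y + c * x)).
- by split.
- by move=> x; exact: mpres_translation.
- by apply: measurable_funD => //; apply: measurable_funM => //; exact: measurable_cst.
Qed.

Lemma mpres_shear1 (c : R) :
  mpres (leb2 R) (leb2 R) (fun z => (z.1 + c * z.2, z.2)).
Proof.
have s := mpres_swap mu mu.
by have := mpres_comp s (mpres_comp (mpres_shear2 c) s).
Qed.

                                                                                
                                           
(** A rotation is a product of three shears, except for the half turn, which is the square of a
    quarter turn. Shears preserve area because they are translations on each line. *)
Lemma mpres_rotation (a b : R) : a ^+ 2 + b ^+ 2 = 1 ->
  mpres (leb2 R) (leb2 R) (fun z => (a * z.1 - b * z.2, b * z.1 + a * z.2)).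
Proof.
have H (c s : R) : c ^+ 2 + s ^+ 2 = 1 -> c != -1 ->
    mpres (leb2 R) (leb2 R) (fun z => (c * z.1 - s * z.2, s * z.1 + c * z.2)).
  move=> cs c1; have d0 : 1 + c != 0 by rewrite addrC addr_eq0.
  (* With (c, s) = (cos t, sin t) this is -tan(t/2), the coefficient of the two outer horizontal
     shears. *)
  pose k := - s / (1 + c); have kc : k * (1 + c) = - s by rewrite /k divfK.
  have sk : s * k = c - 1.
    have s2 : s ^+ 2 = (1 - c) * (1 + c).
      by rewrite -subr_sqr expr1n -cs addrAC subrr add0r.
    by rewrite /k mulrA mulrN -expr2 s2 -mulNr mulfK// opprB.
  have := mpres_comp (mpres_shear1 k)
    (mpres_comp (mpres_shear2 s) (mpres_shear1 k)).
  congr mpres; apply/funext => -[x y] /=; congr pair.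
    have -> : x + k * y + k * (y + s * (x + k * y)) =
        (1 + s * k) * x + (k + k * (1 + s * k)) * y by ring.
    have -> : k + k * (1 + s * k) = - s by rewrite sk -kc; ring.
    by rewrite sk; ring.
  have -> : y + s * (x + k * y) = y + s * x + (s * k) * y by ring.
  by rewrite sk; ring.
move=> ab; have [a1|] := eqVneq a (-1); last exact: H.
have b0 : b = 0.
  by apply/eqP; rewrite -sqrf_eq0; apply/eqP; move: ab; rewrite a1; lra.
have h01 : mpres (leb2 R) (leb2 R)
    (fun z => (0 * z.1 - 1 * z.2, 1 * z.1 + 0 * z.2)).
  by apply: H; [ring|rewrite eq_sym oppr_eq0 oner_eq0].
have := mpres_comp h01 h01; congr mpres; apply/funext => -[x y] /=.
by rewrite a1 b0; congr pair; ring.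
Qed.

End lebesgue_preserving.

                              

(** * Complex differentiability and the exponential *)

Section complex_topology.
Context {R : realType}.
Local Notation C := R[i].

Lemma cvg_ReIm {T : Type} {F : set_system T} {FF : Filter F} (f : T -> C) (l : C) :
  (f : T -> C^o) @ F --> (l : C^o) <->
  (fun x => Re (f x)) @ F --> Re l /\ (fun x => Im (f x)) @ F --> Im l.
Proof.
split=> [/cvgrPdist_lt fl|[/cvgrPdist_lt fl1 /cvgrPdist_lt fl2]].
  split; apply/cvgrPdist_lt => e e0.
    have /fl : (0 < e%:C :> C) by rewrite ltcR.
    apply: filterS => x; rewrite normc_cmod ltcR; apply: le_lt_trans.
    by rewrite -ReB normr_Re_le.
  have /fl : (0 < e%:C :> C) by rewrite ltcR.
  apply: filterS => x; rewrite normc_cmod ltcR; apply: le_lt_trans.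
  by rewrite -ImB normr_Im_le.
apply/cvgrPdist_lt => -[e e'] /[dup] /=; rewrite ltcE /= => /andP[/eqP -> e0] _.
have e20 : 0 < e / 2 by rewrite divr_gt0.
have := fl1 _ e20; have := fl2 _ e20; apply: filterS2 => x h2 h1.
rewrite normc_cmod ltcR (le_lt_trans (cmod_le_ReIm _))// ReB ImB.
by rewrite (splitr e) ltrD.
Qed.

Lemma cvg_cmod {T : Type} {F : set_system T} {FF : Filter F} (f : T -> C) (l : C) :
  (f : T -> C^o) @ F --> (l : C^o) <-> (fun x => cmod (f x - l)) @ F --> 0.
Proof.
split=> [/cvgrPdist_lt fl|/cvgrPdist_lt fl].
  apply/cvgrPdist_lt => e e0; have /fl : (0 < e%:C :> C) by rewrite ltcR.
  apply: filterS => x; rewrite normc_cmod ltcR.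
  by rewrite sub0r normrN ger0_norm ?cmod_ge0// cmodB.
apply/cvgrPdist_lt => -[e e'] /[dup] /=; rewrite ltcE /= => /andP[/eqP -> e0] _.
have := fl _ e0; apply: filterS => x.
by rewrite sub0r normrN ger0_norm ?cmod_ge0// cmodB normc_cmod ltcR.
Qed.

Lemma cont_ReIm {T : topologicalType} (f : T -> C) :
  continuous (f : T -> C^o) <->
  continuous (fun x => Re (f x)) /\ continuous (fun x => Im (f x)).
Proof.
split=> [cf|[cf cf'] x]; last by apply/cvg_ReIm; split; [exact: cf|exact: cf'].
by split=> x; have /cvg_ReIm[] := cf x.
Qed.

(** Division-free form of complex differentiability with moduli in R; [derivable_has_cderiv] matches
    it with the notion in [holomorphic]. *)
Definition has_cderiv (F : C -> C) (z L : C) : Prop :=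
  forall e : R, 0 < e -> exists2 d : R, 0 < d &
    forall h, cmod h < d -> cmod (F (z + h) - F z - h * L) <= e * cmod h.

Lemma derivable_has_cderiv (F : C -> C) (z : C) :
  derivable (F : C^o -> C^o) z 1 <-> exists L, has_cderiv F z L.
Proof.
split=> [/cvg_ex[/= L]|[L FL]].
  move/cvgrPdist_le => FL; exists L => e e0.
  have /FL : (0 < e%:C :> C) by rewrite ltcR.
  rewrite -nbhs_nearE => /nbhs_ballP[/= [d d']].
  rewrite /= ltcE /= => /andP[/eqP -> d0] H; exists d => // h hd.
  have [->|h0] := eqVneq h 0.
    by rewrite addr0 subrr mul0r subr0 cmod0 mulr0.
  have := H h; rewrite /ball /= sub0r normrN normc_cmod ltcR => /(_ hd h0).
  rewrite normc_cmod lecR [_%:A]mulr1 => H'.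
  have -> : F (z + h) - F z - h * L = - h * (L - h^-1 * (F (h + z) - F z)).
    by rewrite (addrC h); field.
  by rewrite cmodM cmodN mulrC ler_wpM2r ?cmod_ge0.
apply/cvg_ex; exists (L : C^o); apply/cvgrPdist_le => -[e e'].
rewrite /= ltcE /= => /andP[/eqP -> e0]; have [d d0 H] := FL _ e0.
rewrite -nbhs_nearE; apply/nbhs_ballP; exists d%:C; first by rewrite /= ltcR.
move=> h; rewrite /ball /= sub0r normrN normc_cmod ltcR => hd h0.
have {}H := H _ hd; rewrite normc_cmod lecR [_%:A]mulr1.
have hp : 0 < cmod h.
  by rewrite lt_neqAle cmod_ge0 andbT eq_sym; apply: contra_neq h0 => /cmod_eq0.
rewrite -(ler_pM2r hp) (le_trans _ H)// -cmodM.
have -> : h^-1 *: (F (h + z) - F z : C^o) = (h^-1 * (F (z + h) - F z) : C).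
  by rewrite (addrC h).
rewrite -[leRHS]cmodN le_eqVlt; apply/orP; left; apply/eqP.
by congr cmod; field.
Qed.

Lemma holomorphicP (F : C -> C) :
  holomorphic F <-> forall z, exists L, has_cderiv F z L.
Proof. by split=> hF z; apply/derivable_has_cderiv; exact: hF. Qed.

Lemma holomorphic_cont (F : C -> C) : holomorphic F ->
  continuous (F : C^o -> C^o).
Proof.
by move=> hF z; apply: differentiable_continuous; apply/derivable1_diffP/hF.
Qed.

Lemma holomorphic_comp (F G : C -> C) : holomorphic F -> holomorphic G ->
  holomorphic (fun z => F (G z)).
Proof.
move=> hF hG z; apply/derivable1_diffP.
apply: (@differentiable_comp _ C^o C^o C^o G F).
  by apply/derivable1_diffP/hG.
by apply/derivable1_diffP/hF.
Qed.

Lemma holomorphicM (F G : C -> C) : holomorphic F -> holomorphic G ->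
  holomorphic (fun z => F z * G z).
Proof.
move=> hF hG z; exact: (@derivableM _ C^o (F : C^o -> C^o) (G : C^o -> C^o)).
Qed.

Lemma holomorphicD (F G : C -> C) : holomorphic F -> holomorphic G ->
  holomorphic (fun z => F z + G z).
Proof.
move=> hF hG z; exact: (@derivableD _ C^o C^o (F : C^o -> C^o) (G : C^o -> C^o)).
Qed.

Lemma holomorphic_cst (c : C) : holomorphic (fun=> c).
Proof. by move=> z; exact: derivable_cst. Qed.

Lemma holomorphic_affine (a b : C) : holomorphic (fun z => a * z + b).
Proof.
apply: holomorphicD; last exact: holomorphic_cst.
apply: holomorphicM; first exact: holomorphic_cst.
by move=> z; exact: derivable_id.
Qed.

Lemma normr_sin_le (x : R) : `|sin x| <= `|x|.
Proof.
have H (y : R) : 0 <= y -> `|sin y| <= y.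
  move=> y0; have [c _] := @MVT_segment R sin cos 0 y y0
    (fun x _ => is_derive_sin x) (continuous_subspaceT (@continuous_sin R)).
  rewrite sin0 !subr0 => ->; rewrite normrM (ger0_norm y0) ler_piMl//.
  by rewrite ler_norml cos_geN1 cos_le1.
have [x0|x0] := leP 0 x; first by rewrite (ger0_norm x0) H.
by rewrite (ltr0_norm x0) -normrN -sinN H// oppr_ge0 ltW.
Qed.

Lemma one_sub_cos (x : R) : 1 - cos x = 2 * sin (x / 2) ^+ 2.
Proof.
by have := cos2Dsin2 (x / 2); rewrite {3}(splitr x) cosD; lra.
Qed.

Lemma one_sub_cos_le (x : R) : 1 - cos x <= x ^+ 2 / 2.
Proof.
rewrite one_sub_cos; have := normr_sin_le (x / 2).
rewrite -(@ler_pXn2r _ 2)// ?nnegrE// !real_normK ?num_real// => h.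
by rewrite (_ : x ^+ 2 / 2 = 2 * (x / 2) ^+ 2) ?ler_pM2l//; field.
Qed.

Lemma one_sub_cos_le_norm (x : R) : 1 - cos x <= `|x|.
Proof.
rewrite one_sub_cos -real_normK ?num_real// expr2.
have h := normr_sin_le (x / 2).
have h1 : `|sin (x / 2)| <= 1 by rewrite ler_norml sin_geN1 sin_le1.
have -> : `|x| = 2 * `|x / 2|.
  by rewrite normrM [`|2^-1|]ger0_norm ?invr_ge0//; field.
by rewrite ler_pM2l// (le_trans _ h)// ler_piMl.
Qed.

Lemma normr_sin_sub_le (x : R) : `|sin x - x| <= x ^+ 2.
Proof.
have H (y : R) : 0 <= y -> `|sin y - y| <= y ^+ 2.
  move=> y0; have [c|c cy] := @MVT_segment R (fun t => sin t - t) (fun t => cos t - 1)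
    0 y y0 (fun x _ => is_deriveB (is_derive_sin x) (is_derive_id x 1)).
    apply: continuous_subspaceT => t; apply: cvgB; first exact: continuous_sin.
    exact: cvg_id.
  rewrite sin0 !subr0 => ->; rewrite normrM (ger0_norm y0) expr2 ler_wpM2r//.
  rewrite -normrN opprB ger0_norm ?subr_ge0 ?cos_le1//.
  rewrite (le_trans (one_sub_cos_le_norm _))//.
  by move: cy; rewrite in_itv/= => /andP[c0 cy]; rewrite ger0_norm.
have [x0|x0] := leP 0 x; first exact: H.
have := H (- x); rewrite oppr_ge0 => /(_ (ltW x0)).
by rewrite sinN sqrrN -opprD normrN.
Qed.

Lemma expR_sub1_le (x : R) : `|expR x - 1| <= `|x| * expR `|x|.
Proof.
have [x0|x0] := leP 0 x.
  rewrite (ger0_norm x0) ger0_norm; last by rewrite subr_ge0 -expR0 ler_expR.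
  have := expR_ge1Dx (- x); have : expR x * expR (- x) = 1 by rewrite -expRD subrr expR0.
  by have := expR_ge0 x; nra.
rewrite (ltr0_norm x0) ler0_norm; last by rewrite subr_le0 -expR0 ler_expR ltW.
rewrite opprB (@le_trans _ _ (- x))//; first by have := expR_ge1Dx x; lra.
by rewrite ler_peMr ?oppr_ge0 ?(ltW x0)// -expR0 ler_expR oppr_ge0 ltW.
Qed.

Lemma expR_sub1x_le (x : R) : `|expR x - 1 - x| <= x ^+ 2 * expR `|x|.
Proof.
have h := expR_ge1Dx x; have h' := expR_ge1Dx (- x).
have e : expR x * expR (- x) = 1 by rewrite -expRD subrr expR0.
have p := expR_ge0 x.
have h1 : 0 <= expR x - 1 - x by lra.
rewrite (ger0_norm h1) (@le_trans _ _ (x * (expR x - 1)))//; first by nra.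
rewrite (@le_trans _ _ `|x * (expR x - 1)|) ?ler_norm// normrM.
by rewrite -real_normK ?num_real// expr2 -mulrA ler_wpM2l// expR_sub1_le.
Qed.

(** Second-order Taylor remainder, assembled from those of the real exponential, sine and cosine. It
    differentiates [cexp] and controls differentiation under the integral in [gint_kernel_hol]. *)
Lemma cexp_sub1z_le (z : C) :
  cmod (cexp z - 1 - z) <= 4 * cmod z ^+ 2 * expR (cmod z).
Proof.
set r := cmod z; have r0 : 0 <= r := cmod_ge0 z.
case: z @r r0 => x y r r0.
have hx : `|x| <= r := normr_Re_le (x +i* y).
have hy : `|y| <= r := normr_Im_le (x +i* y).
have e1 : 1 <= expR r by rewrite -expR0 ler_expR.
have ex : expR `|x| <= expR r by rewrite ler_expR.
have exr : expR x <= expR r by rewrite ler_expR (le_trans (ler_norm _)).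
have x2 : x ^+ 2 <= r ^+ 2.
  by rewrite -(real_normK (num_real x)) ler_pXn2r// nnegrE.
have y2 : y ^+ 2 <= r ^+ 2.
  by rewrite -(real_normK (num_real y)) ler_pXn2r// nnegrE.
have r2 := sqr_ge0 r; have x20 := sqr_ge0 x; have y20 := sqr_ge0 y.
have p := expR_ge0 r.
rewrite (le_trans (cmod_le_ReIm _))// !(ReB, ImB) /= !subr0.
have -> : 4 * r ^+ 2 * expR r = (r ^+ 2 * expR r + r ^+ 2 * expR r)
   + (r ^+ 2 * expR r + r ^+ 2 * expR r) by ring.
apply: lerD.
  have -> : expR x * cos y - 1 - x = - (expR x * (1 - cos y)) + (expR x - 1 - x) by ring.
  rewrite (le_trans (ler_normD _ _))// normrN normrM lerD//.
    rewrite mulrC ler_pM// ?normr_ge0//.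
      rewrite ger0_norm ?subr_ge0 ?cos_le1//.
      by rewrite (le_trans (one_sub_cos_le _))//; lra.
    by rewrite ger0_norm// expR_ge0.
  by rewrite (le_trans (expR_sub1x_le _))// ler_pM// expR_ge0.
have -> : expR x * sin y - y = (expR x - 1) * sin y + (sin y - y) by ring.
rewrite (le_trans (ler_normD _ _))// normrM lerD//.
  rewrite mulrC expr2 -mulrA ler_pM ?normr_ge0//.
    by rewrite (le_trans (normr_sin_le _)).
  by rewrite (le_trans (expR_sub1_le _))// ler_pM// expR_ge0.
by rewrite (le_trans (normr_sin_sub_le _))// (le_trans y2)// ler_peMr.
Qed.

Lemma has_cderiv_quadratic (F : C -> C) (z L : C) (K d0 : R) : 0 < d0 ->
  (forall h, cmod h <= d0 -> cmod (F (z + h) - F z - h * L) <= K * cmod h ^+ 2) ->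
  has_cderiv F z L.
Proof.
move=> d0p H e e0; pose M := `|K| + 1.
have M0 : 0 < M by rewrite ltr_wpDl.
exists (Num.min d0 (e / M)); first by rewrite lt_min d0p divr_gt0.
move=> h; rewrite lt_min => /andP[hd he]; rewrite (le_trans (H _ (ltW hd)))//.
rewrite expr2 mulrA ler_wpM2r ?cmod_ge0//.
rewrite (@le_trans _ _ (M * cmod h))//.
  by rewrite ler_wpM2r ?cmod_ge0// /M (le_trans (ler_norm _))// lerDl.
by rewrite mulrC -ler_pdivlMr// ltW.
Qed.

Lemma holomorphic_cexp : holomorphic (@cexp R).
Proof.
apply/holomorphicP => z; exists (cexp z).
apply: (@has_cderiv_quadratic _ _ _ (cmod (cexp z) * 4 * expR 1) 1) => // h h1.
have -> : cexp (z + h) - cexp z - h * cexp z = cexp z * (cexp h - 1 - h).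
  by rewrite cexpD; ring.
rewrite cmodM -!mulrA ler_wpM2l ?cmod_ge0//.
rewrite (le_trans (cexp_sub1z_le _))// -mulrA ler_wpM2l// mulrC.
by rewrite ler_wpM2r ?sqr_ge0// ler_expR.
Qed.

End complex_topology.

(** * Goursat's theorem and the mean value property *)

Section segment_integral.
Context {R : realType}.
Local Notation C := R[i].

Definition seg (a b : R) (f : R -> C) : C := cintegral (leb1 R) `[a, b] f.

Definition rcont (f : R -> C) : Prop :=
  continuous (fun x => Re (f x)) /\ continuous (fun x => Im (f x)).

Lemma rcont_cintegrable (a b : R) (f : R -> C) : rcont f ->
  cintegrable (leb1 R) `[a, b] f.
Proof.
move=> [cf cf']; split; apply: continuous_compact_integrable => //;
  try exact: segment_compact; exact: continuous_subspaceT.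
Qed.

Lemma rcontB (f g : R -> C) : rcont f -> rcont g -> rcont (fun x => f x - g x).
Proof.
move=> [f1 f2] [g1 g2]; split=> x.
  by under eq_fun do rewrite ReB; apply: cvgB; [exact: f1|exact: g1].
by under eq_fun do rewrite ImB; apply: cvgB; [exact: f2|exact: g2].
Qed.

Lemma rcont_cst (c : C) : rcont (fun=> c).
Proof. by split=> x; exact: cvg_cst. Qed.

Lemma rcont_comp (F : C -> C) (g : R -> C) : holomorphic F -> rcont g ->
  rcont (fun x => F (g x)).
Proof.
move=> hF /cont_ReIm cg; apply/cont_ReIm => x.
exact: cvg_comp (cg x) (@holomorphic_cont _ _ hF (g x)).
Qed.

Lemma seg_split (a m b : R) (f : R -> C) : rcont f -> a <= m -> m <= b ->
  seg a b f = seg a m f + seg m b f.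
Proof.
move=> cf am mb; have [i1 i2] := rcont_cintegrable a b cf.
have [j1 j2] := rcont_cintegrable m b cf.
have S : (`]m, b] `<=` `[m, b])%classic by apply: subset_itv_oc_cc.
have H (g : R -> R) : (leb1 R).-integrable `[a, b] (EFin \o g) ->
  (leb1 R).-integrable `[m, b] (EFin \o g) ->
  Rintegral (leb1 R) `[a, b] g = Rintegral (leb1 R) `[a, m] g +
    Rintegral (leb1 R) `[m, b] g.
  move=> ig jg; have := @Rintegral_itvB R g (BLeft a) (BRight b) m ig.
  rewrite !bnd_simp => /(_ am mb); rewrite -/(leb1 R) => /eqP.
  rewrite subr_eq addrC => /eqP ->; congr (_ + _).
  apply: Rintegral_itv_obnd_cbnd.
  by apply: integrableS jg; [exact: measurable_itv|exact: measurable_itv|exact: S].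
by apply: complex_ext; rewrite ?ReD ?ImD; exact: H.
Qed.

Lemma segB (a b : R) (f g : R -> C) : rcont f -> rcont g ->
  seg a b (fun x => f x - g x) = seg a b f - seg a b g.
Proof.
by move=> cf cg; apply: cintegralB; rewrite //=; exact: rcont_cintegrable.
Qed.

Lemma seg_cst (a b : R) (c : C) : a <= b -> seg a b (fun=> c) = (b - a)%:C * c.
Proof.
move=> ab; have m : fine (lebesgue_measure (`[a, b]%classic : set R)) = b - a.
  rewrite lebesgue_measure_itv /= lte_fin; move: ab; rewrite le_eqVlt.
  by move=> /orP[/eqP ->|->]; rewrite ?ltxx ?subrr.
apply: complex_ext; rewrite !ReImE /= Rintegral_cst//= /leb1 /= m; ring.
Qed.

Lemma cmod_seg_le (a b M : R) (f : R -> C) : a <= b -> rcont f ->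
  (forall x, a <= x <= b -> cmod (f x) <= M) ->
  cmod (seg a b f) <= 2 * (M * (b - a)).
Proof.
move=> ab cf H; have If := rcont_cintegrable a b cf.
have mab : measurable (`[a, b]%classic : set (measurableTypeR R)) by exact: measurable_itv.
have [mf _] := (cintegrableP _ _ mab).1 If.
rewrite -lee_fin (le_trans (cmod_cintegral_le _ mab mf))// EFinM lee_pmul2l//.
have M0 : 0 <= M by rewrite (le_trans (cmod_ge0 (f a)))// H// lexx.
have -> : (M * (b - a))%:E = (\int[leb1 R]_(x in `[a, b]) (cst M%:E) x)%E.
  rewrite integral_cst// [X in (_ * X)%E]lebesgue_measure_itv/= lte_fin.
  move: ab; rewrite le_eqVlt => /orP[/eqP ->|->].
    by rewrite ltxx subrr mulr0 mule0.
  by rewrite -EFinB -EFinM.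
apply: ge0_le_integral => //.
- by move=> x _; rewrite lee_fin cmod_ge0.
- by apply/measurable_EFinP; exact: measurable_cmod.
Qed.

End segment_integral.

Section goursat.
Context {R : realType}.
Local Notation C := R[i].
Variable G : C -> C.
Hypothesis hG : holomorphic G.

Lemma rcont_hline (c : R) : rcont (fun x => G (x +i* c)).
Proof.
apply: rcont_comp => //; split => x /=; [exact: cvg_id|exact: cvg_cst].
Qed.

Lemma rcont_vline (c : R) : rcont (fun y => G (c +i* y)).
Proof.
apply: rcont_comp => //; split => x /=; [exact: cvg_cst|exact: cvg_id].
Qed.

Local Hint Resolve rcont_hline rcont_vline : core.

(** The counterclockwise contour integral of [G] around the rectangle [a, b] x [c, d], with opposite
    sides paired. *)
Definition bdry (a b c d : R) : C :=
  seg a b (fun x => G (x +i* c) - G (x +i* d)) +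
  'i%C * seg c d (fun y => G (b +i* y) - G (a +i* y)).

Lemma bdry_splitx (a m b c d : R) : a <= m -> m <= b ->
  bdry a b c d = bdry a m c d + bdry m b c d.
Proof.
move=> am mb; rewrite /bdry (seg_split _ am mb); last exact: rcontB.
rewrite !segB//; ring.
Qed.

Lemma bdry_splity (a b c m d : R) : c <= m -> m <= d ->
  bdry a b c d = bdry a b c m + bdry a b m d.
Proof.
move=> cm md; rewrite /bdry (seg_split _ cm md); last exact: rcontB.
rewrite !segB//; ring.
Qed.

Let P (p : R * R) (w h : R) := bdry p.1 (p.1 + w) p.2 (p.2 + h).

(** The contour integral is the sum of those over the four quarters, so one quarter carries at least
    a fourth of the modulus. *)
Let quarter (p : R * R) (w h : R) : 0 <= w -> 0 <= h ->
  exists q : R * R, [/\ p.1 <= q.1 <= p.1 + w / 2, p.2 <= q.2 <= p.2 + h / 2 &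
    cmod (P p w h) <= 4 * cmod (P q (w / 2) (h / 2))].
Proof.
case: p => a c w0 h0 /=; have w20 : 0 <= w / 2 by rewrite divr_ge0.
have h20 : 0 <= h / 2 by rewrite divr_ge0.
pose q1 := (a, c); pose q2 := (a + w / 2, c); pose q3 := (a, c + h / 2).
pose q4 := (a + w / 2, c + h / 2).
pose N q := cmod (P q (w / 2) (h / 2)).
have S : P (a, c) w h = (P q1 (w / 2) (h / 2) + P q2 (w / 2) (h / 2)) +
    (P q3 (w / 2) (h / 2) + P q4 (w / 2) (h / 2)).
  rewrite /P /= -!addrA -!splitr.
  rewrite (@bdry_splity _ _ _ (c + h / 2)) ?lerDl//; last first.
    by rewrite lerD2l ler_pdivrMr// ler_peMr// ler1n.
  rewrite (@bdry_splitx _ (a + w / 2) _ c) ?lerDl//; last first.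
    by rewrite lerD2l ler_pdivrMr// ler_peMr// ler1n.
  rewrite (@bdry_splitx _ (a + w / 2) _ (c + h / 2)) ?lerDl//; last first.
    by rewrite lerD2l ler_pdivrMr// ler_peMr// ler1n.
  by rewrite !addrA.
have T : cmod (P (a, c) w h) <= N q1 + N q2 + (N q3 + N q4).
  by rewrite S (le_trans (cmodD _ _))// lerD// cmodD.
have {S} : [\/ cmod (P (a, c) w h) <= 4 * N q1, cmod (P (a, c) w h) <= 4 * N q2,
    cmod (P (a, c) w h) <= 4 * N q3 | cmod (P (a, c) w h) <= 4 * N q4].
  have [?|n1] := leP (cmod (P (a, c) w h)) (4 * N q1); first by constructor 1.
  have [?|n2] := leP (cmod (P (a, c) w h)) (4 * N q2); first by constructor 2.
  have [?|n3] := leP (cmod (P (a, c) w h)) (4 * N q3); first by constructor 3.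
  by constructor 4; move: T n1 n2 n3; lra.
by case=> H; [exists q1|exists q2|exists q3|exists q4]; split; rewrite //= ?lexx ?lerDl ?w20 ?h20.
Qed.

(** The contour integral of an affine function vanishes, so only the first-order error at z
    contributes, and on the boundary it is at most e times the semiperimeter. *)
Let small (z L : C) (e : R) (a b c d : R) : 0 <= e ->
  a <= Re z <= b -> c <= Im z <= d ->
  (forall w, cmod (w - z) <= (b - a) + (d - c) ->
     cmod (G w - G z - (w - z) * L) <= e * cmod (w - z)) ->
  cmod (bdry a b c d) <= 4 * e * ((b - a) + (d - c)) ^+ 2.
Proof.
move=> e0 /andP[az zb] /andP[cz zd] H.
have ab : a <= b by rewrite (le_trans az).
have cd : c <= d by rewrite (le_trans cz).
set s := (b - a) + (d - c).
have s0 : 0 <= s by rewrite addr_ge0// subr_ge0.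
have B x y : a <= x <= b -> c <= y <= d ->
    cmod (G (x +i* y) - G z - (x +i* y - z) * L) <= e * s.
  move=> /andP[ax xb] /andP[cy yd].
  have le_s : cmod (x +i* y - z) <= s.
    rewrite (le_trans (cmod_le_ReIm _))// ReB ImB /= lerD//.
      by rewrite ler_norml; apply/andP; split; lra.
    by rewrite ler_norml; apply/andP; split; lra.
  by rewrite (le_trans (H _ le_s))// ler_wpM2l.
(* Removing the affine part changes the two integrands by the constants i(c - d)L and (b - a)L,
   whose contributions to the contour integral cancel. *)
pose f1 x := (G (x +i* c) - G z - (x +i* c - z) * L) -
  (G (x +i* d) - G z - (x +i* d - z) * L).
pose f2 y := (G (b +i* y) - G z - (b +i* y - z) * L) -
  (G (a +i* y) - G z - (a +i* y - z) * L).
have E1 : f1 = (fun x => (G (x +i* c) - G (x +i* d)) - (0 +i* (c - d)) * L).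
  apply/funext => x.
  have -> : 0 +i* (c - d) = x +i* c - x +i* d by apply: complex_ext; rewrite !ReImE/= ?subrr.
  by rewrite /f1; ring.
have E2 : f2 = (fun y => (G (b +i* y) - G (a +i* y)) - (b - a)%:C * L).
  apply/funext => y.
  have -> : (b - a)%:C = b +i* y - a +i* y by apply: complex_ext; rewrite !ReImE/= ?subrr.
  by rewrite /f2; ring.
have c1 : rcont f1 by rewrite E1; apply: rcontB; [exact: rcontB|exact: rcont_cst].
have c2 : rcont f2 by rewrite E2; apply: rcontB; [exact: rcontB|exact: rcont_cst].
have -> : bdry a b c d = seg a b f1 + 'i%C * seg c d f2.
  rewrite E1 E2.
  rewrite (segB _ _ (rcontB (rcont_hline c) (rcont_hline d)) (rcont_cst _)).
  rewrite (segB _ _ (rcontB (rcont_vline b) (rcont_vline a)) (rcont_cst _)).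
  rewrite !seg_cst//.
  rewrite /bdry; set u := seg _ _ _; set v := seg _ _ _.
  by apply: complex_ext; rewrite !ReImE /=; ring.
have b1 : cmod (seg a b f1) <= 2 * ((e * s + e * s) * (b - a)).
  apply: cmod_seg_le => // x xab; rewrite (le_trans (cmodD _ _))// cmodN.
  by rewrite lerD// B// lexx ?ab ?cd.
have b2 : cmod (seg c d f2) <= 2 * ((e * s + e * s) * (d - c)).
  apply: cmod_seg_le => // x xab; rewrite (le_trans (cmodD _ _))// cmodN.
  by rewrite lerD// B// lexx ?ab ?cd.
rewrite (le_trans (cmodD _ _))// cmodM cmod_i mul1r (le_trans (lerD b1 b2))//.
by rewrite le_eqVlt; apply/orP; left; apply/eqP; rewrite /s; ring.
Qed.

                                                                               
                                                         
(** Repeated bisection: quarters keeping at least a fourth of the modulus shrink to one point, and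
    differentiability there makes the integral over the n-th quarter at most an arbitrarily small
    multiple of 4^-n. *)
Lemma goursat (a b c d : R) : a <= b -> c <= d -> bdry a b c d = 0.
Proof.
move=> ab cd; pose w := b - a; pose h := d - c.
have w0 : 0 <= w by rewrite subr_ge0.
have h0 : 0 <= h by rewrite subr_ge0.
have e2 n : 0 <= (2 ^+ n)^-1 :> R by rewrite invr_ge0 exprn_ge0.
have /choice[f fP] : forall np : nat * (R * R), exists q : R * R,
    [/\ np.2.1 <= q.1 <= np.2.1 + w / 2 ^+ np.1 / 2,
        np.2.2 <= q.2 <= np.2.2 + h / 2 ^+ np.1 / 2 &
    cmod (P np.2 (w / 2 ^+ np.1) (h / 2 ^+ np.1)) <=
      4 * cmod (P q (w / 2 ^+ np.1 / 2) (h / 2 ^+ np.1 / 2))].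
  by move=> [n p] /=; apply: quarter; rewrite mulr_ge0.
(* Lower-left corners of the successively chosen quarters. *)
pose s := fix s n := if n is m.+1 then f (m, s m) else (a, c).
have sS n : s n.+1 = f (n, s n) by [].
have half (x : R) n : x / 2 ^+ n / 2 = x / 2 ^+ n.+1 by rewrite exprSr invfM mulrA.
have dbl (x : R) n : x / 2 ^+ n = x / 2 ^+ n.+1 + x / 2 ^+ n.+1 by rewrite -half -splitr.
have big n : cmod (bdry a b c d) <= 4 ^+ n * cmod (P (s n) (w / 2 ^+ n) (h / 2 ^+ n)).
  elim: n => [|n IH].
    by rewrite !expr0 mul1r !divr1 /P /= !subrKC.
  rewrite (le_trans IH)// exprSr -mulrA ler_wpM2l ?exprn_ge0// sS.
  by have [_ _] := fP (n, s n); rewrite /= !half.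
have mon k n : ((s n).1 <= (s (n + k)%N).1 /\ (s (n + k)%N).1 + w / 2 ^+ (n + k) <= (s n).1 + w / 2 ^+ n) /\
    ((s n).2 <= (s (n + k)%N).2 /\ (s (n + k)%N).2 + h / 2 ^+ (n + k) <= (s n).2 + h / 2 ^+ n).
  elim: k => [|k [[I1 I2] [I3 I4]]]; first by rewrite addn0 !lexx.
  rewrite addnS sS; have [/= /andP[J1 J2] /andP[J3 J4] _] := fP (n + k, s (n + k))%N.
  rewrite !half in J2 J4; move: I2 I4; rewrite (dbl w (n + k)%N) (dbl h (n + k)%N).
  move: I1 I3 J1 J2 J3 J4; set A := w / 2 ^+ (n + k).+1; set B := h / 2 ^+ (n + k).+1.
  by move=> *; split; split; lra.
have nest m n : (s m).1 <= (s n).1 + w / 2 ^+ n /\ (s m).2 <= (s n).2 + h / 2 ^+ n.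
  have pw k : 0 <= w / 2 ^+ k by rewrite mulr_ge0.
  have ph k : 0 <= h / 2 ^+ k by rewrite mulr_ge0.
  have [mn|/ltnW mn] := leqP m n.
    have := mon (n - m)%N m; rewrite subnKC//; have := pw n; have := ph n.
    by move=> ? ? [[? _] [? _]]; split; lra.
  have := mon (m - n)%N n; rewrite subnKC//; have := pw m; have := ph m.
  by move=> ? ? [[_ ?] [_ ?]]; split; lra.
pose S1 := range (fun n => (s n).1); pose S2 := range (fun n => (s n).2).
have in1 n : (s n).1 <= sup S1 <= (s n).1 + w / 2 ^+ n.
  apply/andP; split; last first.
    by apply: ge_sup; [exists (s 0%N).1; exists 0%N|move=> _ [m _ <-]; exact: (nest m n).1].
  apply: ub_le_sup; last by exists n.
  by exists ((s 0%N).1 + w / 2 ^+ 0) => _ [m _ <-]; exact: (nest m 0%N).1.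
have in2 n : (s n).2 <= sup S2 <= (s n).2 + h / 2 ^+ n.
  apply/andP; split; last first.
    by apply: ge_sup; [exists (s 0%N).2; exists 0%N|move=> _ [m _ <-]; exact: (nest m n).2].
  apply: ub_le_sup; last by exists n.
  by exists ((s 0%N).2 + h / 2 ^+ 0) => _ [m _ <-]; exact: (nest m 0%N).2.
(* The suprema of the lower-left corners give a point common to all the nested rectangles. *)
pose z : C := sup S1 +i* sup S2.
have /holomorphicP/(_ z)[L HL] := hG.
suff H e : 0 < e -> cmod (bdry a b c d) <= 4 * e * (w + h) ^+ 2.
  apply: cmod_eq0; apply/eqP; rewrite eq_le cmod_ge0 andbT.
  apply/ler_addgt0Pl => e e0; rewrite addr0.
  have q0 : 0 < 4 * (w + h) ^+ 2 + 1 by rewrite ltr_wpDl// mulr_ge0// sqr_ge0.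
  rewrite (le_trans (H (e / (4 * (w + h) ^+ 2 + 1)) _)) ?divr_gt0//.
  rewrite (_ : 4 * _ * _ = e * ((4 * (w + h) ^+ 2) / (4 * (w + h) ^+ 2 + 1))); last by ring.
  by rewrite ler_piMr ?(ltW e0)// ler_pdivrMr// mul1r lerDl.
move=> e0; have [dl dl0 {}HL] := HL _ e0.
have [n nd] : exists n : nat, (w + h) / 2 ^+ n < dl.
  (* Since n < 2^n, this many halvings bring the semiperimeter below [dl]. *)
  pose n := (Num.truncn ((w + h) / dl)).+1; exists n.
  rewrite ltr_pdivrMr ?exprn_gt0// mulrC -ltr_pdivrMr//.
  rewrite (lt_le_trans (truncnS_gt _))// -natrX ler_nat.
  by rewrite -/n (leq_trans (ltnW (ltn_expl n (ltnSn 1)))).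
have K : cmod (P (s n) (w / 2 ^+ n) (h / 2 ^+ n)) <=
    4 * e * (w / 2 ^+ n + h / 2 ^+ n) ^+ 2.
  rewrite /P (le_trans (@small z L e _ _ _ _ (ltW e0) (in1 n) (in2 n) _))//.
    move=> v; rewrite !(addrC (_ n).1, addrC (_ n).2) !addrK -mulrDl => vs.
    by rewrite -{1}(subrKC z v) HL// (le_lt_trans vs).
  by rewrite !(addrC (_ n).1, addrC (_ n).2) !addrK.
(* The factor 4^n from the bisection cancels the (2^n)^2 in the squared semiperimeter. *)
rewrite (le_trans (big n))// (le_trans (ler_wpM2l _ K)) ?exprn_ge0//.
rewrite -mulrDl exprMn exprVn -exprM mulnC exprM (_ : 2 ^+ 2 = 4); last by ring.
rewrite le_eqVlt; apply/orP; left; apply/eqP; field.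
by rewrite expf_neq0// pnatr_eq0.
Qed.

End goursat.

Section mean_value.
Context {R : realType}.
Local Notation C := R[i].

(** In logarithmic coordinates circles become vertical segments. Goursat shows that the mean over
    such a segment does not depend on its real part a, and letting a tend to minus infinity shrinks
    the circle to 0. *)
Lemma circle_mean (F : C -> C) (z : C) : holomorphic F ->
  seg 0 (2 * pi) (fun t => F (z * cexp (0 +i* t))) = (2 * pi)%:C * F 0.
Proof.
move=> hF; pose F1 v := F (z * v).
have hF1 : holomorphic F1.
  apply: (@holomorphic_comp _ F (fun v => z * v) hF).
  have := @holomorphic_affine R z 0; congr holomorphic; apply/funext => v.
  by rewrite addr0.
pose G v := F1 (cexp v).
have hG : holomorphic G by exact: (@holomorphic_comp _ F1 (@cexp R) hF1 holomorphic_cexp).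
have tp : 0 <= 2 * pi :> R by rewrite mulr_ge0// pi_ge0.
(* [G] has period 2 pi i, so on the rectangle [a, 0] x [0, 2 pi] the horizontal sides cancel and the
   two vertical integrals must be equal. *)
have cst a : a <= 0 -> seg 0 (2 * pi) (fun y => G (0 +i* y)) =
    seg 0 (2 * pi) (fun y => G (a +i* y)).
  move=> a0; have := goursat hG a0 tp; rewrite /bdry.
  have -> : (fun x => G (x +i* 0) - G (x +i* (2 * pi))) = (fun=> 0).
    apply/funext => x; rewrite /G (_ : cexp (x +i* (2 * pi)) = cexp (x +i* 0)) ?subrr//.
    by rewrite /cexp /= mulr_natl sin2pi cos2pi sin0 cos0.
  rewrite seg_cst// mulr0 add0r segB; [|exact: rcont_vline|exact: rcont_vline].
  move=> /(congr1 (fun v => - 'i%C * v)); rewrite mulr0 mulrA.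
  have -> : - 'i%C * 'i%C = 1 :> C by apply: complex_ext; rewrite !ReImE/=; ring.
  by rewrite mul1r => /eqP; rewrite subr_eq0 => /eqP.
rewrite -[LHS]/(seg 0 (2 * pi) (fun y => G (0 +i* y))).
apply/eqP; rewrite -subr_eq0; apply/eqP/cmod_eq0/eqP.
rewrite eq_le cmod_ge0 andbT; apply/ler_addgt0Pl => e e0; rewrite addr0.
pose e' := e / (4 * pi + 1).
have p1 : 0 < 4 * pi + 1 :> R by rewrite ltr_wpDl// mulr_ge0// pi_ge0.
have e'0 : 0 < e' by rewrite divr_gt0.
have /holomorphicP/(_ 0)[L HL] := hF1.
have := @holomorphic_cont _ _ hF1 0 => /cvgrPdist_lt/(_ e'%:C).
rewrite ltcR => /(_ e'0); rewrite -nbhs_nearE => /nbhs_ballP[/= [d d']].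
rewrite /= ltcE /= => /andP[/eqP -> d0] H.
(* The radius e^a is small enough for [F1] to be within [e'] of its value at 0 on the whole
   circle. *)
have [a a0 ad] : exists2 a : R, a <= 0 & expR a < d.
  exists (ln (Num.min 1 (d / 2))).
    by rewrite ln_le0// ge_min lexx.
  rewrite lnK ?posrE ?lt_min ?ltr01 ?divr_gt0//.
  by rewrite gt_min; apply/orP; right; rewrite ltr_pdivrMr// ltr_pMr// ltr1n.
rewrite (cst _ a0).
have -> : (2 * pi)%:C * F 0 = seg 0 (2 * pi) (fun=> F 0) by rewrite seg_cst// subr0.
rewrite -segB; [|exact: rcont_vline|exact: rcont_cst].
rewrite (le_trans (@cmod_seg_le _ _ _ e' _ tp _ _))//.
- by apply: rcontB; [exact: rcont_vline|exact: rcont_cst].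
- move=> x _; have := H (cexp (a +i* x)).
  rewrite /ball /= sub0r normrN normc_cmod ltcR cmod_cexp => /(_ ad).
  by rewrite normc_cmod ltcR cmodB /G /F1 mulr0 => /ltW.
rewrite subr0 /e' (_ : 2 * _ = e * (4 * pi / (4 * pi + 1))); last by ring.
by rewrite ler_piMr ?(ltW e0)// ler_pdivrMr// mul1r lerDl.
Qed.

End mean_value.

                                     

(** * Simple maps and measurability of continuous compositions *)

Section simple_maps.
Context d (T : measurableType d).

(** The target carries no sigma-algebra, so pairs and arbitrary post-compositions of simple maps
    remain simple. *)
Definition simple_map (V : Type) (q : T -> V) : Prop :=
  finite_set (range q) /\ forall v, measurable (q @^-1` [set v]).

Lemma simple_map_comp (V W : Type) (q : T -> V) (g : V -> W) :
  simple_map q -> simple_map (fun x => g (q x)).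
Proof.
move=> [fq mq]; split.
  by rewrite -[X in finite_set X]/((g \o q) @` setT) -(image_comp q g setT); exact: finite_image.
move=> w.
rewrite (_ : _ @^-1` _ = \bigcup_(v in range q `&` [set v | g v = w]) (q @^-1` [set v])).
  by apply: fin_bigcup_measurable => //; exact: finite_setIl.
apply/seteqP; split=> [x /= gx|x [v [_ /= gv]] /= ->//].
by exists (q x) => //; split => //; exists x.
Qed.

Lemma simple_map_pair (V W : Type) (q : T -> V) (q' : T -> W) :
  simple_map q -> simple_map q' -> simple_map (fun x => (q x, q' x)).
Proof.
move=> [fq mq] [fq' mq']; split.
  apply: (@sub_finite_set _ _ (range q `*` range q')).
    by move=> _ [x _ <-]; split; exists x.
  exact: finite_setX.
move=> [v w].
rewrite (_ : _ @^-1` _ = q @^-1` [set v] `&` q' @^-1` [set w]).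
  exact: measurableI.
by apply/seteqP; split=> x /=; [case=> -> ->|case=> -> ->].
Qed.

Lemma simple_map_preimage (V : Type) (q : T -> V) (B : set V) :
  simple_map q -> measurable (q @^-1` B).
Proof.
(* Composing with the Prop-valued [B] gives a simple map whose fibre over [True] is the preimage of
   [B]. *)
move=> sq; have [_ /(_ True)] := simple_map_comp B sq.
by congr measurable; apply/seteqP; split => x /=;
  [move=> ->|move=> Bx; apply/propext; split].
Qed.

Lemma simple_map_measurable d' (V : measurableType d') (q : T -> V) (D : set T) :
  simple_map q -> measurable_fun D q.
Proof. by move=> sq mD B mB; apply: measurableI => //; exact: simple_map_preimage. Qed.

Section real.
Variable R : realType.
Import HBNNSimple.

Lemma simple_approx (f : T -> R) : measurable_fun setT f ->
  exists q : nat -> T -> R, [/\ forall k, simple_map (q k),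
    forall k x, `|q k x| <= `|f x| & forall x, (fun k => q k x) @ \oo --> f x].
Proof.
move=> mf.
have H (g : T -> R) : measurable_fun setT g -> (forall x, 0 <= g x) ->
    exists q : nat -> T -> R, [/\ forall k, simple_map (q k),
    forall k x, 0 <= q k x <= g x & forall x, (fun k => q k x) @ \oo --> g x].
  move=> mg g0; have mg' : measurable_fun setT (EFin \o g) by exact/measurable_EFinP.
  have g0' x : setT x -> (0 <= (EFin \o g) x)%E by rewrite /= lee_fin.
  exists (fun k => nnsfun_approx measurableT mg' k); split.
  - by move=> k; split=> [|v]; [exact: fimfunP|exact: measurable_sfunP].
  - move=> k x; apply/andP; split; first exact: fun_ge0.
    by rewrite -lee_fin nnsfun_approxE (le_trans (le_approx _ g0' _)).
  - by move=> x; have /fine_cvgP[] := cvg_nnsfun_approx measurableT mg' g0' (I : setT x).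
have [p [sp bp cp]] := H _ (measurable_funrpos mf) (fun x => funrpos_ge0 f x).
have [n [sn bn cn]] := H _ (measurable_funrneg mf) (fun x => funrneg_ge0 f x).
exists (fun k x => p k x - n k x); split.
- move=> k; exact: (simple_map_comp (fun v => v.1 - v.2) (simple_map_pair (sp k) (sn k))).
- move=> k x; have /andP[p0 pb] := bp k x; have /andP[n0 nb] := bn k x.
  have e : `|f x| = f^\+ x + f^\- x by have := congr1 (fun h => h x) (funrposDneg f).
  by rewrite e ler_norml; apply/andP; split; lra.
- move=> x; have -> : f x = f^\+ x - f^\- x by have := congr1 (fun h => h x) (funrposBneg f).
  apply: cvgB; [exact: cp|exact: cn].
Qed.

End real.

Definition approximable (V : topologicalType) (p : T -> V) : Prop :=
  exists q : nat -> T -> V, (forall k, simple_map (q k)) /\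
    forall x, (fun k => q k x) @ \oo --> p x.

Lemma approximable_real (R : realType) (p : T -> R) :
  measurable_fun setT p -> approximable p.
Proof. by move=> /simple_approx[q [sq _ cq]]; exists q. Qed.

Lemma approximable_pair (V W : topologicalType) (p : T -> V) (p' : T -> W) :
  approximable p -> approximable p' ->
  approximable (fun x => (p x, p' x) : V * W).
Proof.
move=> [q [sq cq]] [q' [sq' cq']]; exists (fun k x => (q k x, q' k x)).
by split=> [k|x]; [exact: simple_map_pair|exact: cvg_pair].
Qed.

(** The functions [g (q k x)] are simple, hence measurable, and converge pointwise to [g (p x)].
    This avoids comparing product sigma-algebras with the Borel sets of [V]. *)
Lemma measurable_cont_comp (R : realType) (V : topologicalType) (p : T -> V)
    (g : V -> R) (D : set T) :
  approximable p -> continuous g -> measurable_fun D (fun x => g (p x)).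
Proof.
move=> [q [sq cq]] cg.
apply: (@measurable_fun_cvg _ _ _ D (fun k x => g (q k x))).
  by move=> k; apply: simple_map_measurable; exact: simple_map_comp.
by move=> x _; exact: cvg_comp (cq x) (cg (p x)).
Qed.

End simple_maps.

Section cmeasurable_hol.
Context d (T : measurableType d) (R : realType).
Local Notation C := R[i].

Lemma cmeasurable_cont (F : C -> C) (g : T -> C) (D : set T) :
  continuous (F : C^o -> C^o) -> cmeasurable setT g ->
  cmeasurable D (fun x => F (g x)).
Proof.
move=> cF [g1 g2].
have /cont_ReIm[c1 c2] : continuous ((fun p : R * R => F (p.1 +i* p.2)) : _ -> C^o).
  move=> p; have cp : (fun p : R * R => (p.1 +i* p.2) : C^o) @ p --> (p.1 +i* p.2 : C^o).
    by apply/cvg_ReIm; split => /=; [exact: cvg_fst|exact: cvg_snd].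
  exact: cvg_comp cp (cF _).
have ap : approximable (fun x => (Re (g x), Im (g x)) : R * R).
  by apply: approximable_pair; exact: approximable_real.
have E x : F (g x) = F (Re (g x) +i* Im (g x)) by case: (g x).
split.
  under eq_fun do rewrite E; exact: measurable_cont_comp ap c1.
under eq_fun do rewrite E; exact: measurable_cont_comp ap c2.
Qed.

Lemma cmeasurable_hol (F : C -> C) (g : T -> C) (D : set T) :
  holomorphic F -> cmeasurable setT g -> cmeasurable D (fun x => F (g x)).
Proof. by move=> /holomorphic_cont cF; exact: cmeasurable_cont. Qed.

Lemma cmeasurable_cexp (g : T -> C) (D : set T) :
  cmeasurable setT g -> cmeasurable D (fun x => cexp (g x)).
Proof. exact/cmeasurable_hol/holomorphic_cexp. Qed.

End cmeasurable_hol.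

(** * Cauchy-Schwarz and the Gaussian integral *)

Section cauchy_schwarz.
Context d (T : measurableType d) (R : realType) (mu : {measure set T -> \bar R}).

Lemma le_mean_sqr (x A B : R) : 0 <= x -> 0 <= A -> 0 <= B ->
  (forall t, 0 < t -> x <= (t * A + B / t) / 2) -> x ^+ 2 <= A * B.
Proof.
move=> x0 A0 B0 H; move: x0; rewrite le_eqVlt => /orP[/eqP <-|x0].
  by rewrite expr0n mulr_ge0.
move: A0; rewrite le_eqVlt => /orP[/eqP A0|A0].
  (* If A = 0, this t makes the bound strictly smaller than x, a contradiction; otherwise t = x / A
     gives the inequality. *)
  have t0 : 0 < (B + 1) / x by rewrite divr_gt0// ltr_wpDl.
  have B1 : 0 < B + 1 by rewrite ltr_wpDl.
  have := H _ t0; rewrite -A0 mulr0 add0r invf_div mulrCA.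
  have : B / (B + 1) < 1 by rewrite ltr_pdivrMr// mul1r ltrDl.
  move=> h; have : x * (B / (B + 1)) < x by rewrite gtr_pMr.
  by lra.
have := H (x / A) (divr_gt0 x0 A0).
rewrite divfK ?gt_eqF// invf_div mulrA => h.
have : x <= B * A / x by lra.
by rewrite ler_pdivlMr// -expr2 mulrC.
Qed.

(** Integrate a b <= (t a^2 + b^2 / t) / 2 for each t > 0 and optimise over t afterwards. The
    witness [I] also records that the integral is finite. *)
Lemma cauchy_schwarz (a b : T -> R) (A B : R) :
  measurable_fun setT a -> measurable_fun setT b ->
  (forall x, 0 <= a x) -> (forall x, 0 <= b x) ->
  (\int[mu]_x (a x ^+ 2)%:E <= A%:E)%E -> (\int[mu]_x (b x ^+ 2)%:E <= B%:E)%E ->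
  exists I : R, [/\ (\int[mu]_x (a x * b x)%:E = I%:E)%E, 0 <= I & I ^+ 2 <= A * B].
Proof.
move=> ma mb a0 b0 IA IB.
have i0 : (0 <= \int[mu]_x (a x * b x)%:E)%E.
  by apply: integral_ge0 => x _; rewrite lee_fin mulr_ge0.
have A0 : 0 <= A.
  by rewrite -lee_fin (le_trans _ IA)// integral_ge0// => x _; rewrite lee_fin sqr_ge0.
have B0 : 0 <= B.
  by rewrite -lee_fin (le_trans _ IB)// integral_ge0// => x _; rewrite lee_fin sqr_ge0.
have H t : 0 < t -> (\int[mu]_x (a x * b x)%:E <= ((t * A + B / t) / 2)%:E)%E.
  move=> t0; have t2 : 0 <= t / 2 by rewrite divr_ge0// ltW.
  have t2' : 0 <= t^-1 / 2 by rewrite divr_ge0// invr_ge0 ltW.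
  apply: (@le_trans _ _ (\int[mu]_x ((t / 2)%:E * (a x ^+ 2)%:E
      + (t^-1 / 2)%:E * (b x ^+ 2)%:E))%E).
    apply: ge0_le_integral => //.
    - by move=> x _; rewrite lee_fin mulr_ge0.
    - by apply/measurable_EFinP; exact: measurable_funM.
    - by apply: emeasurable_funD; apply: measurable_funeM; apply/measurable_EFinP;
        exact: measurable_funX.
    - move=> x _; rewrite -!EFinM -EFinD lee_fin.
      have := sqr_ge0 (t * a x - b x) => h.
      have -> : t / 2 * a x ^+ 2 + t^-1 / 2 * b x ^+ 2 =
        a x * b x + (t * a x - b x) ^+ 2 / (2 * t) by field; rewrite gt_eqF.
      by rewrite lerDl divr_ge0// mulr_ge0// ltW.
  rewrite ge0_integralD//; last 4 first.
  - by move=> x _; rewrite -EFinM lee_fin mulr_ge0// sqr_ge0.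
  - by apply: measurable_funeM; apply/measurable_EFinP; exact: measurable_funX.
  - by move=> x _; rewrite -EFinM lee_fin mulr_ge0// sqr_ge0.
  - by apply: measurable_funeM; apply/measurable_EFinP; exact: measurable_funX.
  rewrite !ge0_integralZl_EFin//; last 4 first.
  - by move=> x _; rewrite lee_fin sqr_ge0.
  - by apply/measurable_EFinP; exact: measurable_funX.
  - by move=> x _; rewrite lee_fin sqr_ge0.
  - by apply/measurable_EFinP; exact: measurable_funX.
  have -> : ((t * A + B / t) / 2)%:E = ((t / 2)%:E * A%:E + (t^-1 / 2)%:E * B%:E)%E.
    by rewrite -!EFinM -EFinD; congr EFin; ring.
  by apply: leeD; apply: lee_wpmul2l; rewrite ?lee_fin.
have fin : (\int[mu]_x (a x * b x)%:E)%E \is a fin_num.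
  by rewrite ge0_fin_numE// (le_lt_trans (H 1 ltr01))// ltry.
exists (fine (\int[mu]_x (a x * b x)%:E)%E); rewrite fineK//; split => //.
  exact: fine_ge0.
apply: le_mean_sqr => //; first exact: fine_ge0.
by move=> t t0; rewrite -lee_fin fineK//; exact: H.
Qed.

End cauchy_schwarz.

Section gaussian.
Variable R : realType.

Lemma gauss_weight_ge0 (z : R * R) : 0 <= gauss_weight z.
Proof. exact: expR_ge0. Qed.

Lemma gauss_weight_cmod (z : R * R) :
  gauss_weight z = expR (- cmod (z.1 +i* z.2) ^+ 2).
Proof. by rewrite cmod_sqr. Qed.

Lemma measurable_gauss_weight d (T : measurableType d) (D : set T)
    (f : T -> measurableTypeR R * measurableTypeR R) :
  measurable_fun setT f -> measurable_fun D (fun x => gauss_weight (f x)).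
Proof.
move=> mf; apply: measurable_funTS; apply: (measurableT_comp _ mf).
apply: measurableT_comp => //; apply: measurable_funN.
by apply: measurable_funD; exact: measurable_funX.
Qed.

Lemma integral_gauss_weight : (\int[leb2 R]_z (gauss_weight z)%:E = pi%:E)%E.
Proof.
have mg : measurable_fun setT (fun z : measurableTypeR R * measurableTypeR R =>
  (gauss_weight z)%:E) by apply/measurable_EFinP; exact: measurable_gauss_weight.
rewrite /leb2 fubini_tonelli1//; last by move=> z; rewrite lee_fin gauss_weight_ge0.
have mG : measurable_fun setT (fun x : measurableTypeR R => (gauss_fun x)%:E).
  by apply/measurable_EFinP; exact: measurable_gauss_fun.
rewrite (eq_integral (fun x : measurableTypeR R => ((gauss_fun x)%:E * (Num.sqrt pi)%:E)%E)); last first.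
  move=> x _; rewrite -integralT_gauss -ge0_integralZl_EFin//.
  - apply: eq_integral => y _.
    by rewrite -EFinM /gauss_fun -expRD /gauss_weight /= opprD.
  - by move=> y _; rewrite lee_fin gauss_fun_ge0.
  - exact: gauss_fun_ge0.
rewrite ge0_integralZr//; last by move=> y _; rewrite lee_fin gauss_fun_ge0.
by rewrite integralT_gauss -EFinM -expr2 sqr_sqrtr// pi_ge0.
Qed.

End gaussian.

                       

(** * Fock space and its Weyl translations *)

Section fock_space.
Context {R : realType}.
Local Notation C := R[i].
Implicit Types F G : C -> C.
Local Notation R2 := (measurableTypeR R * measurableTypeR R)%type.
Local Notation pt z := (z.1 +i* z.2).

(** Pi times the squared Fock norm, kept in the extended reals so that membership is finiteness;
    [fock_norm] goes through [fine] and reads 0 on a function of infinite norm. *)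
Definition fsq F : \bar R :=
  (\int[leb2 R]_z (cmod (F (pt z)) ^+ 2 * gauss_weight z)%:E)%E.

Lemma cmeasurable_pt : cmeasurable setT (fun z : R2 => pt z).
Proof. by split=> /=; [exact: measurable_fst|exact: measurable_snd]. Qed.

Lemma cmeasurable_hol_pt F : holomorphic F ->
  cmeasurable setT (fun z : R2 => F (pt z)).
Proof. by move=> hF; exact: (cmeasurable_hol _ hF cmeasurable_pt). Qed.

Lemma measurable_gauss : measurable_fun setT (fun z : R2 => gauss_weight z).
Proof. by apply: measurable_gauss_weight; exact: measurable_id. Qed.

Lemma cmeasurable_gauss : cmeasurable setT (fun z : R2 => (gauss_weight z)%:C).
Proof. by apply: cmeasurableR; exact: measurable_gauss. Qed.

Lemma measurable_fsq (u : R2 -> C) : cmeasurable setT u ->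
  measurable_fun setT (fun z : R2 => cmod (u z) ^+ 2 * gauss_weight z).
Proof.
move=> mu; apply: measurable_funM; last exact: measurable_gauss.
by apply: measurable_funX; exact: measurable_cmod.
Qed.

Lemma fsq_term_ge0 (z : R2) (v : C) : 0 <= cmod v ^+ 2 * gauss_weight z.
Proof. by rewrite mulr_ge0 ?sqr_ge0// gauss_weight_ge0. Qed.

Lemma fsq_ge0 F : (0 <= fsq F)%E.
Proof. by apply: integral_ge0 => z _; rewrite lee_fin fsq_term_ge0. Qed.

Lemma fockP F : fock F <-> holomorphic F /\ (fsq F < +oo)%E.
Proof.
have p0 : 0 < (pi : R)^-1 by rewrite invr_gt0 pi_gt0.
rewrite /fock -/(fsq F); split=> -[hF H]; split => //.
  rewrite ltey; apply: contraTneq H => ->.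
  by rewrite gt0_muley ?ltxx// lte_fin.
by rewrite lte_mul_pinfty ?lee_fin ?(ltW p0)// ge0_fin_numE.
Qed.

Lemma fock_normE F : fock_norm F = Num.sqrt (pi^-1 * fine (fsq F)).
Proof.
rewrite /fock_norm /fock_inner ReM /= mul0r subr0; congr (Num.sqrt (_ * fine _)).
apply: eq_integral => z _; congr EFin.
by rewrite mulJc ReM /= mul0r subr0.
Qed.

Lemma fock_norm_ge0 F : 0 <= fock_norm F. Proof. exact: sqrtr_ge0. Qed.

Lemma fock_norm_fsq F : (fsq F < +oo)%E -> fsq F = (pi * fock_norm F ^+ 2)%:E.
Proof.
move=> Foo; have p0 : 0 <= (pi : R)^-1 by rewrite invr_ge0 pi_ge0.
rewrite fock_normE sqr_sqrtr; last by rewrite mulr_ge0 ?fine_ge0 ?fsq_ge0.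
rewrite mulrA divff ?gt_eqF ?pi_gt0// mul1r fineK//.
by rewrite ge0_fin_numE// fsq_ge0.
Qed.

Lemma eq_fock_norm_fsq F G : fsq F = fsq G -> fock_norm F = fock_norm G.
Proof. by rewrite !fock_normE => ->. Qed.

Lemma fsqZ (c : C) F : holomorphic F -> fsq (fun z => c * F z) = ((cmod c ^+ 2)%:E * fsq F)%E.
Proof.
move=> hF; rewrite -ge0_integralZl_EFin ?sqr_ge0//.
- by apply: eq_integral => z _; rewrite -EFinM; congr EFin; rewrite cmodM; ring.
- by move=> z _; rewrite lee_fin fsq_term_ge0.
- by apply/measurable_EFinP; exact: (measurable_fsq (cmeasurable_hol_pt hF)).
Qed.

Lemma fsqD_le (u v : R2 -> C) : cmeasurable setT u -> cmeasurable setT v ->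
  (\int[leb2 R]_z (cmod (u z + v z) ^+ 2 * gauss_weight z)%:E <=
   2%:E * \int[leb2 R]_z (cmod (u z) ^+ 2 * gauss_weight z)%:E +
   2%:E * \int[leb2 R]_z (cmod (v z) ^+ 2 * gauss_weight z)%:E)%E.
Proof.
move=> mu mv; have m1 := measurable_fsq mu; have m2 := measurable_fsq mv.
rewrite -!ge0_integralZl_EFin//; last 4 first.
- by move=> z _; rewrite lee_fin fsq_term_ge0.
- exact/measurable_EFinP.
- by move=> z _; rewrite lee_fin fsq_term_ge0.
- exact/measurable_EFinP.
rewrite -ge0_integralD//; last 4 first.
- by move=> z _; rewrite -EFinM lee_fin mulr_ge0 ?fsq_term_ge0.
- by apply: measurable_funeM; exact/measurable_EFinP.
- by move=> z _; rewrite -EFinM lee_fin mulr_ge0 ?fsq_term_ge0.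
- by apply: measurable_funeM; exact/measurable_EFinP.
apply: ge0_le_integral => //.
- by move=> z _; rewrite lee_fin fsq_term_ge0.
- by apply/measurable_EFinP; exact: (measurable_fsq (cmeasurableD mu mv)).
- by apply: emeasurable_funD; apply: measurable_funeM; exact/measurable_EFinP.
move=> z _; rewrite -!EFinM -EFinD lee_fin.
rewrite [leRHS](_ : _ = (2 * cmod (u z) ^+ 2 + 2 * cmod (v z) ^+ 2) * gauss_weight z).
  by rewrite ler_wpM2r ?gauss_weight_ge0// cmodD_sqr.
by ring.
Qed.

Lemma fock_hol F : fock F -> holomorphic F. Proof. by case. Qed.

Lemma fock_fsq F : fock F -> (fsq F < +oo)%E. Proof. by move/fockP => []. Qed.

Lemma fock0 : fock (fun=> 0 : C).
Proof.
apply/fockP; split; first exact: (@holomorphic_cst R 0).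
rewrite /fsq (eq_integral (cst 0%E)) ?integral0//.
by move=> z _; rewrite cmod0 expr0n mul0r.
Qed.

Lemma fockZ (c : C) F : fock F -> fock (fun z => c * F z).
Proof.
move=> /fockP[hF F2]; apply/fockP; split.
  exact: (@holomorphicM _ (fun=> c) F (@holomorphic_cst R c) hF).
by rewrite fsqZ// lte_mul_pinfty// lee_fin sqr_ge0.
Qed.

Lemma fockD F G : fock F -> fock G -> fock (fun z => F z + G z).
Proof.
move=> /fockP[hF F2] /fockP[hG G2]; apply/fockP; split; first exact: (@holomorphicD _ F G hF hG).
apply: (le_lt_trans (fsqD_le (cmeasurable_hol_pt hF) (cmeasurable_hol_pt hG))).
by apply: lte_add_pinfty; rewrite lte_mul_pinfty// lee_fin.
Qed.

Lemma fockB F G : fock F -> fock G -> fock (fun z => F z - G z).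
Proof.
move=> fF fG; rewrite (_ : (fun _ => _) = (fun z => F z + -1 * G z)).
  exact: (fockD fF (fockZ (-1) fG)).
by apply/funext => z; rewrite mulN1r.
Qed.

Lemma fock_sum n (F : 'I_n -> C -> C) : (forall i, fock (F i)) ->
  fock (fun z => \sum_(i < n) F i z).
Proof.
elim: n F => [|n IH] F fF.
  by rewrite (_ : (fun _ => _) = (fun=> 0)); [exact: fock0|apply/funext => z; rewrite big_ord0].
rewrite (_ : (fun _ => _) = (fun z => \sum_(i < n) F (widen_ord (leqnSn n) i) z + F ord_max z)).
  exact: (fockD (IH (fun i => F (widen_ord (leqnSn n) i)) (fun i => fF _)) (fF ord_max)).
by apply/funext => z; rewrite big_ord_recr.
Qed.

(** A triangle inequality up to the factor 2, which comes from |u + v|^2 <= 2|u|^2 + 2|v|^2. *)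
Lemma fock_normB_le F G : fock F -> fock G ->
  fock_norm (fun z => F z - G z) <= 2 * (fock_norm F + fock_norm G).
Proof.
move=> fF fG; have fFG := fockB fF fG.
have [hF F2] := (fockP F).1 fF; have [hG G2] := (fockP G).1 fG.
have hG' : holomorphic (fun z => -1 * G z).
  exact: (@holomorphicM _ (fun=> -1) G (@holomorphic_cst R (-1)) hG).
have := fsqD_le (cmeasurable_hol_pt hF) (cmeasurable_hol_pt hG').
rewrite -/(fsq F) -/(fsq (fun z => -1 * G z)) fsqZ// cmodN cmod1 expr1n mul1e.
have -> : (\int[leb2 R]_z (cmod (F (pt z) + -1 * G (pt z)) ^+ 2 * gauss_weight z)%:E)%E =
    fsq (fun z => F z - G z).
  by apply: eq_integral => z _; rewrite mulN1r.
rewrite (fock_norm_fsq F2) (fock_norm_fsq G2) (fock_norm_fsq (fock_fsq fFG)).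
rewrite -!EFinM -EFinD lee_fin.
have p0 := pi_gt0 R; set a := fock_norm F; set b := fock_norm G; set c := fock_norm _.
rewrite (_ : _ + _ = pi * (2 * a ^+ 2 + 2 * b ^+ 2)); last by ring.
rewrite ler_pM2l// => h.
have a0 : 0 <= a := fock_norm_ge0 _; have b0 : 0 <= b := fock_norm_ge0 _.
rewrite -(@ler_pXn2r _ 2)// ?nnegrE ?fock_norm_ge0//; last by rewrite mulr_ge0// addr_ge0.
rewrite (le_trans h)//; nra.
Qed.

Lemma cintegrable_fock_inner F G : fock F -> fock G ->
  cintegrable (leb2 R) setT
    (fun z => F (pt z) * conjc (G (pt z)) * (gauss_weight z)%:C).
Proof.
move=> /fockP[hF F2] /fockP[hG G2].
have mF := cmeasurable_hol_pt hF; have mG := cmeasurable_hol_pt hG.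
have I u : cmeasurable setT u ->
    (\int[leb2 R]_z (cmod (u z) ^+ 2 * gauss_weight z)%:E < +oo)%E ->
    (leb2 R).-integrable setT (EFin \o (fun z => cmod (u z) ^+ 2 * gauss_weight z)).
  move=> mu u2; apply/integrableP; split; first by apply/measurable_EFinP; exact: (measurable_fsq mu).
  under eq_integral do rewrite /= ger0_norm ?fsq_term_ge0//.
  exact: u2.
apply: (le_cintegrable _ _ (integrableD measurableT (I _ mF F2) (I _ mG G2))) => //.
  by apply: cmeasurableM; [apply: cmeasurableM => //; exact: cmeasurableJ|exact: cmeasurable_gauss].
move=> z _ /=; rewrite !cmodM cmodJ cmodR (ger0_norm (gauss_weight_ge0 _)) -mulrDl.
rewrite ler_wpM2r ?gauss_weight_ge0//.
by have := sqr_ge0 (cmod (F (pt z)) - cmod (G (pt z)));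
  have := sqr_ge0 (cmod (F (pt z)) + cmod (G (pt z))); nra.
Qed.

Lemma fock_innerBr F G G' : fock F -> fock G -> fock G' ->
  fock_inner F (fun z => G z - G' z) = fock_inner F G - fock_inner F G'.
Proof.
move=> fF fG fG'; rewrite /fock_inner -mulrBr -cintegralB//;
  try exact: cintegrable_fock_inner.
congr (_ * _); apply: eq_cintegral => z _.
by apply: complex_ext; rewrite !ReImE /=; ring.
Qed.

(** Weyl translation by c with phase e^(i tau). Every [beta h q] has this form, for both signs of h,
    so unitarity and the group law are checked once here. *)
Definition wshift (tau : R) (c : C) F : C -> C := fun zeta =>
  cexp (0 +i* tau - zeta * conjc c - (cmod c ^+ 2 / 2)%:C) * F (zeta + c).

Lemma wshift_hol tau c F : holomorphic F -> holomorphic (wshift tau c F).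
Proof.
move=> hF; apply: (@holomorphicM _
  (fun z => cexp (0 +i* tau - z * conjc c - (cmod c ^+ 2 / 2)%:C)) (fun z => F (z + c))).
  apply: (@holomorphic_comp _ (@cexp R)
    (fun z => 0 +i* tau - z * conjc c - (cmod c ^+ 2 / 2)%:C)); first exact: holomorphic_cexp.
  have := @holomorphic_affine R (- conjc c) (0 +i* tau - (cmod c ^+ 2 / 2)%:C).
  by congr holomorphic; apply/funext => z; ring.
apply: (@holomorphic_comp _ F (fun z => z + c) hF).
by have := @holomorphic_affine R 1 c; congr holomorphic; apply/funext => z; rewrite mul1r.
Qed.

(** Completing the square: the exponential factor turns the Gaussian at z into the Gaussian at z +
    c, so isometry reduces to translation invariance of Lebesgue measure. *)
Lemma wshift_sqr tau c F (z : R2) :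
  cmod (wshift tau c F (pt z)) ^+ 2 * gauss_weight z =
  cmod (F (pt z + c)) ^+ 2 * gauss_weight (z.1 + Re c, z.2 + Im c).
Proof.
rewrite /wshift cmodM exprMn cmod_cexp mulrAC mulrC; congr (_ * _).
rewrite /gauss_weight -expRM_natl -expRD; congr expR.
by rewrite !ReImE /= cmod_sqr; case: c => a b /=; field.
Qed.

Lemma pt_shift (z : R2) c : pt z + c = pt (z.1 + Re c, z.2 + Im c).
Proof. by apply: complex_ext; rewrite !ReImE. Qed.

Lemma fsq_wshift tau c F : holomorphic F -> fsq (wshift tau c F) = fsq F.
Proof.
move=> hF; have [_ h] := mpres_translation2 (Re c, Im c).
rewrite /fsq -[RHS](h (fun z => (cmod (F (pt z)) ^+ 2 * gauss_weight z)%:E)) /=.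
- by apply: eq_integral => z _; rewrite wshift_sqr pt_shift.
- by apply/measurable_EFinP; exact: (measurable_fsq (cmeasurable_hol_pt hF)).
- by move=> z; rewrite lee_fin fsq_term_ge0.
Qed.

Lemma fock_wshift tau c F : fock F -> fock (wshift tau c F).
Proof.
move=> /fockP[hF F2]; apply/fockP; split; first exact: (@wshift_hol tau c F hF).
by rewrite (fsq_wshift tau c hF); exact: F2.
Qed.

Lemma fock_norm_wshift tau c F : holomorphic F ->
  fock_norm (wshift tau c F) = fock_norm F.
Proof. by move=> hF; apply: eq_fock_norm_fsq; exact: (fsq_wshift tau c hF). Qed.

(** Translate the variable by -c and write the weight as exp(- z conj z); the two exponents then
    coincide. *)
Lemma fock_inner_wshift tau c F G : fock F -> fock G ->
  fock_inner (wshift tau c F) G = fock_inner F (wshift (- tau) (- c) G).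
Proof.
move=> fF fG; have fF' := fock_wshift tau c fF.
have /cintegrableP -/(_ measurableT)[m _] := cintegrable_fock_inner fF' fG.
rewrite /fock_inner -(mpres_cintegral (mpres_translation2 (- Re c, - Im c)) m).
congr (_ * _); apply: eq_cintegral => z _ /=.
have -> : ((z.1 - Re c) +i* (z.2 - Im c)) = pt z - c by apply: complex_ext; rewrite !ReImE.
rewrite /wshift subrK conjcM cexpJ.
have E (w : R2) : (gauss_weight w)%:C = cexp (- (pt w * conjc (pt w))).
  rewrite mulJc gauss_weight_cmod; apply: complex_ext; rewrite /= ?oppr0 ?cos0 ?sin0 ?mulr1 ?mulr0//.
have E' : (gauss_weight (z.1 - Re c, z.2 - Im c))%:C =
    cexp (- ((pt z - c) * conjc (pt z - c))).
  rewrite E; have -> : pt (z.1 - Re c, z.2 - Im c) = pt z - c.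
    by apply: complex_ext; rewrite !ReImE.
  by [].
rewrite E' E.
set f := F _; set g := conjc (G _).
transitivity (cexp (0 +i* tau - (pt z - c) * conjc c - (cmod c ^+ 2 / 2)%:C
   - (pt z - c) * conjc (pt z - c)) * (f * g)).
  by rewrite [in RHS]cexpD; ring.
transitivity (cexp (conjc (0 +i* - tau - pt z * conjc (- c) - (cmod (- c) ^+ 2 / 2)%:C)
   - pt z * conjc (pt z)) * (f * g)); last by rewrite cexpD; ring.
congr (cexp _ * _); rewrite cmodN.
by apply: complex_ext; rewrite !ReImE /= ?ReImE ?cmod_sqr; field.
Qed.

(** The Weyl relation: displacements add up to a phase, which is the cocycle of the Heisenberg group
    law. *)
Lemma wshift_comp tau c sigma d F :
  wshift tau c (wshift sigma d F) =
  wshift (tau + sigma - Im (c * conjc d)) (c + d) F.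
Proof.
apply/funext => z; rewrite /wshift (addrA z c d) mulrA -cexpD; congr (cexp _ * _).
by apply: complex_ext; rewrite !ReImE /= ?cmod_sqr ?ReImE; field.
Qed.

End fock_space.

(** * Sigma-finiteness of iterated product measures *)

Section sigma_finite_product.
Context d1 d2 (X : measurableType d1) (Y : measurableType d2) (R : realType).
Variables (m1 : {sigma_finite_measure set X -> \bar R}).
Variables (m2 : {sigma_finite_measure set Y -> \bar R}).

Lemma sigma_finite_prod : sigma_finite setT (m1 \x m2)%E.
Proof.
have [F FT Ffin] := sigma_finiteT m1; have [G GT Gfin] := sigma_finiteT m2.
exists (fun n => if unpickle n is Some ij then F ij.1 `*` G ij.2 else set0).
  apply/seteqP; split=> // -[x y] _.
  have : setT x by []. rewrite FT => -[i _ Fi].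
  have : setT y by []. rewrite GT => -[j _ Gj].
  by exists (pickle (i, j)) => //; rewrite pickleK.
move=> n; case: (unpickle n) => [[i j]|]; last by split => //; rewrite measure0.
have [mF lF] := Ffin i; have [mG lG] := Gfin j; split; first exact: measurableX.
by rewrite product_measure1E// lte_mul_pinfty// ge0_fin_numE.
Qed.

                                                                         
                                              
(** The product measure bundled with its sigma-finiteness, so that Fubini and Tonelli apply again
    with [leb2] and [leb3] as factors. *)
Definition sprod : {sigma_finite_measure set (X * Y)%type -> \bar R} :=
  HB.pack_for (sigma_finite_measure (X * Y)%type R) (m1 \x m2)%E
    (Measure_isSigmaFinite.Build _ _ _ (m1 \x m2)%E sigma_finite_prod).

End sigma_finite_product.

Definition sleb1 (R : realType) :
  {sigma_finite_measure set (measurableTypeR R) -> \bar R} := @lebesgue_measure R.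

Definition sleb2 (R : realType) :
  {sigma_finite_measure set (measurableTypeR R * measurableTypeR R)%type -> \bar R} :=
  sprod (sleb1 R) (sleb1 R).

Definition sleb3 (R : realType) : {sigma_finite_measure set
    (measurableTypeR R * measurableTypeR R * measurableTypeR R)%type -> \bar R} :=
  sprod (sleb2 R) (sleb1 R).

(** * Point evaluation and the reproducing formula *)

Section reproducing.
Context {R : realType}.
Local Notation C := R[i].
Implicit Types F G : C -> C.
Local Notation R2 := (measurableTypeR R * measurableTypeR R)%type.
Local Notation pt z := (z.1 +i* z.2).

Definition gint (u : R2 -> C) : C :=
  cintegral (leb2 R) setT (fun z => u z * (gauss_weight z)%:C).

Definition gintegrable (u : R2 -> C) : Prop :=
  cintegrable (leb2 R) setT (fun z => u z * (gauss_weight z)%:C).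

Lemma cmod_gauss (v : C) (z : R2) :
  cmod (v * (gauss_weight z)%:C) = cmod v * gauss_weight z.
Proof. by rewrite cmodM cmodR (ger0_norm (gauss_weight_ge0 _)). Qed.

Lemma gauss_weight_rot (z : R2) (t : R) :
  gauss_weight (cos t * z.1 - sin t * z.2, sin t * z.1 + cos t * z.2) = gauss_weight z.
Proof.
rewrite /gauss_weight /=; congr (expR (- _)).
transitivity ((cos t ^+ 2 + sin t ^+ 2) * (z.1 ^+ 2 + z.2 ^+ 2)); first by ring.
by rewrite cos2Dsin2 mul1r.
Qed.

Lemma pt_rot (z : R2) (t : R) : pt z * cexp (0 +i* t) =
  pt (cos t * z.1 - sin t * z.2, sin t * z.1 + cos t * z.2).
Proof. by apply: complex_ext; rewrite !ReImE /= expR0; ring. Qed.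

                                                                             
                                                 
(** The Gaussian measure is rotation invariant, so F may be replaced by its average over rotations,
    which is the constant F 0 by [circle_mean]; Fubini exchanges the average with the integral. *)
Lemma gauss_mean F : holomorphic F -> gintegrable (fun z => F (pt z)) ->
  gint (fun z => F (pt z)) = pi%:C * F 0.
Proof.
move=> hF IF.
pose D := `[0, 2 * pi]%classic : set (measurableTypeR R).
have mD : measurable D by exact: measurable_itv.
have pp : 0 <= 2 * pi :> R by rewrite mulr_ge0// pi_ge0.
have muD : sleb1 R D = (2 * pi)%:E.
  rewrite [LHS]lebesgue_measure_itv /= lte_fin mulr_gt0 ?pi_gt0//.
  by rewrite -EFinB subr0.
(* Kernel on angle times plane. Integrating first over the plane gives 2 pi copies of the integral;
   integrating first over the angle gives F 0 times the total mass. *)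
pose k (p : measurableTypeR R * R2) : C := (\1_D p.1)%:C *
  (F (pt p.2 * cexp (0 +i* p.1)) * (gauss_weight p.2)%:C).
have [mIF lIF] := (cintegrableP _ _ measurableT).1 IF.
have rot t : mpres (leb2 R) (leb2 R)
    (fun z => (cos t * z.1 - sin t * z.2, sin t * z.1 + cos t * z.2)).
  by apply: mpres_rotation; exact: cos2Dsin2.
have krot t (z : R2) : F (pt z * cexp (0 +i* t)) * (gauss_weight z)%:C =
    (fun w : R2 => F (pt w) * (gauss_weight w)%:C)
      (cos t * z.1 - sin t * z.2, sin t * z.1 + cos t * z.2).
  by rewrite /= gauss_weight_rot pt_rot.
have mk : cmeasurable setT k.
  apply: cmeasurableM.
    apply: cmeasurableR.
    apply: (@measurableT_comp _ _ _ _ _ _ (\1_D : measurableTypeR R -> R)).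
      exact: measurable_indic.
    exact: measurable_fst.
  apply: cmeasurableM.
    apply: (cmeasurable_hol _ hF).
    apply: cmeasurableM; first exact: (cmeasurable_comp cmeasurable_pt measurable_snd).
    apply: cmeasurable_cexp; split => /=; [exact: measurable_cst|exact: measurable_fst].
  exact: (cmeasurable_comp cmeasurable_gauss measurable_snd).
have Ik : cintegrable (sleb1 R \x sleb2 R)%E setT k.
  apply/cintegrableP => //; split => //.
  rewrite fubini_tonelli1//; last 2 first.
  - by apply/measurable_EFinP; exact: measurable_cmod.
  - by move=> p; rewrite lee_fin cmod_ge0.
  pose A := fine (\int[leb2 R]_z (cmod (F (pt z) * (gauss_weight z)%:C))%:E)%E.
  have EA : (\int[leb2 R]_z (cmod (F (pt z) * (gauss_weight z)%:C))%:E)%E = A%:E.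
    rewrite fineK// ge0_fin_numE//; apply: integral_ge0 => z _.
    by rewrite lee_fin cmod_ge0.
  rewrite (eq_integral (fun t => (\1_D t)%:E * A%:E)%E); last first.
    move=> t _; rewrite /fubini_F.
    have -> : ((\1_D t)%:E * A%:E = \int[leb2 R]_z ((\1_D t)%:E *
        (cmod (F (pt z) * (gauss_weight z)%:C))%:E))%E.
      rewrite -EA ge0_integralZl_EFin//.
        by move=> z _; rewrite lee_fin cmod_ge0.
      by apply/measurable_EFinP; exact: measurable_cmod.
    rewrite -[RHS]((rot t).2 (fun z : R2 => ((\1_D t)%:E *
      (cmod (F (pt z) * (gauss_weight z)%:C))%:E)%E)); last 2 first.
    - by apply: measurable_funeM; apply/measurable_EFinP; exact: measurable_cmod.
    - by move=> z; rewrite -EFinM lee_fin mulr_ge0 ?cmod_ge0// indicE ler0n.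
    apply: eq_integral => z _; rewrite /k [fst _]/= [snd _]/= cmodM cmodR.
    by rewrite krot /= -EFinM ger0_norm// indicE ler0n.
  have A0 : (0 <= A%:E)%E.
    by rewrite lee_fin fine_ge0// integral_ge0// => z _; rewrite lee_fin cmod_ge0.
  rewrite ge0_integralZr//; last by apply/measurable_EFinP; exact: measurable_indic.
  have -> : (\int[sleb1 R]_x (\1_D x)%:E = (2 * pi)%:E)%E.
    by rewrite integral_indic// setIT; exact: muD.
  by rewrite -EFinM ltry.
have [_ E1] := cintegral_fubini Ik.
have [_ E2] := cintegral_fubini_swap Ik.
have H1 : cintegral (leb1 R) setT
    (fun x => cintegral (leb2 R) setT (fun y => k (x, y))) =
    (2 * pi)%:C * gint (fun z => F (pt z)).
  have -> : (2 * pi)%:C * gint (fun z => F (pt z)) = cintegral (leb1 R) setT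
      (crestrict D (fun=> gint (fun z => F (pt z)))).
    by rewrite -cintegral_mkcond -/(seg 0 (2 * pi) _) seg_cst// subr0.
  apply: eq_cintegral => t _; rewrite /crestrict.
  case: ifPn => tD.
    rewrite /gint -(mpres_cintegral (rot t) mIF).
    apply: eq_cintegral => z _; rewrite -krot /k /=.
    by rewrite indicE tD mul1r.
  rewrite (@eq_cintegral _ _ _ _ _ _ (fun=> 0)); last first.
    by move=> z _; rewrite /k /= indicE (negbTE tD) mul0r.
  by rewrite /cintegral /Rintegral !integral0.
have H2 : cintegral (leb2 R) setT
    (fun y => cintegral (leb1 R) setT (fun x => k (x, y))) =
    ((2 * pi)%:C * F 0) * pi%:C.
  transitivity (cintegral (leb2 R) setT (fun y => ((2 * pi)%:C * F 0) * (gauss_weight y)%:C)).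
    apply: eq_cintegral => z _; rewrite -(circle_mean (pt z) hF) /seg mulrC.
    have cF : rcont (fun t => F (pt z * cexp (0 +i* t))).
      apply: (@rcont_comp _ (fun v => F (pt z * v))).
        apply: (@holomorphic_comp _ F (fun v => pt z * v) hF).
        have := @holomorphic_affine R (pt z) 0; congr holomorphic.
        by apply/funext => v; rewrite addr0.
      apply: (@rcont_comp _ (@cexp R)); first exact: holomorphic_cexp.
      by split=> x /=; [exact: cvg_cst|exact: cvg_id].
    rewrite -cintegralZl//; last exact: rcont_cintegrable.
    rewrite [RHS]cintegral_mkcond; apply: eq_cintegral => t _.
    rewrite /crestrict /k /= indicE; case: ifPn => tD; last by rewrite mul0r.
    by rewrite mul1r mulrC.
  rewrite cintegralZl//.
    congr (_ * _); rewrite /cintegral /Rintegral /= integral_gauss_weight/=.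
    by rewrite integral0.
  apply: (@le_cintegrable _ _ _ _ _ _ (fun z : R2 => gauss_weight z)) => //.
  - exact: cmeasurable_gauss.
  - apply/integrableP; split; first by apply/measurable_EFinP; exact: measurable_gauss.
    under eq_integral do rewrite /= ger0_norm ?gauss_weight_ge0//.
    by rewrite integral_gauss_weight ltry.
  - by move=> z _; rewrite cmodR ger0_norm ?gauss_weight_ge0.
have : (2 * pi)%:C * gint (fun z => F (pt z)) = (2 * pi)%:C * (pi%:C * F 0).
  by rewrite -H1 E1 -E2 H2; ring.
apply: mulfI; apply/eqP => -[/eqP]; apply/negP.
by rewrite mulf_neq0// gt_eqF// pi_gt0.
Qed.

Lemma fock1 : fock (fun=> 1 : C).
Proof.
apply/fockP; split; first exact: (@holomorphic_cst R 1).
rewrite /fsq (eq_integral (fun z : R2 => (gauss_weight z)%:E)).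
  by rewrite integral_gauss_weight ltry.
by move=> z _; rewrite cmod1 expr1n mul1r.
Qed.

Lemma fock_gintegrable F : fock F -> gintegrable (fun z => F (pt z)).
Proof.
move=> fF; have := cintegrable_fock_inner fF fock1.
by congr cintegrable; apply/funext => z; rewrite conjc1 mulr1.
Qed.

Lemma fock_gint F : fock F -> gint (fun z => F (pt z)) = pi%:C * F 0.
Proof. by move=> fF; apply: gauss_mean; [exact: fF.1|exact: fock_gintegrable]. Qed.

Lemma wshift_at0 tau c F : F c =
  cexp (- (0 +i* tau - (cmod c ^+ 2 / 2)%:C)) * wshift tau c F 0.
Proof. by rewrite /wshift mul0r subr0 add0r mulrA -cexpD addNr cexp0 mul1r. Qed.

(** The isometry [wshift] moves c to 0, where the value is a Gaussian mean, and Cauchy-Schwarz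
    bounds that mean. This makes evaluation continuous and lets Bochner integrals be computed
    pointwise. *)
Lemma fock_eval_le F c : fock F ->
  cmod (F c) <= 2 * expR (cmod c ^+ 2 / 2) * fock_norm F.
Proof.
move=> fF; have fG := fock_wshift 0 c fF; have hF := fock_hol fF.
rewrite (wshift_at0 0 c) cmodM cmod_cexp !ReImE /= sub0r opprK.
rewrite [leLHS]mulrC [leRHS]mulrAC ler_pM2r ?expR_gt0// -(fock_norm_wshift 0 c hF).
set G := wshift 0 c F in fG *.
have p0 := pi_gt0 R; rewrite -(ler_pM2l p0).
have -> : pi * cmod (G 0) = cmod (gint (fun z => G (pt z))).
  by rewrite fock_gint// cmodM cmodR (gtr0_norm p0).
have [mG _] := (cintegrableP _ _ measurableT).1 (fock_gintegrable fG).
(* Cauchy-Schwarz is stated without a weight, so each factor receives the square root of the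
   Gaussian. *)
pose s (z : R2) := Num.sqrt (gauss_weight z).
have s2 z : s z ^+ 2 = gauss_weight z by rewrite sqr_sqrtr// gauss_weight_ge0.
have ms : measurable_fun setT s.
  apply: (@measurableT_comp _ _ _ _ _ _ (@Num.sqrt R)); last exact: measurable_gauss.
  by apply: continuous_measurable_fun; exact: sqrt_continuous.
have hG := fock_hol fG; have mG' := cmeasurable_hol_pt hG.
have [||||||I [EI I0 I2]] := @cauchy_schwarz _ _ R (leb2 R)
  (fun z => cmod (G (pt z)) * s z) s (pi * fock_norm G ^+ 2) pi.
- by apply: measurable_funM => //; exact: measurable_cmod.
- exact: ms.
- by move=> z; rewrite mulr_ge0 ?cmod_ge0// sqrtr_ge0.
- by move=> z; exact: sqrtr_ge0.
- rewrite -(fock_norm_fsq (fock_fsq fG)) le_eqVlt; apply/orP; left; apply/eqP.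
  by apply: eq_integral => z _; rewrite exprMn s2.
- rewrite -integral_gauss_weight le_eqVlt; apply/orP; left; apply/eqP.
  by apply: eq_integral => z _; rewrite s2.
have IN : I <= pi * fock_norm G.
  rewrite -(@ler_pXn2r _ 2)// ?nnegrE ?mulr_ge0 ?fock_norm_ge0 ?(ltW p0)//.
  by rewrite (le_trans I2)// le_eqVlt; apply/orP; left; apply/eqP; ring.
rewrite mulrCA; apply: (@le_trans _ _ (2 * I)); last by rewrite ler_pM2l.
rewrite -lee_fin (le_trans (cmod_cintegral_le _ measurableT mG))// EFinM -EI.
rewrite le_eqVlt; apply/orP; left; apply/eqP; congr (_ * _)%E.
by apply: eq_integral => z _; rewrite cmod_gauss -mulrA -expr2 s2.
Qed.

Lemma fock_norm_eq0 F : fock F -> fock_norm F = 0 -> F = (fun=> 0).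
Proof.
move=> fF F0; apply/funext => c; apply/cmod_eq0/eqP.
by rewrite eq_le cmod_ge0 andbT (le_trans (fock_eval_le c fF))// F0 mulr0.
Qed.

(** The value at c is, up to an exponential, the value at 0 of a Weyl translate, which [fock_gint]
    computes; translating the integral back produces the kernel. *)
Lemma fock_reproducing F c : fock F ->
  pi%:C * F c = gint (fun z => F (pt z) * cexp (conjc (pt z) * c)).
Proof.
move=> fF; have fG := fock_wshift 0 c fF.
have [mG _] := (cintegrableP _ _ measurableT).1 (fock_gintegrable fG).
rewrite (wshift_at0 0 c) mulrCA -fock_gint// /gint.
rewrite -(mpres_cintegral (mpres_translation2 (- Re c, - Im c)) mG).
rewrite -cintegralZl//; last first.
  exact: (mpres_cintegrable (mpres_translation2 (- Re c, - Im c)) (fock_gintegrable fG)).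
apply: eq_cintegral => z _.
have -> : pt (z.1 + (- Re c, - Im c).1, z.2 + (- Re c, - Im c).2) = pt z - c.
  by apply: complex_ext; rewrite !ReImE.
rewrite /wshift subrK.
have E (v : C) : (expR (- cmod v ^+ 2))%:C = cexp (- (v * conjc v)).
  rewrite mulJc; apply: complex_ext; rewrite /= ?oppr0 ?cos0 ?sin0 ?mulr1 ?mulr0//.
rewrite !gauss_weight_cmod !E.
have -> : pt (z.1 + (- Re c, - Im c).1, z.2 + (- Re c, - Im c).2) = pt z - c.
  by apply: complex_ext; rewrite !ReImE.
set f := F _.
transitivity (cexp (- (0 +i* 0 - (cmod c ^+ 2 / 2)%:C) +
  ((0 +i* 0 - (pt z - c) * conjc c - (cmod c ^+ 2 / 2)%:C) +
   (- ((pt z - c) * conjc (pt z - c))))) * f).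
  by rewrite !cexpD; ring.
rewrite -mulrA -cexpD mulrC; congr (_ * cexp _).
by apply: complex_ext; rewrite !ReImE /= ?ReImE ?cmod_sqr; field.
Qed.

End reproducing.

(** * Holomorphy from the reproducing formula *)

Section projection.
Context {R : realType}.
Local Notation C := R[i].
Implicit Types F G : C -> C.
Local Notation R2 := (measurableTypeR R * measurableTypeR R)%type.
Local Notation pt z := (z.1 +i* z.2).

Definition gsq (v : R2 -> C) : \bar R :=
  (\int[leb2 R]_z (cmod (v z) ^+ 2 * gauss_weight z)%:E)%E.

Lemma gsq_integrable (v : R2 -> C) : cmeasurable setT v -> (gsq v < +oo)%E ->
  (leb2 R).-integrable setT (EFin \o (fun z => cmod (v z) ^+ 2 * gauss_weight z)).
Proof.
move=> mv v2; apply/integrableP; split.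
  by apply/measurable_EFinP; exact: (measurable_fsq mv).
under eq_integral do rewrite /= ger0_norm ?fsq_term_ge0//.
exact: v2.
Qed.

(** Since |z| <= |x| + |y|, the growth is dominated by one of four exponentials of linear forms,
    chosen by the quadrant of z. Each is the modulus of a Fock function. *)
Lemma exp_cmod_le (a : R) (z : C) : 0 <= a -> exists s : bool * bool,
  expR (a * cmod z) <=
    expR (- Re (z * conjc (((-1) ^+ s.1 * a) +i* ((-1) ^+ s.2 * a)))).
Proof.
move=> a0; exists (0 <= Re z, 0 <= Im z); rewrite ler_expR.
apply: (le_trans (ler_wpM2l a0 (cmod_le_ReIm z))); rewrite !ReImE /=.
have S (x : R) : `|x| = - ((-1) ^+ (0 <= x)%R * x).
  by case: (ger0P x) => x0; rewrite ?expr1 ?expr0; [ring|rewrite mul1r].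
by rewrite !S le_eqVlt; apply/orP; left; apply/eqP; ring.
Qed.

Lemma gauss_growth_integrable (v : R2 -> C) (a : R) : cmeasurable setT v ->
  (gsq v < +oo)%E -> 0 <= a ->
  (leb2 R).-integrable setT
    (EFin \o (fun z => cmod (v z) * expR (a * cmod (pt z)) * gauss_weight z)).
Proof.
move=> mv v2 a0.
pose c (s : bool * bool) : C := ((-1) ^+ s.1 * a) +i* ((-1) ^+ s.2 * a).
pose K s : C -> C := fun z => cexp (cmod (c s) ^+ 2 / 2)%:C * wshift 0 (c s) (fun=> 1) z.
have fK s : fock (K s) by apply: fockZ; apply: fock_wshift; exact: fock1.
have mK s := cmeasurable_hol_pt (fock_hol (fK s)).
have cK s z : cmod (K s z) = expR (- Re (z * conjc (c s))).
  by rewrite /K /wshift mulr1 -cexpD cmod_cexp !ReImE /= ?ReImE; congr expR; ring.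
have IK s : (leb2 R).-integrable setT
    (EFin \o (fun z => cmod (K s (pt z)) ^+ 2 * gauss_weight z)).
  by apply: gsq_integrable; [exact: mK|exact: (fock_fsq (fK s))].
have Iv := gsq_integrable mv v2.
have I4 := integrableD measurableT
  (integrableD measurableT (IK (true, true)) (IK (true, false)))
  (integrableD measurableT (IK (false, true)) (IK (false, false))).
apply: (le_integrable measurableT _ _ (integrableD measurableT Iv I4)).
  apply/measurable_EFinP; apply: measurable_funM; last exact: measurable_gauss.
  apply: measurable_funM; first exact: measurable_cmod.
  apply: measurableT_comp => //; apply: measurable_funM; first exact: measurable_cst.
  by apply: measurable_cmod; exact: cmeasurable_pt.
move=> z _ /=; rewrite lee_fin.
have g0 := gauss_weight_ge0 z; have t0 s := fsq_term_ge0 z (K s (pt z)).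
rewrite !ger0_norm//; last 2 first.
- by rewrite !addr_ge0// fsq_term_ge0.
- by rewrite !mulr_ge0 ?cmod_ge0 ?expR_ge0.
rewrite -!mulrDl ler_wpM2r//.
have [s sP] := exp_cmod_le (pt z) a0.
have q0 s' := sqr_ge0 (cmod (K s' (pt z))).
have H : expR (a * cmod (pt z)) ^+ 2 <= cmod (K s (pt z)) ^+ 2.
  by rewrite ler_pXn2r ?nnegrE ?expR_ge0 ?cmod_ge0// cK.
have S : cmod (K s (pt z)) ^+ 2 <=
    cmod (K (true, true) (pt z)) ^+ 2 + cmod (K (true, false) (pt z)) ^+ 2 +
   (cmod (K (false, true) (pt z)) ^+ 2 + cmod (K (false, false) (pt z)) ^+ 2).
  have h1 := q0 (true, true); have h2 := q0 (true, false).
  have h3 := q0 (false, true); have h4 := q0 (false, false).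
  by clear -h1 h2 h3 h4; case: s => [[] []]; lra.
apply: (@le_trans _ _ (cmod (v z) ^+ 2 + expR (a * cmod (pt z)) ^+ 2)).
  set x := cmod _; set y := expR _.
  by have := sqr_ge0 (x - y); have := sqr_ge0 (x + y); nra.
by rewrite lerD2l (le_trans H).
Qed.

Lemma le_expR (r : R) : r <= expR r.
Proof. by rewrite (le_trans _ (expR_ge1Dx r))// lerDr. Qed.

(** Differentiation under the integral sign, with the quadratic remainder of the exponential
    dominated uniformly for |h| <= 1. *)
Lemma gint_kernel_hol (v : R2 -> C) : cmeasurable setT v -> (gsq v < +oo)%E ->
  holomorphic (fun c => gint (fun z => v z * cexp (conjc (pt z) * c))).
Proof.
move=> mv v2; apply/holomorphicP => c; pose a := cmod c.
(* With r = |z|, the 3 pays for r^2 <= (e^r)^2 and for the factor e^r in the remainder estimate. *)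
pose M (z : R2) := cmod (v z) * expR ((a + 3) * cmod (pt z)) * gauss_weight z.
have a0 : 0 <= a := cmod_ge0 c.
have IM : (leb2 R).-integrable setT (EFin \o M).
  by apply: gauss_growth_integrable => //; rewrite addr_ge0.
have mconj : cmeasurable setT (fun z : R2 => conjc (pt z)).
  by apply: cmeasurableJ; exact: cmeasurable_pt.
have mexp d : cmeasurable setT (fun z : R2 => cexp (conjc (pt z) * d)).
  by apply: cmeasurable_cexp; apply: cmeasurableM => //; exact: cmeasurable_cst.
have Rle (x y : C) : Re (x * y) <= cmod x * cmod y.
  by rewrite -cmodM (le_trans (ler_norm _))// normr_Re_le.
have I0 h : cmod h <= 1 -> gintegrable (fun z => v z * cexp (conjc (pt z) * (c + h))).
  move=> h1; apply: (le_cintegrable _ _ IM) => //.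
    by apply: cmeasurableM; [exact: cmeasurableM|exact: cmeasurable_gauss].
  move=> z _; rewrite cmod_gauss /M ler_wpM2r ?gauss_weight_ge0//.
  rewrite cmodM ler_wpM2l ?cmod_ge0// cmod_cexp ler_expR.
  rewrite (le_trans (Rle _ _))// cmodJ mulrC ler_wpM2r ?cmod_ge0//.
  by rewrite (le_trans (cmodD _ _))// lerD// (le_trans h1)// ler1n.
have I1 : gintegrable (fun z => v z * (conjc (pt z) * cexp (conjc (pt z) * c))).
  apply: (le_cintegrable _ _ IM) => //.
    apply: cmeasurableM; last exact: cmeasurable_gauss.
    by apply: cmeasurableM => //; exact: cmeasurableM.
  move=> z _; rewrite cmod_gauss /M ler_wpM2r ?gauss_weight_ge0//.
  rewrite cmodM ler_wpM2l ?cmod_ge0// cmodM cmod_cexp cmodJ.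
  set r := cmod (pt z); have r0 : 0 <= r := cmod_ge0 _.
  apply: (@le_trans _ _ (expR r * expR (r * a))).
    by rewrite ler_pM ?expR_ge0 ?le_expR// ler_expR (le_trans (Rle _ _))// cmodJ.
  by rewrite -expRD ler_expR; nra.
pose L := gint (fun z => v z * (conjc (pt z) * cexp (conjc (pt z) * c))).
(* The constant 8 is 2 from [cmod_cintegral_le] times 4 from [cexp_sub1z_le]. *)
exists L; apply: (@has_cderiv_quadratic _ _ _ _ (8 * Rintegral (leb2 R) setT M) 1) => // h h1.
have c0 : cmod (0 : C) <= 1 by rewrite cmod0.
have Ic := I0 0 c0; rewrite addr0 in Ic.
pose D (z : R2) := v z * cexp (conjc (pt z) * (c + h)) * (gauss_weight z)%:C -
  v z * cexp (conjc (pt z) * c) * (gauss_weight z)%:C -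
  h * (v z * (conjc (pt z) * cexp (conjc (pt z) * c)) * (gauss_weight z)%:C).
have ID : cintegrable (leb2 R) setT D.
  apply: cintegrableB => //; last exact: cintegrableZl.
  by apply: cintegrableB => //; exact: I0.
have -> : gint (fun z => v z * cexp (conjc (pt z) * (c + h))) -
    gint (fun z => v z * cexp (conjc (pt z) * c)) - h * L = cintegral (leb2 R) setT D.
  rewrite /D cintegralB//; last 2 first.
  - by apply: cintegrableB => //; exact: I0.
  - exact: cintegrableZl.
  rewrite cintegralB//; last exact: I0.
  by rewrite cintegralZl.
have [mD _] := (cintegrableP _ _ measurableT).1 ID.
have EM : (\int[leb2 R]_z (M z)%:E)%E = (Rintegral (leb2 R) setT M)%:E.
  by rewrite /Rintegral fineK//; exact: (integrable_fin_num measurableT IM).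
rewrite -lee_fin (le_trans (cmod_cintegral_le _ measurableT mD))//.
have -> : (8 * Rintegral (leb2 R) setT M * cmod h ^+ 2)%:E =
    (2%:E * ((4 * cmod h ^+ 2)%:E * \int[leb2 R]_z (M z)%:E))%E.
  by rewrite EM -!EFinM; congr EFin; ring.
have mM := measurable_int _ IM.
have M0 z : 0 <= M z by rewrite /M !mulr_ge0 ?cmod_ge0 ?expR_ge0 ?gauss_weight_ge0.
have h20 : 0 <= 4 * cmod h ^+ 2 by rewrite mulr_ge0// sqr_ge0.
rewrite lee_pmul2l// -ge0_integralZl_EFin//; last by move=> z _; rewrite lee_fin.
apply: ge0_le_integral => //.
- by move=> z _; rewrite lee_fin cmod_ge0.
- by apply/measurable_EFinP; exact: measurable_cmod.
- by apply: measurable_funeM.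
move=> z _; rewrite -EFinM lee_fin.
have -> : D z = v z * (cexp (conjc (pt z) * c) *
    (cexp (conjc (pt z) * h) - 1 - conjc (pt z) * h)) * (gauss_weight z)%:C.
  by rewrite /D mulrDr cexpD; ring.
rewrite cmod_gauss /M [leRHS](_ : _ = cmod (v z) * (4 * cmod h ^+ 2 *
  expR ((a + 3) * cmod (pt z))) * gauss_weight z); last by ring.
rewrite ler_wpM2r ?gauss_weight_ge0// cmodM ler_wpM2l ?cmod_ge0// cmodM cmod_cexp.
set r := cmod (pt z); have r0 : 0 <= r := cmod_ge0 _.
apply: (@le_trans _ _ (expR (a * r) * (4 * (r * cmod h) ^+ 2 * expR r))).
  apply: ler_pM; rewrite ?expR_ge0 ?cmod_ge0//.
    by rewrite ler_expR (le_trans (Rle _ _))// cmodJ mulrC.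
  rewrite (le_trans (cexp_sub1z_le _))// cmodM cmodJ -/r ler_wpM2l//.
    by rewrite mulr_ge0// sqr_ge0.
  by rewrite ler_expR ler_piMr.
have rr : r ^+ 2 <= expR r * expR r by rewrite expr2 ler_pM// le_expR.
have -> : expR ((a + 3) * r) = expR (a * r) * (expR r * expR r * expR r).
  by rewrite -!expRD; congr expR; ring.
rewrite (_ : expR (a * r) * _ = (4 * cmod h ^+ 2) * (expR (a * r) * (r ^+ 2 * expR r))); last by ring.
by rewrite ler_wpM2l// ler_wpM2l ?expR_ge0// ler_wpM2r ?expR_ge0.
Qed.

(** Membership test for functions obtained by integration: measurability, square-integrability and
    the reproducing formula suffice, because the kernel is holomorphic in c. *)
Lemma fock_of_reproducing (V : C -> C) :
  cmeasurable setT (fun z : R2 => V (pt z)) -> (fsq V < +oo)%E ->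
  (forall c, pi%:C * V c = gint (fun z => V (pt z) * cexp (conjc (pt z) * c))) ->
  fock V.
Proof.
move=> mV V2 HV; apply/fockP; split => //.
have := @holomorphicM _ (fun=> (pi^-1)%:C) _ (@holomorphic_cst R (pi^-1)%:C)
  (gint_kernel_hol mV V2).
congr holomorphic; apply/funext => c; rewrite -HV mulrA.
have -> : (pi^-1)%:C * pi%:C = 1 :> C.
  by apply: complex_ext; rewrite !ReImE /= ?mulVf ?gt_eqF ?pi_gt0//; ring.
by rewrite mul1r.
Qed.

End projection.

(** * Norm convergence from pointwise convergence *)

Section limit_lemmas.
Context {R : realType}.
Local Notation C := R[i].

Lemma limn_einf_near_gt (u : nat -> \bar R) (x y : \bar R) :
  (y < x)%E -> (x <= limn_einf u)%E -> \forall k \near \oo, (y < u k)%E.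
Proof.
move=> yx xu; have : (y < ereal_sup (range (einfs u)))%E.
  have <- : limn_einf u = ereal_sup (range (einfs u)).
    by rewrite limn_einf_lim; apply/cvg_lim => //; exact: cvg_einfs_sup.
  exact: lt_le_trans xu.
move=> /ereal_sup_gt[_ [n _ <-] yn]; exists n => // k /= nk.
by rewrite (lt_le_trans yn)//; apply: ereal_inf_lbound; exists k.
Qed.

                                                                            
                                                                 
(** Riesz's argument: Fatou applied to 2|u_k|^2 + 2|v|^2 - |u_k - v|^2, which is nonnegative and
    tends pointwise to 4|v|^2. Convergence of the norms then forces the norm of the difference to
    0. *)
Lemma fock_scheffe (u : nat -> C -> C) (v : C -> C) :
  (forall k, fock (u k)) -> fock v ->
  (forall z, (fun k => u k z : C^o) @ \oo --> (v z : C^o)) ->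
  (fun k => fock_norm (u k)) @ \oo --> fock_norm v ->
  (fun k => fock_norm (fun z => u k z - v z)) @ \oo --> (0 : R).
Proof.
move=> fu fv uv Nuv.
have fd k := fockB (fu k) fv.
have mu k := measurable_fsq (cmeasurable_hol_pt (fock_hol (fu k))).
have mv := measurable_fsq (cmeasurable_hol_pt (fock_hol fv)).
have md k := measurable_fsq (cmeasurable_hol_pt (fock_hol (fd k))).
pose P (w : C -> C) (z : measurableTypeR R * measurableTypeR R) : R :=
  cmod (w (z.1 +i* z.2)) ^+ 2 * gauss_weight z.
have IP w : fock w -> (leb2 R).-integrable setT (EFin \o P w).
  move=> fw; apply: (@gsq_integrable _ (fun z => w (z.1 +i* z.2))); last exact: (fock_fsq fw).
  exact: (cmeasurable_hol_pt (fock_hol fw)).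
have EP w : fock w -> (\int[leb2 R]_z (P w z)%:E)%E = (pi * fock_norm w ^+ 2)%:E.
  by move=> fw; rewrite -(fock_norm_fsq (fock_fsq fw)).
have sq (w : nat -> R) (l : R) : w @ \oo --> l -> (fun k => w k ^+ 2) @ \oo --> l ^+ 2.
  by move=> h; under eq_fun do rewrite expr2; rewrite expr2; exact: cvgM.
pose d k := fun z => u k z - v z.
pose g k (z : measurableTypeR R * measurableTypeR R) : \bar R :=
  (2 * P (u k) z + 2 * P v z - P (d k) z)%:E.
have Eg k : (\int[leb2 R]_z g k z)%E =
    (pi * (2 * fock_norm (u k) ^+ 2 + 2 * fock_norm v ^+ 2 - fock_norm (d k) ^+ 2))%:E.
  have I1 := integrableZl measurableT 2 (IP _ (fu k)).
  have I2 := integrableZl measurableT 2 (IP _ fv).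
  have -> : (\int[leb2 R]_z g k z)%E = (\int[leb2 R]_z
      ((2%:E * (P (u k) z)%:E + 2%:E * (P v z)%:E) - (P (d k) z)%:E))%E.
    by apply: eq_integral => z _; rewrite /g !EFinD !EFinM EFinN.
  rewrite integralB//; [|exact: integrableD|exact: (IP _ (fd k))].
  rewrite integralD// !integralZl//; [|exact: IP|exact: (IP _ (fu k))].
  rewrite [X in (_ * X + _ - _)%E](EP _ (fu k)) [X in (_ + _ * X - _)%E](EP _ fv).
  rewrite [X in (_ - X)%E](EP _ (fd k)).
  transitivity ((2 * (pi * fock_norm (u k) ^+ 2) + 2 * (pi * fock_norm v ^+ 2) -
    pi * fock_norm (d k) ^+ 2)%:E); first by [].
  by congr EFin; ring.
have g0 k z : (0 <= g k z)%E.
  rewrite /g lee_fin subr_ge0 /P !mulrA -mulrDl ler_wpM2r ?gauss_weight_ge0//.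
  have := cmodD_sqr (u k (z.1 +i* z.2)) (- v (z.1 +i* z.2)).
  by rewrite cmodN -!mulrA.
have mg k : measurable_fun setT (g k).
  apply/measurable_EFinP; apply: measurable_funB; last exact: (md k).
  apply: measurable_funD; apply: measurable_funM; try exact: measurable_cst.
    exact: (mu k).
  exact: mv.
have lg z : limn_einf (fun k => g k z) = (4 * P v z)%:E.
  have cg : (fun k => g k z) @ \oo --> (4 * P v z)%:E.
    apply: cvg_EFin; first by near=> k.
    rewrite /comp /g /=; set p := z.1 +i* z.2.
    have -> : 4 * P v z = 2 * P v z + 2 * P v z - 0 * gauss_weight z by ring.
    have := uv p => /cvg_ReIm[c1 c2].
    apply: cvgB.
      apply: cvgD; last exact: cvg_cst.
      apply: cvgMr; apply: cvgMl; rewrite cmod_sqr.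
      under eq_fun do rewrite cmod_sqr.
      by apply: cvgD; apply: sq.
    apply: cvgMl.
    have : (fun k => cmod (u k p - v p)) @ \oo --> 0 by exact/cvg_cmod.
    by move=> /sq; rewrite expr0n.
  by rewrite is_cvg_limn_einfE; [exact/cvg_lim|apply/cvg_ex; eexists; exact: cg].
have FT := @fatou _ _ R (leb2 R) setT measurableT g mg (fun k z _ => g0 k z).
have {FT} FT : ((pi * (4 * fock_norm v ^+ 2))%:E <= limn_einf (fun k =>
   (pi * (2 * fock_norm (u k) ^+ 2 + 2 * fock_norm v ^+ 2 - fock_norm (d k) ^+ 2))%:E))%E.
  rewrite (_ : (fun k => _) = (fun n => \int[leb2 R]_z g n z)%E); last first.
    by apply/funext => k; exact/esym/Eg.
  apply: le_trans FT; rewrite le_eqVlt; apply/orP; left; apply/eqP.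
  transitivity (\int[leb2 R]_z (4%:E * (P v z)%:E))%E.
    rewrite integralZl//; last exact: IP.
    by rewrite [X in (_ * X)%E](EP _ fv) -EFinM; congr EFin; ring.
  by apply: eq_integral => z _; rewrite lg EFinM.
have p0 := pi_gt0 R.
apply/cvgrPdist_lt => e e0.
(* Fatou costs e^2 / 2, and twice the error e^2 / 4 on the squared norms costs as much again. *)
have e2 : 0 < e ^+ 2 / 2 by rewrite divr_gt0// exprn_gt0.
have N2 : (fun k => fock_norm (u k) ^+ 2) @ \oo --> fock_norm v ^+ 2.
  exact: sq.
have e4 : 0 < e ^+ 2 / 4 by rewrite divr_gt0// exprn_gt0.
have F1 := (cvgrPdist_lt _ _).1 N2 _ e4.
have yx : ((pi * (4 * fock_norm v ^+ 2 - e ^+ 2 / 2))%:E < (pi * (4 * fock_norm v ^+ 2))%:E)%E.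
  by rewrite lte_fin ltr_pM2l// ltrBlDr ltrDl.
have F2 := limn_einf_near_gt yx FT.
near=> k.
have h1 : `|fock_norm v ^+ 2 - fock_norm (u k) ^+ 2| < e ^+ 2 / 4.
  by near: k; exact: F1.
have h2 : ((pi * (4 * fock_norm v ^+ 2 - e ^+ 2 / 2))%:E < (pi * (2 * fock_norm (u k) ^+ 2
  + 2 * fock_norm v ^+ 2 - fock_norm (d k) ^+ 2))%:E)%E.
  by near: k; exact: F2.
rewrite sub0r normrN ger0_norm ?fock_norm_ge0//.
rewrite -(@ltr_pXn2r _ 2)// ?nnegrE ?fock_norm_ge0 ?(ltW e0)//.
move: h2; rewrite lte_fin ltr_pM2l// -/(d k).
by move: h1; rewrite ltr_norml => /andP[]; lra.
Unshelve. all: by end_near.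
Qed.

End limit_lemmas.

                                        

(** * The representations beta_h as Weyl translations *)

Section schrodinger_fock.
Context {R : realType}.
Local Notation C := R[i].
Implicit Types F G : C -> C.
Local Notation R2 := (measurableTypeR R * measurableTypeR R)%type.
Local Notation pt z := (z.1 +i* z.2).

(** The displacement implementing beta_h(q): sqrt|h| times z for h > 0, and times the conjugate of z
    otherwise. *)
Definition beta_shift (h : R) (q : heis R) : C :=
  (Num.sqrt `|h|)%:C * (q.1.1 +i* (if 0 < h then q.1.2 else - q.1.2)).

Lemma eq_wshift (tau tau' : R) (c c' : C) F : tau = tau' -> c = c' ->
  wshift tau c F = wshift tau' c' F.
Proof. by move=> -> ->. Qed.

Lemma beta_posE (h : R) (z : C) (t : R) F : 0 <= h ->
  beta_pos h z t F = wshift (2 * h * t) ((Num.sqrt h)%:C * z) F.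
Proof.
move=> h0; apply/funext => zeta; rewrite /beta_pos /wshift; congr (cexp _ * _).
have two : (2 : C) = (2 : R)%:C by rewrite rmorphMn.
have := sqr_sqrtr h0; move: (Num.sqrt h) => s <-; rewrite two.
case: z zeta => x y [u v]; rewrite !cmod_sqr.
by apply: complex_ext; rewrite !ReImE /=; field.
Qed.

Lemma betaE (h : R) (q : heis R) F :
  beta h q F = wshift (2 * h * q.2) (beta_shift h q) F.
Proof.
rewrite /beta /beta_shift; case: ltP => h0.
  by rewrite (gtr0_norm h0) beta_posE// ltW.
rewrite (beta_posE _ _ _ (normr_ge0 h)) (ler0_norm h0).
by rewrite (_ : 2 * - h * - q.2 = 2 * h * q.2); last by ring.
Qed.

Definition hinv (q : heis R) : heis R := ((- q.1.1, - q.1.2), - q.2).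

Lemma hmulA (p q r : heis R) : hmul p (hmul q r) = hmul (hmul p q) r.
Proof.
case: p q r => [[a b] c] [[a' b'] c'] [[a'' b''] c'']; rewrite /hmul /=.
by congr (_, _, _); ring.
Qed.

Lemma hinvM (p q : heis R) : hinv (hmul p q) = hmul (hinv q) (hinv p).
Proof.
by case: p q => [[a b] c] [[a' b'] c']; rewrite /hinv /hmul /=; congr (_, _, _); ring.
Qed.

(** The phase in [wshift_comp] is 2h times the cocycle of [hmul]; for h <= 0 the conjugation in
    [beta_shift] flips its sign accordingly. *)
Lemma beta_comp (h : R) (p q : heis R) F :
  beta h p (beta h q F) = beta h (hmul p q) F.
Proof.
rewrite !betaE wshift_comp; case: p q => [[a b] c] [[a' b'] c'].
rewrite /beta_shift /hmul /=.
have := sqr_sqrtr (normr_ge0 h); move: (Num.sqrt `|h|) => s.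
case: ltP => h0.
  rewrite (gtr0_norm h0) => <-; apply: eq_wshift.
    by rewrite ?ReImE /=; field.
  by apply: complex_ext; rewrite ?ReImE /=; ring.
rewrite (ler0_norm h0) => /(congr1 -%R); rewrite opprK => <-; apply: eq_wshift.
  by rewrite ?ReImE /=; field.
by apply: complex_ext; rewrite ?ReImE /=; ring.
Qed.

Lemma fock_beta (h : R) (q : heis R) F : fock F -> fock (beta h q F).
Proof. by rewrite betaE; exact: fock_wshift. Qed.

Lemma fock_norm_beta (h : R) (q : heis R) F : fock F ->
  fock_norm (beta h q F) = fock_norm F.
Proof. by move=> fF; rewrite betaE; exact: (fock_norm_wshift _ _ (fock_hol fF)). Qed.

Lemma fock_norm_sqrE F : fock F ->
  fock_norm F ^+ 2 = complex.Re (fock_inner F F).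
Proof.
move=> fF; rewrite /fock_norm sqr_sqrtr//.
rewrite /fock_inner ReM /= mul0r subr0 mulr_ge0 ?invr_ge0 ?pi_ge0//.
apply: Rintegral_ge0 => z _; rewrite mulJc ReM /= mul0r subr0.
exact: fsq_term_ge0.
Qed.

(** The inverse group element provides an adjoint value, and two adjoint values differ by a Fock
    function orthogonal to itself, hence zero; so the chosen value is this one. *)
Lemma adjoint_beta (h : R) (q : heis R) F : fock F ->
  adjoint (beta h q) F = beta h (hinv q) F.
Proof.
move=> fF; set B := beta h (hinv q) F.
have fB : fock B by exact: fock_beta.
have adjB G : fock G -> fock_inner (beta h q G) F = fock_inner G B.
  move=> fG; rewrite /B !betaE (fock_inner_wshift _ _ fG fF); congr (fock_inner G _); apply: eq_wshift.
    by rewrite /hinv /=; ring.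
  rewrite /beta_shift /hinv /=; case: ifP => _;
  by apply: complex_ext; rewrite !ReImE /=; ring.
have [|fA hA] := @xgetPex _ (fun=> 0 : C) [set G' | is_adjoint_value (beta h q) F G'].
  by exists B.
rewrite -/(adjoint (beta h q) F) in fA hA.
set A := adjoint _ _ in fA hA *.
have fAB := fockB fA fB.
(* Both [A] and [B] pair with [A - B] through the same [beta h q (A - B)]. *)
have : fock_inner (fun z => A z - B z) (fun z => A z - B z) = 0.
  by rewrite fock_innerBr// -hA// -adjB// subrr.
move=> E; have /eqP := fock_norm_sqrE fAB; rewrite E expf_eq0 => /eqP/= /(fock_norm_eq0 fAB) AB.
apply/funext => z; apply/eqP; rewrite -subr_eq0; apply/eqP.
by have := congr1 (fun f => f z) AB.
Qed.

Lemma cvg_wshift {T : Type} {FF : set_system T} {FFF : Filter FF} (tau : T -> R) (c : T -> C)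
    (tau0 : R) (c0 : C) F (zeta : C) : holomorphic F ->
  tau @ FF --> tau0 -> (c : T -> C^o) @ FF --> (c0 : C^o) ->
  (fun x => wshift (tau x) (c x) F zeta : C^o) @ FF --> (wshift tau0 c0 F zeta : C^o).
Proof.
move=> hF ctau cc; have /cvg_ReIm[c1 c2] := cc.
rewrite /wshift; apply: (@cvgM _ _ _ _ (fun x => cexp _ : C^o) (fun x => F _ : C^o)).
  pose arg x : C := 0 +i* tau x - zeta * conjc (c x) - (cmod (c x) ^+ 2 / 2)%:C.
  apply: (@cvg_comp _ _ _ (arg : T -> C^o) (@cexp R : C^o -> C^o)); last first.
    exact: (@holomorphic_cont _ _ holomorphic_cexp).
  apply/cvg_ReIm; rewrite /arg; split.
    under eq_fun do rewrite !ReImE /= cmod_sqr.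
    rewrite !ReImE /= cmod_sqr.
    apply: cvgB; last first.
      by apply: cvgMl; apply: cvgD; under eq_fun do rewrite expr2; rewrite expr2; apply: cvgM.
    apply: cvgB; first exact: cvg_cst.
    apply: cvgB; first by apply: cvgMr.
    by apply: cvgMr; apply: cvgN.
  under eq_fun do rewrite !ReImE /=.
  rewrite !ReImE /=.
  apply: cvgB; last exact: cvg_cst.
  apply: cvgB; first exact: ctau.
  apply: cvgD; last by apply: cvgMr.
  by apply: cvgMr; apply: cvgN.
apply: (@cvg_comp _ _ _ ((fun x => zeta + c x) : T -> C^o) (F : C^o -> C^o)); last first.
  exact: (@holomorphic_cont _ _ hF).
by apply: (@cvgD _ C^o); [exact: cvg_cst|exact: cc].
Qed.

Lemma cvg_beta {T : Type} {FF : set_system T} {FFF : Filter FF} (q : T -> R * R * R)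
    (q0 : R * R * R) (h : R) F (zeta : C) : fock F -> q @ FF --> q0 ->
  (fun x => beta h (q x) F zeta : C^o) @ FF --> (beta h q0 F zeta : C^o).
Proof.
move=> fF cq; rewrite betaE; under eq_fun do rewrite betaE.
have c1 : (fun x => (q x).1.1) @ FF --> q0.1.1.
  by apply: (cvg_comp _ _ (cvg_comp _ _ cq cvg_fst)); exact: cvg_fst.
have c2 : (fun x => (q x).1.2) @ FF --> q0.1.2.
  by apply: (cvg_comp _ _ (cvg_comp _ _ cq cvg_fst)); exact: cvg_snd.
have c3 : (fun x => (q x).2) @ FF --> q0.2 by apply: (cvg_comp _ _ cq); exact: cvg_snd.
apply: (@cvg_wshift _ _ _ (fun x => 2 * h * (q x).2) (fun x => beta_shift h (q x))
  _ _ F zeta (fock_hol fF)); first by apply: cvgMr.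
apply/cvg_ReIm; rewrite /beta_shift; split.
  under eq_fun do rewrite !ReImE /=.
  rewrite !ReImE /=; apply: cvgB; first by apply: cvgMr.
  by under eq_fun do rewrite mul0r; rewrite mul0r; exact: cvg_cst.
under eq_fun do rewrite !ReImE /=.
rewrite !ReImE /=; apply: cvgD; last first.
  by under eq_fun do rewrite mul0r; rewrite mul0r; exact: cvg_cst.
by apply: cvgMr; case: ifP => _ //; exact: cvgN.
Qed.

Lemma cmeasurable_beta d (T : measurableType d)
    (q : T -> measurableTypeR R * measurableTypeR R * measurableTypeR R) (zeta : T -> C) (h : R) F :
  fock F -> measurable_fun setT q -> cmeasurable setT zeta ->
  cmeasurable setT (fun x => beta h (q x) F (zeta x)).
Proof.
move=> fF mq mz.
have m1 : measurable_fun setT (fun x => (q x).1.1).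
  exact: (measurableT_comp measurable_fst (measurableT_comp measurable_fst mq)).
have m2 : measurable_fun setT (fun x => (q x).1.2).
  exact: (measurableT_comp measurable_snd (measurableT_comp measurable_fst mq)).
have m3 : measurable_fun setT (fun x => (q x).2).
  exact: (measurableT_comp measurable_snd mq).
apply: (@eq_cmeasurable _ _ _ _
  (fun x => wshift (2 * h * (q x).2) (beta_shift h (q x)) F (zeta x))).
  by move=> x _; rewrite betaE.
have mc : cmeasurable setT (fun x => beta_shift h (q x)).
  apply: cmeasurableM; first exact: cmeasurable_cst.
  by split => //=; case: (0 < h) => //; exact: measurable_funN.
rewrite /wshift; apply: cmeasurableM; last first.
  by apply: (cmeasurable_hol _ (fock_hol fF)); exact: cmeasurableD.
apply: cmeasurable_cexp; apply: cmeasurableB.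
  apply: cmeasurableB; last by apply: cmeasurableM => //; exact: cmeasurableJ.
  by split => /=; [exact: measurable_cst|apply: measurable_funM => //; exact: measurable_cst].
apply: cmeasurableR; apply: measurable_funM; last exact: measurable_cst.
by apply: measurable_funX; exact: measurable_cmod.
Qed.

End schrodinger_fock.

(** * Integrals of functions with values in Fock space *)

Lemma ge0_le_lower_integral d (T : measurableType d) (R : realType)
    (mu : {measure set T -> \bar R}) (D : set T) (f g : T -> \bar R) :
  (forall x, D x -> (0 <= f x)%E) -> (forall x, D x -> (f x <= g x)%E) ->
  (\int[mu]_(x in D) f x <= \int[mu]_(x in D) g x)%E.
Proof.
move=> f0 fg.
have g0 x : D x -> (0 <= g x)%E by move=> Dx; rewrite (le_trans (f0 _ Dx))// fg.
rewrite !ge0_integralE//; apply: ereal_sup_le => _ [h /= hf <-].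
exists h => //= x; rewrite (le_trans (hf x))// !patchE.
by case: ifPn => // xD; apply: fg; exact: set_mem.
Qed.

                                            

Section fock_integral.
Context d (T : measurableType d) (R : realType).
Local Notation C := R[i].
Local Notation R2 := (measurableTypeR R * measurableTypeR R)%type.
Local Notation pt z := (z.1 +i* z.2).

(** What Tonelli needs both for x -> [fock_norm (r x)] and for the integral of r as a function of
    the Fock variable. *)
Definition jointly_measurable (r : T -> C -> C) : Prop :=
  cmeasurable setT (fun p : T * R2 => r p.1 (pt p.2)).

Lemma jointly_measurable_fix (r : T -> C -> C) (zeta : C) (D : set T) :
  jointly_measurable r -> cmeasurable D (fun x => r x zeta).
Proof.
move=> mr; rewrite (_ : (fun x => r x zeta) =
  (fun x => r x (pt ((Re zeta, Im zeta) : R2)))).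
  apply: (cmeasurable_comp mr (phi := fun x => (x, (Re zeta, Im zeta) : R2))).
  apply: measurable_funTS; apply/measurable_fun_pairP; split => /=; first exact: measurable_id.
  exact: measurable_cst.
by apply/funext => x /=; case: zeta.
Qed.

Lemma measurable_fock_norm (r : T -> C -> C) (D : set T) : jointly_measurable r ->
  measurable_fun D (fun x => fock_norm (r x)).
Proof.
move=> mr; apply: measurable_funTS; under eq_fun do rewrite fock_normE.
apply: (@measurableT_comp _ _ _ _ _ _ (@Num.sqrt R)).
  by apply: continuous_measurable_fun; exact: sqrt_continuous.
apply: measurable_funM; first exact: measurable_cst.
apply: measurableT_comp => //.
apply: (@measurable_fun_fubini_tonelli_F _ _ _ _ _ (sleb2 R)
  (fun p : T * R2 => (cmod (r p.1 (pt p.2)) ^+ 2 * gauss_weight p.2)%:E)).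
- apply/measurable_EFinP; apply: measurable_funM.
    by apply: measurable_funX; exact: measurable_cmod.
  by apply: measurable_gauss_weight; exact: measurable_snd.
- by move=> p; rewrite lee_fin fsq_term_ge0.
Qed.

Variable mu : {sigma_finite_measure set T -> \bar R}.
Variable r : T -> C -> C.
Hypothesis mr : jointly_measurable r.
Hypothesis fr : forall x, fock (r x).
Variable B : R.
Hypothesis rB : (\int[mu]_x (fock_norm (r x))%:E = B%:E)%E.

Let N x := fock_norm (r x).
Let mN : measurable_fun setT N. Proof. exact: measurable_fock_norm. Qed.
Let N0 x : 0 <= N x. Proof. exact: fock_norm_ge0. Qed.
Let NE0 x : (0 <= (N x)%:E)%E. Proof. by rewrite lee_fin. Qed.
Let mr1 (z : C) : cmeasurable setT (fun x => r x z).
Proof. exact: jointly_measurable_fix. Qed.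
Let IN : mu.-integrable setT (EFin \o N).
Proof.
apply/integrableP; split; first exact/measurable_EFinP.
under eq_integral do rewrite /= ger0_norm//.
by rewrite rB ltry.
Qed.

Lemma fock_section_integrable (z : C) : cintegrable mu setT (fun x => r x z).
Proof.
pose c := 2 * expR (cmod z ^+ 2 / 2).
apply: (le_cintegrable measurableT (mr1 z) (g := fun x => c * N x)).
  by apply: eq_integrable (integrableZl measurableT c IN) => // x _ /=; rewrite EFinM.
by move=> x _; exact: fock_eval_le.
Qed.

Let mV : cmeasurable setT (fun z : R2 => cintegral mu setT (fun x => r x (pt z))).
Proof.
have [m1 m2] := mr.
have mF (h : T * R2 -> R) : measurable_fun setT h ->
    measurable_fun setT (fun z : R2 => Rintegral mu setT (fun x => h (x, z))).
  move=> mh; apply: measurableT_comp => //.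
  rewrite (_ : (fun x => _) = (fun z => \int[mu]_x (EFin \o h)^\+ (x, z) -
      \int[mu]_x (EFin \o h)^\- (x, z))%E).
    apply: emeasurable_funB.
      apply: (@measurable_fun_fubini_tonelli_G _ _ _ _ _ mu (EFin \o h)^\+%E) => //.
      by apply: measurable_funepos; exact/measurable_EFinP.
    apply: (@measurable_fun_fubini_tonelli_G _ _ _ _ _ mu (EFin \o h)^\-%E) => //.
    by apply: measurable_funeneg; exact/measurable_EFinP.
  apply/funext => z; rewrite integralE.
  by congr (_ - _)%E; apply: eq_integral => x _; rewrite ?funeposE ?funenegE.
by split; [exact: (mF _ m1)|exact: (mF _ m2)].
Qed.

                                                                           
(** A Minkowski inequality. Cauchy-Schwarz with density N bounds |int r|^2 by 4 B times the integral
    of |r|^2 / N; integrating against the Gaussian and exchanging the order, that integral becomes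
    pi times the integral of N, which is pi B. *)
Lemma fsq_fock_integral :
  (fsq (fun z => cintegral mu setT (fun x => r x z)) <= (4 * pi * B ^+ 2)%:E)%E.
Proof.
have mi : measurable_fun setT (fun x => (N x)^-1).
  rewrite (_ : (fun x => _) = (fun x => N x `^ (-1))).
    by apply: (@measurableT_comp _ _ _ _ _ _ (fun x : R => x `^ (-1))) => //;
      exact: measurable_powR.
  by apply/funext => x; rewrite powR_inv1.
have ms : measurable_fun setT (fun x : R => Num.sqrt x).
  by apply: continuous_measurable_fun; exact: sqrt_continuous.
have B0 : 0 <= B by rewrite -lee_fin -rB integral_ge0// => x _; rewrite lee_fin fock_norm_ge0.
pose a (z : C) x := cmod (r x z) * Num.sqrt ((N x)^-1).
pose b x := Num.sqrt (N x).
have ma z : measurable_fun setT (a z).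
  by apply: measurable_funM; [exact: measurable_cmod|exact: measurableT_comp ms mi].
have mb : measurable_fun setT b by exact: measurableT_comp ms mN.
have ab z x : a z x * b x = cmod (r x z).
  (* Where N vanishes so does [r x], so the convention that the inverse of 0 is 0 does no harm. *)
  rewrite /a /b -mulrA -sqrtrM ?invr_ge0//.
  have [Nx|Nx] := eqVneq (N x) 0; last by rewrite mulVf// sqrtr1 mulr1.
  by rewrite (fock_norm_eq0 (fr x) Nx) cmod0 mul0r.
have a2 z x : a z x ^+ 2 = cmod (r x z) ^+ 2 * (N x)^-1.
  by rewrite /a exprMn (@sqr_sqrtr _ (N x)^-1)// invr_ge0.
have b2 x : b x ^+ 2 = N x by rewrite sqr_sqrtr.
pose A (z : C) : \bar R := (\int[mu]_x (cmod (r x z) ^+ 2 * (N x)^-1)%:E)%E.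
have A0 z : (0 <= A z)%E.
  by apply: integral_ge0 => x _; rewrite lee_fin mulr_ge0 ?sqr_ge0// invr_ge0.
have Afin z : A z \is a fin_num.
  rewrite ge0_fin_numE//; pose c := 2 * expR (cmod z ^+ 2 / 2).
  have c0 : 0 <= c by rewrite mulr_ge0// expR_ge0.
  apply: (@le_lt_trans _ _ (\int[mu]_x ((c ^+ 2)%:E * (N x)%:E))%E).
    apply: ge0_le_integral => //.
    - by move=> x _; rewrite lee_fin mulr_ge0 ?sqr_ge0// invr_ge0.
    - apply/measurable_EFinP; apply: measurable_funM => //.
      by apply: measurable_funX; exact: measurable_cmod.
    - by apply: measurable_funeM; exact/measurable_EFinP.
    move=> x _; rewrite -EFinM lee_fin.
    have [Nx|Nx] := eqVneq (N x) 0; first by rewrite Nx invr0 !mulr0.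
    have Np : 0 < N x by rewrite lt_neqAle eq_sym Nx N0.
    rewrite ler_pdivrMr// -mulrA -expr2 -exprMn ler_pXn2r// ?nnegrE ?cmod_ge0 ?mulr_ge0//.
    exact: fock_eval_le.
  rewrite ge0_integralZl_EFin ?sqr_ge0//; last exact/measurable_EFinP.
  by rewrite rB -EFinM ltry.
have CS z : ((cmod (cintegral mu setT (fun x => r x z)) ^+ 2)%:E <= (4 * B)%:E * A z)%E.
  have [||||||I [EI I0 I2]] := @cauchy_schwarz _ _ R mu (a z) b (fine (A z)) B.
  - exact: ma.
  - exact: mb.
  - by move=> x; rewrite mulr_ge0 ?cmod_ge0// sqrtr_ge0.
  - by move=> x; exact: sqrtr_ge0.
  - rewrite fineK// le_eqVlt; apply/orP; left; apply/eqP.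
    by apply: eq_integral => x _; rewrite a2.
  - rewrite -rB le_eqVlt; apply/orP; left; apply/eqP.
    by apply: eq_integral => x _; rewrite b2.
  have := cmod_cintegral_le mu measurableT (mr1 z).
  have -> : (\int[mu]_x (cmod (r x z))%:E)%E = I%:E.
    by rewrite -EI; apply: eq_integral => x _; rewrite ab.
  rewrite -EFinM lee_fin => h.
  rewrite -(fineK (Afin z)) -EFinM lee_fin.
  rewrite (@le_trans _ _ ((2 * I) ^+ 2))//.
    by rewrite ler_pXn2r// ?nnegrE ?cmod_ge0// mulr_ge0.
  rewrite exprMn (_ : 4 * B * _ = 2 ^+ 2 * (fine (A z) * B)); last by ring.
  by rewrite ler_pM2l// exprn_gt0.
have mA2 : measurable_fun setT (fun p : T * R2 =>
    (cmod (r p.1 (pt p.2)) ^+ 2 * (N p.1)^-1 * gauss_weight p.2)%:E).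
  apply/measurable_EFinP; apply: measurable_funM.
    apply: measurable_funM; first by apply: measurable_funX; exact: measurable_cmod.
    exact: measurableT_comp mi measurable_fst.
  by apply: measurable_gauss_weight; exact: measurable_snd.
have p20 (p : T * R2) :
    (0 <= (cmod (r p.1 (pt p.2)) ^+ 2 * (N p.1)^-1 * gauss_weight p.2)%:E)%E.
  by rewrite lee_fin !mulr_ge0 ?sqr_ge0 ?cmod_ge0 ?invr_ge0 ?N0 ?gauss_weight_ge0.
have mAz z : measurable_fun setT (fun x => (cmod (r x z) ^+ 2 * (N x)^-1)%:E).
  apply/measurable_EFinP; apply: measurable_funM => //.
  by apply: measurable_funX; exact: measurable_cmod.
have Az z x : (0 <= (cmod (r x z) ^+ 2 * (N x)^-1)%:E)%E.
  by rewrite lee_fin mulr_ge0 ?sqr_ge0// invr_ge0.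
have EG (z : R2) : (A (pt z) * (gauss_weight z)%:E)%E = fubini_G mu (fun p : T * R2 =>
    (cmod (r p.1 (pt p.2)) ^+ 2 * (N p.1)^-1 * gauss_weight p.2)%:E) z.
  rewrite /fubini_G /A -ge0_integralZr//; first by rewrite lee_fin gauss_weight_ge0.
apply: (@le_trans _ _ (\int[sleb2 R]_z ((4 * B)%:E * (A (pt z) * (gauss_weight z)%:E)))%E).
  apply: ge0_le_integral => //.
  - by move=> z _; rewrite lee_fin fsq_term_ge0.
  - by apply/measurable_EFinP; exact: (measurable_fsq mV).
  - apply: measurable_funeM; under eq_fun do rewrite EG.
    exact: measurable_fun_fubini_tonelli_G.
  move=> z _; rewrite EFinM muleA; apply: lee_wpmul2r; last exact: CS.
  by rewrite lee_fin gauss_weight_ge0.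
under eq_integral do rewrite EG.
rewrite ge0_integralZl_EFin ?mulr_ge0//; last 2 first.
- by move=> z _; apply: integral_ge0 => x _; exact: p20.
- exact: measurable_fun_fubini_tonelli_G.
rewrite -fubini_tonelli2// fubini_tonelli1//.
rewrite (eq_integral (fun x => (pi%:E * (N x)%:E)%E)); last first.
  move=> x _; rewrite /fubini_F /=.
  transitivity (\int[leb2 R]_z ((N x)^-1%:E * (cmod (r x (pt z)) ^+ 2 * gauss_weight z)%:E))%E.
    by apply: eq_integral => z _; rewrite -EFinM; congr EFin; ring.
  rewrite ge0_integralZl_EFin ?invr_ge0//; last 2 first.
  - by move=> z _; rewrite lee_fin fsq_term_ge0.
  - by apply/measurable_EFinP; exact: (measurable_fsq (cmeasurable_hol_pt (fock_hol (fr x)))).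
  rewrite -/(fsq (r x)) (fock_norm_fsq (fock_fsq (fr x))) -!EFinM; congr EFin.
  rewrite -/(N x) mulrCA; congr (_ * _).
  have [->|Nx] := eqVneq (N x) 0; first by rewrite expr0n mulr0.
  by rewrite expr2 mulKf.
rewrite ge0_integralZl_EFin ?pi_ge0//; last exact/measurable_EFinP.
by rewrite rB -!EFinM lee_fin le_eqVlt; apply/orP; left; apply/eqP; ring.
Qed.

(** Each [r x] satisfies the reproducing formula, and Fubini passes it to the integral, so
    [fock_of_reproducing] applies. *)
Lemma fock_fock_integral : fock (fun z => cintegral mu setT (fun x => r x z)).
Proof.
apply: fock_of_reproducing; first exact: mV.
  by rewrite (le_lt_trans fsq_fock_integral)// ltry.
(* A Fock function with the same modulus as the antiholomorphic kernel exp(conj z c); it supplies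
   the second factor of Cauchy-Schwarz. *)
move=> c; pose K : C -> C :=
  fun z => cexp (cmod c ^+ 2 / 2)%:C * wshift 0 (- c) (fun=> 1) z.
have fK : fock K by apply: fockZ; apply: fock_wshift; exact: fock1.
have cK z : cmod (K z) = cmod (cexp (conjc z * c)).
  rewrite /K /wshift mulr1 -cexpD !cmod_cexp; congr expR.
  by rewrite !ReImE /= cmodN; ring.
pose k := pi * fock_norm K ^+ 2.
have Ek : fsq K = k%:E := fock_norm_fsq (fock_fsq fK).
have k0 : 0 <= k by rewrite mulr_ge0 ?pi_ge0 ?sqr_ge0.
pose s (z : R2) := Num.sqrt (gauss_weight z).
have s2 z : s z ^+ 2 = gauss_weight z by rewrite sqr_sqrtr// gauss_weight_ge0.
have ms : measurable_fun setT s.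
  apply: (@measurableT_comp _ _ _ _ _ _ (@Num.sqrt R)); last exact: measurable_gauss.
  by apply: continuous_measurable_fun; exact: sqrt_continuous.
pose q (p : T * R2) : C := r p.1 (pt p.2) * cexp (conjc (pt p.2) * c) * (gauss_weight p.2)%:C.
have mq : cmeasurable setT q.
  apply: cmeasurableM; last exact: (cmeasurable_comp cmeasurable_gauss measurable_snd).
  apply: cmeasurableM => //; apply: cmeasurable_cexp; apply: cmeasurableM; last exact: cmeasurable_cst.
  by apply: cmeasurableJ; exact: (cmeasurable_comp cmeasurable_pt measurable_snd).
have Iq : cintegrable (mu \x sleb2 R)%E setT q.
  apply/cintegrableP => //; split => //.
  rewrite fubini_tonelli1//; last 2 first.
  - by apply/measurable_EFinP; exact: measurable_cmod.
  - by move=> p; rewrite lee_fin cmod_ge0.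
  apply: (@le_lt_trans _ _ (\int[mu]_x ((Num.sqrt (pi * k))%:E * (N x)%:E))%E); last first.
    rewrite ge0_integralZl_EFin ?sqrtr_ge0//; last exact/measurable_EFinP.
    by rewrite rB -EFinM ltry.
  apply: ge0_le_lower_integral => x _.
    by apply: integral_ge0 => z _; rewrite lee_fin cmod_ge0.
  have hx := cmeasurable_hol_pt (fock_hol (fr x)).
  have hK := cmeasurable_hol_pt (fock_hol fK).
  have [||||||J [EJ J0 J2]] := @cauchy_schwarz _ _ R (leb2 R)
    (fun z => cmod (r x (pt z)) * s z) (fun z => cmod (K (pt z)) * s z) (pi * N x ^+ 2) k.
  - by apply: measurable_funM => //; exact: measurable_cmod.
  - by apply: measurable_funM => //; exact: measurable_cmod.
  - by move=> z; rewrite mulr_ge0 ?cmod_ge0// sqrtr_ge0.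
  - by move=> z; rewrite mulr_ge0 ?cmod_ge0// sqrtr_ge0.
  - rewrite -(fock_norm_fsq (fock_fsq (fr x))) le_eqVlt; apply/orP; left; apply/eqP.
    by apply: eq_integral => z _; rewrite exprMn s2.
  - rewrite -Ek le_eqVlt; apply/orP; left; apply/eqP.
    by apply: eq_integral => z _; rewrite exprMn s2.
  have -> : fubini_F (sleb2 R) (fun z => (cmod (q z))%:E) x = J%:E.
    rewrite -EJ /fubini_F.
    have Eq (z : R2) : cmod (q (x, z)) = cmod (r x (pt z)) * s z * (cmod (K (pt z)) * s z).
      rewrite /q [LHS]cmod_gauss cmodM -cK -s2; ring.
    by apply: eq_integral => z _; rewrite Eq.
  rewrite -EFinM lee_fin -(@ler_pXn2r _ 2)// ?nnegrE ?mulr_ge0 ?sqrtr_ge0//.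
  rewrite (le_trans J2)// exprMn (@sqr_sqrtr _ (pi * k)) ?(mulr_ge0 (pi_ge0 _) k0)//.
  by rewrite le_eqVlt; apply/orP; left; apply/eqP; ring.
have [_ E1] := cintegral_fubini Iq.
have [_ E2] := cintegral_fubini_swap Iq.
transitivity (cintegral (sleb2 R) setT (fun y => cintegral mu setT (fun x => q (x, y)))); last first.
  apply: eq_cintegral => z _; rewrite -[RHS]mulrA [RHS]mulrC -[RHS]cintegralZl//.
    by apply: eq_cintegral => x _; rewrite /q /=; ring.
  exact: fock_section_integrable.
rewrite E2 -E1 -cintegralZl//; last exact: fock_section_integrable.
by apply: eq_cintegral => x _; rewrite (fock_reproducing c (fr x)).
Qed.

Lemma fock_norm_fock_integral_le :
  fock_norm (fun z => cintegral mu setT (fun x => r x z)) <= 2 * B.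
Proof.
have B0 : 0 <= B by rewrite -lee_fin -rB integral_ge0// => x _; rewrite lee_fin fock_norm_ge0.
rewrite -(@ler_pXn2r _ 2)// ?nnegrE ?fock_norm_ge0 ?mulr_ge0//.
have := fsq_fock_integral; rewrite (fock_norm_fsq (fock_fsq fock_fock_integral)) lee_fin.
rewrite (_ : 4 * pi * B ^+ 2 = pi * (2 * B) ^+ 2); last by ring.
by rewrite ler_pM2l// pi_gt0.
Qed.

End fock_integral.

(** * Bochner integrals: pointwise evaluation and existence *)

Section bochner_eval.
Context d (T : measurableType d) (R : realType).
Variables (mu : {measure set T -> \bar R}) (D : set T).
Hypothesis mD : measurable D.
Local Notation C := R[i].
Local Notation step := (step mu D).

Lemma fock_step_fun (s : step) x : fock (step_fun s x).
Proof. by apply: fock_sum => i; apply: fockZ; exact: step_fock. Qed.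

Lemma fock_step_integral (s : step) : fock (step_integral s).
Proof. by apply: fock_sum => i; apply: fockZ; exact: step_fock. Qed.

Lemma step_fun_integral (s : step) zeta :
  cintegrable mu D (fun x => step_fun s x zeta) /\
  cintegral mu D (fun x => step_fun s x zeta) = step_integral s zeta.
Proof.
pose f (i : 'I_(step_size s)) (x : T) : C :=
  (\1_(step_set i) x : R)%:C * step_val i zeta.
have I1 (i : 'I_(step_size s)) : cintegrable mu D (fun x => (\1_(step_set i) x : R)%:C).
  split; last exact: integrable0.
  apply/integrableP; split.
    by apply/measurable_EFinP; apply: measurable_indic; exact: step_measurable.
  under eq_integral do rewrite /= ger0_norm ?ler0n//.
  have mi : measurable (step_set i) by exact: step_measurable.
  by rewrite (integral_indic mu mD mi) setIC; exact: (step_finite i).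
have If i : cintegrable mu D (f i).
  have := cintegrableZl (step_val i zeta) mD (I1 i).
  by apply: eq_cintegrable => // x _; rewrite /f mulrC.
have [I2 E2] := cintegral_sum mD If; split; first exact: I2.
rewrite [LHS]E2; apply: eq_bigr => i _.
transitivity (cintegral mu D (fun x => step_val i zeta * (\1_(step_set i) x : R)%:C)).
  by apply: eq_cintegral => x _; rewrite /f mulrC.
rewrite cintegralZl// mulrC; congr (_ * _).
rewrite /cintegral /Rintegral /= integral0; congr (_ +i* _).
have mi : measurable (step_set i) by exact: step_measurable.
by rewrite (integral_indic mu mD mi) setIC.
Qed.

(** Evaluation at zeta is bounded by c times the norm, so it passes through both limits in the
    definition of the Bochner integral; for step functions the formula is finite additivity. *)
Lemma bochner_eval (u : T -> C -> C) (v : C -> C) zeta :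
  is_bochner mu D u v -> cmeasurable D (fun x => u x zeta) ->
  v zeta = cintegral mu D (fun x => u x zeta).
Proof.
move=> [fu fv [s [_ s1 s2]]] mu_.
pose c := 2 * expR (cmod zeta ^+ 2 / 2).
have c0 : 0 < c by rewrite mulr_gt0// expR_gt0.
pose dl k := (\int[mu]_(x in D) (fock_norm (fun z => u x z - step_fun (s k) x z))%:E)%E.
have S k : cintegrable mu D (fun x => step_fun (s k) x zeta) := (step_fun_integral (s k) zeta).1.
have mS k := ((cintegrableP _ _ mD).1 (S k)).1.
have md k : cmeasurable D (fun x => u x zeta - step_fun (s k) x zeta) by exact: cmeasurableB.
have L k : (\int[mu]_(x in D) (cmod (u x zeta - step_fun (s k) x zeta))%:E <= c%:E * dl k)%E.
  (* The constant c is extracted on the side known to be measurable; the norm of the difference is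
     only compared through lower integrals. *)
  have -> : (\int[mu]_(x in D) (cmod (u x zeta - step_fun (s k) x zeta))%:E =
    c%:E * \int[mu]_(x in D) (c^-1%:E * (cmod (u x zeta - step_fun (s k) x zeta))%:E))%E.
    rewrite ge0_integralZl_EFin ?invr_ge0 ?(ltW c0)//.
    - by rewrite muleA -EFinM divff ?gt_eqF// mul1e.
    - by move=> x _; rewrite lee_fin cmod_ge0.
    - by apply/measurable_EFinP; exact: measurable_cmod.
  apply: lee_wpmul2l; first by rewrite lee_fin ltW.
  apply: ge0_le_lower_integral => x Dx.
    by rewrite -EFinM lee_fin mulr_ge0 ?cmod_ge0// invr_ge0 ltW.
  have := fock_eval_le zeta (fockB (fu x Dx) (fock_step_fun (s k) x)).
  by rewrite -EFinM lee_fin ler_pdivrMl.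
have d0 k : (0 <= dl k)%E by apply: integral_ge0 => x _; rewrite lee_fin fock_norm_ge0.
have Iu : cintegrable mu D (fun x => u x zeta).
  have : \forall k \near \oo, (dl k < 1)%E.
    have := s1; rewrite -/dl => /fine_cvgP[fin /cvgrPdist_lt/(_ 1 ltr01) H].
    near=> k; have fk : dl k \is a fin_num by near: k.
    rewrite -(fineK fk) lte_fin; have : `|0 - fine (dl k)| < 1 by near: k.
    by rewrite sub0r normrN ger0_norm// fine_ge0.
  move=> [k _ /(_ k (leqnn _)) dk].
  have : cintegrable mu D (fun x => u x zeta - step_fun (s k) x zeta).
    apply/cintegrableP => //; split => //; rewrite (le_lt_trans (L k))//.
    by rewrite lte_mul_pinfty ?lee_fin ?(ltW c0)// (lt_trans dk)// ltry.
  move=> Id; have := cintegrableD mD Id (S k).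
  by apply: eq_cintegrable => // x _; rewrite subrK.
apply/eqP; rewrite -subr_eq0; apply/eqP/cmod_eq0/eqP.
rewrite eq_le cmod_ge0 andbT; apply/ler_addgt0Pl => e e0; rewrite addr0.
(* Evaluation costs c, and [cmod_cintegral_le] another factor 2 in one of the two errors; each error
   ends up at most e / 2. *)
have e1 : 0 < e / (4 * c) by rewrite divr_gt0// mulr_gt0.
have e2 : 0 < e / (2 * c) by rewrite divr_gt0// mulr_gt0.
have : \forall k \near \oo, (dl k < (e / (4 * c))%:E)%E /\
    fock_norm (fun z => step_integral (s k) z - v z) < e / (2 * c).
  have := s1; rewrite -/dl => /fine_cvgP[fin /cvgrPdist_lt/(_ _ e1) H].
  have {}s2 := (cvgrPdist_lt _ _).1 s2 _ e2.
  near=> k; have fk : dl k \is a fin_num by near: k.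
  split.
    rewrite -(fineK fk) lte_fin; have : `|0 - fine (dl k)| < e / (4 * c) by near: k.
    by rewrite sub0r normrN ger0_norm// fine_ge0.
  have : `|0 - fock_norm (fun z => step_integral (s k) z - v z)| < e / (2 * c).
    by near: k; exact: s2.
  by rewrite sub0r normrN ger0_norm// fock_norm_ge0.
move=> [k _ /(_ k (leqnn _)) [dk nk]].
have h1 : cmod (step_integral (s k) zeta - v zeta) <= c * (e / (2 * c)).
  rewrite (le_trans (fock_eval_le zeta (fockB (fock_step_integral (s k)) fv)))//.
  by rewrite ler_pM2l// ltW.
have h2 : cmod (cintegral mu D (fun x => u x zeta) - step_integral (s k) zeta) <=
    2 * (c * (e / (4 * c))).
  rewrite -(step_fun_integral (s k) zeta).2 -cintegralB//.
  rewrite -lee_fin (le_trans (cmod_cintegral_le _ mD (md k)))//.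
  rewrite EFinM; apply: lee_wpmul2l; first by rewrite lee_fin.
  apply: (le_trans (L k)).
  have -> : (c * (e / (4 * c)))%:E = (c%:E * (e / (4 * c))%:E)%E by rewrite -EFinM.
  apply: lee_wpmul2l.
    by rewrite lee_fin ltW.
  exact: ltW.
have -> : v zeta - cintegral mu D (fun x => u x zeta) =
  - (step_integral (s k) zeta - v zeta) -
    (cintegral mu D (fun x => u x zeta) - step_integral (s k) zeta) by ring.
rewrite (le_trans (cmodD _ _))// !cmodN (le_trans (lerD h1 h2))//.
rewrite le_eqVlt; apply/orP; left; apply/eqP; field.
by rewrite gt_eqF.
Unshelve. all: by end_near.
Qed.

Lemma bochnerE (u : T -> C -> C) (v : C -> C) :
  (forall zeta, cmeasurable D (fun x => u x zeta)) -> is_bochner mu D u v ->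
  bochner mu D u = (fun zeta => cintegral mu D (fun x => u x zeta)).
Proof.
move=> mu_ uv; apply/funext => zeta.
have H : is_bochner mu D u (bochner mu D u).
  by apply: (@xgetPex _ (fun=> 0 : C) [set v | is_bochner mu D u v]); exists v.
exact: (bochner_eval H).
Qed.

(** A [step] requires sets of finite measure; a level set of infinite measure is admissible only
    because [Theta] vanishes on it. *)
Lemma step_of_simple (W : choiceType) (tau : T -> W) (Theta : W -> C -> C) :
  simple_map tau -> (forall w, fock (Theta w)) ->
  (forall w, (mu (D `&` tau @^-1` [set w]) < +oo)%E \/ Theta w = (fun=> 0)) ->
  exists s : step, forall x, step_fun s x = Theta (tau x).
Proof.
move=> [/finite_seqP[l0 rl0] mtau] fT finT.
(* Without duplicates exactly one index contributes at each point. *)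
pose l := undup l0.
have rl x : tau x \in l.
  have : range tau (tau x) by exists x.
  by rewrite mem_undup rl0.
pose w0 (i : 'I_(size l)) := tnth (in_tuple l) i.
pose A (i : 'I_(size l)) : set T :=
  if (mu (D `&` tau @^-1` [set w0 i]) < +oo)%E then tau @^-1` [set w0 i] else set0.
have mA i : measurable (A i) by rewrite /A; case: ifP.
have fA i : (mu (D `&` A i) < +oo)%E.
  by rewrite /A; case: ifPn => //; rewrite setI0 measure0.
exists (Step mA fA (fun i => fT (w0 i))) => x; apply/funext => zeta.
rewrite /step_fun /=.
have /tnthP[i0 xi0] : tau x \in in_tuple l by exact: rl.
have Ew : w0 i0 = tau x by rewrite xi0.
rewrite (bigD1 i0)//= big1 ?addr0.
  rewrite Ew; have [fin|T0] := finT (tau x); last by rewrite T0 mulr0.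
  have Ax : A i0 x by rewrite /A Ew fin.
  by rewrite indicE mem_set// mul1r.
move=> i ii0; rewrite indicE memNset ?mul0r// /A; case: ifP => _ /= xi; last by [].
move: ii0; apply/negP; rewrite negbK; apply/eqP.
by apply: (tuple_uniqP (in_tuple l) (undup_uniq l0)); rewrite -/(w0 i) -xi -/(w0 i0) Ew.
Qed.

End bochner_eval.

Section bochner_exists.
Context d (T : measurableType d) (R : realType).
Local Notation C := R[i].
Local Notation R2 := (measurableTypeR R * measurableTypeR R)%type.
Local Notation R3 := (R * R * R)%type.
Local Notation pt z := (z.1 +i* z.2).
Variables (mu : {sigma_finite_measure set T -> \bar R}) (D : set T).
Hypothesis mD : measurable D.
Variables (f : T -> C) (p : T -> R3) (Psi : R3 -> C -> C) (M : R).
Hypothesis If : cintegrable mu D f.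
Hypothesis ap : approximable p.
Hypothesis fPsi : forall v, fock (Psi v).
Hypothesis nPsi : forall v, fock_norm (Psi v) = M.
Hypothesis cPsi : forall (v : nat -> R3) (v0 : R3) zeta, v @ \oo --> v0 ->
  (fun k => Psi (v k) zeta : C^o) @ \oo --> (Psi v0 zeta : C^o).
Hypothesis mPsi : jointly_measurable (fun x => Psi (p x)).

Lemma fock_normZ (c : C) (F : C -> C) : fock F ->
  fock_norm (fun z => c * F z) = cmod c * fock_norm F.
Proof.
move=> fF; have p0 := pi_gt0 R.
have := fock_norm_fsq (fock_fsq (fockZ c fF)).
rewrite (fsqZ c (fock_hol fF)) (fock_norm_fsq (fock_fsq fF)) -EFinM => -[E].
apply/eqP; rewrite -(@eqrXn2 _ 2)// ?fock_norm_ge0 ?mulr_ge0 ?cmod_ge0 ?fock_norm_ge0//.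
by rewrite -(inj_eq (mulfI (lt0r_neq0 p0))) -E; apply/eqP; ring.
Qed.

Lemma fock_normBC (F G : C -> C) :
  fock_norm (fun z => F z - G z) = fock_norm (fun z => G z - F z).
Proof. by apply: eq_fock_norm_fsq; apply: eq_integral => z _; rewrite cmodB. Qed.

Let f0 := crestrict D f.

Let mf0 : cmeasurable setT f0.
Proof. by have [/(cmeasurable_mkcond _ mD)] := (cintegrableP _ _ mD).1 If. Qed.

Let If0 : (\int[mu]_x (cmod (f0 x))%:E < +oo)%E.
Proof.
by have /(cintegrableP _ _ measurableT)[] := (cintegrable_mkcond _ _ mD).1 If.
Qed.

Let u x : C -> C := fun zeta => f0 x * Psi (p x) zeta.

Let mu_ : jointly_measurable u.
Proof. by apply: cmeasurableM => //; exact: (cmeasurable_comp mf0 measurable_fst). Qed.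

Let fu x : fock (u x). Proof. exact: fockZ. Qed.

Let M0 : 0 <= M. Proof. by rewrite -(nPsi (0, 0, 0)) fock_norm_ge0. Qed.

Let simple_approx_c : exists q : nat -> T -> C, [/\ forall k, simple_map (q k),
  forall k x, cmod (q k x) <= cmod (f0 x) &
  forall x, (fun k => q k x : C^o) @ \oo --> (f0 x : C^o)].
Proof.
have [m1 m2] := mf0.
have [q1 [s1 b1 c1]] := simple_approx m1; have [q2 [s2 b2 c2]] := simple_approx m2.
exists (fun k x => q1 k x +i* q2 k x); split.
- move=> k; exact: (simple_map_comp (fun v => v.1 +i* v.2) (simple_map_pair (s1 k) (s2 k))).
- move=> k x; rewrite -(@ler_pXn2r _ 2)// ?nnegrE ?cmod_ge0// !cmod_sqr /=.
  have sq (y z : R) : `|y| <= `|z| -> y ^+ 2 <= z ^+ 2.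
    by move=> yz; rewrite -(real_normK (num_real y)) -(real_normK (num_real z)) ler_pXn2r// nnegrE.
  by rewrite lerD// sq.
- by move=> x; apply/cvg_ReIm; split => /=; [exact: c1|exact: c2].
Qed.

Let vanish (h : T -> C) : (forall x, cmod (h x) <= cmod (f0 x)) ->
  forall x, x \notin D -> h x = 0.
Proof.
move=> hf x xD; apply/cmod_eq0/eqP; rewrite eq_le cmod_ge0 andbT.
by rewrite (le_trans (hf x))// /f0 /crestrict (negbTE xD) cmod0.
Qed.

(** Simple approximants of f and of p give step functions that converge pointwise in zeta. Since the
    norm of [Psi] is constant their norms converge too, hence they converge in norm by
    [fock_scheffe]; the norms of the errors are dominated by a multiple of |f|, and dominated
    convergence makes their integrals tend to 0. *)
Lemma bochner_exists : is_bochner mu D (fun x zeta => f x * Psi (p x) zeta)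
  (fun zeta => cintegral mu D (fun x => f x * Psi (p x) zeta)).
Proof.
have [q [sq bq cq]] := simple_approx_c; have [pk [sp cp]] := ap.
pose Theta (w : C * R3) : C -> C := fun zeta => w.1 * Psi w.2 zeta.
have mcf : measurable_fun setT (fun x => cmod (f0 x)) by exact: measurable_cmod.
have /choice[s sE] : forall k, exists s : step mu D, forall x,
    step_fun s x = Theta (q k x, pk k x).
  move=> k; have sqp := simple_map_pair (sq k) (sp k).
  apply: (@step_of_simple _ T R mu D (C * R3)%type (fun x => (q k x, pk k x))
    Theta sqp) => [w|[c v]]; first exact: fockZ.
  have [->|c0] := eqVneq c 0.
    by right; apply/funext => z; rewrite /Theta /= mul0r.
  left; have cp0 : 0 < cmod c.
    by rewrite lt_neqAle cmod_ge0 andbT eq_sym; apply: contra_neq c0 => /cmod_eq0.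
  set A := D `&` _; have mA : measurable A.
    by apply: measurableI => //; exact: sqp.2.
  (* Chebyshev: on this level set |f| is at least |c| > 0, so it has finite measure. *)
  have : ((cmod c)%:E * mu A <= \int[mu]_x (cmod (f0 x))%:E)%E.
    have -> : mu A = (\int[mu]_x (\1_A x : R)%:E)%E by rewrite integral_indic// setIT.
    rewrite -ge0_integralZl_EFin ?(ltW cp0)//.
      apply: ge0_le_lower_integral => x _; first by rewrite -EFinM lee_fin mulr_ge0 ?(ltW cp0).
      rewrite -EFinM lee_fin indicE; have [xA|xA] := boolP (x \in A).
        have [_ /= [E _]] : A x by exact: set_mem.
        by rewrite mulr1 -E.
      by rewrite mulr0 cmod_ge0.
    by apply/measurable_EFinP; exact: measurable_indic.
  move=> H; rewrite ltey; apply: contraTneq (le_lt_trans H If0) => ->.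
  by rewrite gt0_muley ?ltxx// lte_fin.
have ms k : jointly_measurable (step_fun (s k)).
  apply: cmeasurable_sum => i; apply: cmeasurableM.
    apply: cmeasurableR; apply: (@measurableT_comp _ _ _ _ _ _ (\1_(step_set i) : T -> R)).
      by apply: measurable_indic; exact: step_measurable.
    exact: measurable_fst.
  by apply: (cmeasurable_comp (cmeasurable_hol_pt (fock_hol (step_fock i)))); exact: measurable_snd.
pose r k x : C -> C := fun z => u x z - step_fun (s k) x z.
have mr k : jointly_measurable (r k) by exact: (cmeasurableB mu_ (ms k)).
have fr k x : fock (r k x) by apply: fockB; [exact: fu|exact: (fock_step_fun (s k) x)].
have Nb k x : fock_norm (r k x) <= 4 * (cmod (f0 x) * M).
  rewrite (le_trans (fock_normB_le (fu x) (fock_step_fun (s k) x)))//.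
  rewrite sE /Theta /u !fock_normZ// !nPsi.
  have : cmod (q k x) * M <= cmod (f0 x) * M by rewrite ler_wpM2r.
  by rewrite /=; lra.
(* The step functions have norm |q k x| M, which tends to |f0 x| M; this is the second hypothesis of
   [fock_scheffe]. *)
have Nc x : (fun k => fock_norm (r k x)) @ \oo --> (0 : R).
  under eq_fun do rewrite /r fock_normBC.
  apply: fock_scheffe.
  - by move=> k; exact: fock_step_fun.
  - exact: fu.
  - move=> z; under eq_fun do rewrite sE.
    by rewrite /Theta /u; apply: (@cvgM C); [exact: cq|apply: cPsi; exact: cp].
  - under eq_fun do rewrite sE /Theta fock_normZ//= nPsi.
    rewrite /u fock_normZ// nPsi; apply: cvgMl.
    apply/cvgrPdist_lt => e e0.
    have H : \forall k \near \oo, `|0 - cmod (q k x - f0 x)| < e.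
      by move: e e0; apply/cvgrPdist_lt; exact: ((cvg_cmod _ _).1 (cq x)).
    move: H; apply: filterS => k; rewrite sub0r normrN (ger0_norm (cmod_ge0 _)).
    apply: le_lt_trans.
    have h1 := cmodD (q k x - f0 x) (f0 x); have h2 := cmodD (f0 x - q k x) (q k x).
    rewrite !subrK in h1 h2; rewrite (cmodB (f0 x)) in h2.
    by rewrite ler_norml; apply/andP; split; lra.
have mN k : measurable_fun setT (fun x => fock_norm (r k x)) by exact: measurable_fock_norm.
have IfM : mu.-integrable setT (EFin \o (fun x => 4 * (cmod (f0 x) * M))).
  apply/integrableP; split.
    by apply/measurable_EFinP; apply: measurable_funM; [exact: measurable_cst|];
      apply: measurable_funM => //; exact: measurable_cst.
  rewrite (eq_integral (fun x => ((4 * M)%:E * (cmod (f0 x))%:E)%E)); last first.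
    move=> x _; rewrite /= ger0_norm ?mulr_ge0 ?cmod_ge0// -EFinM.
    by congr EFin; ring.
  rewrite ge0_integralZl_EFin ?mulr_ge0//; last 2 first.
  - by move=> x _; rewrite lee_fin cmod_ge0.
  - exact/measurable_EFinP.
  by rewrite lte_mul_pinfty// lee_fin mulr_ge0.
pose dk k := (\int[mu]_x (fock_norm (r k x))%:E)%E.
have dk0 k : (0 <= dk k)%E by apply: integral_ge0 => x _; rewrite lee_fin fock_norm_ge0.
have DC : dk @ \oo --> 0%E.
  have [||||_ _] := @dominated_convergence _ _ R mu setT measurableT
    (fun k x => (fock_norm (r k x))%:E) (fun=> 0%E) (EFin \o (fun x => 4 * (cmod (f0 x) * M)))
    (fun k => (measurable_EFinP _ _).2 (mN k)).
  - exact: measurable_cst.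
  - by apply: aeW => x _; apply: cvg_EFin; [exact: nearW|exact: Nc].
  - exact: IfM.
  - apply: aeW => x k _ /=; rewrite lee_fin ger0_norm ?fock_norm_ge0//; exact: Nb.
  by rewrite integral0.
have dkoo k : (dk k < +oo)%E.
  have /integrableP[_] := IfM; apply: le_lt_trans; apply: ge0_le_lower_integral => x _.
    by rewrite lee_fin fock_norm_ge0.
  by rewrite /= lee_fin (le_trans (Nb k x))// ler_norm.
have dkE k : dk k = (fine (dk k))%:E by rewrite fineK// ge0_fin_numE.
have vE : (fun zeta => cintegral mu D (fun x => f x * Psi (p x) zeta)) =
    (fun zeta => cintegral mu setT (fun x => u x zeta)).
  apply/funext => zeta; rewrite cintegral_mkcond; apply: eq_cintegral => x _.
  by rewrite /crestrict /u /f0 /crestrict; case: ifP => //; rewrite mul0r.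
have uE x : D x -> u x = (fun zeta => f x * Psi (p x) zeta).
  by move=> Dx; apply/funext => z; rewrite /u /f0 /crestrict mem_set.
have nu x : fock_norm (u x) = cmod (f0 x) * M by rewrite /u fock_normZ// nPsi.
have [Bu BuE] : exists B, (\int[mu]_x (fock_norm (u x))%:E)%E = B%:E.
  exists (fine (\int[mu]_x (fock_norm (u x))%:E)%E); rewrite fineK// ge0_fin_numE.
    have /integrableP[_] := IfM; apply: le_lt_trans; apply: ge0_le_lower_integral => x _.
      by rewrite lee_fin fock_norm_ge0.
    rewrite /= lee_fin nu; apply: le_trans (ler_norm _).
    by have := mulr_ge0 (cmod_ge0 (f0 x)) M0; lra.
  by apply: integral_ge0 => x _; rewrite lee_fin fock_norm_ge0.
have step0 k x : x \notin D -> step_fun (s k) x = (fun=> 0).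
  by move=> xD; rewrite sE; apply/funext => z; rewrite /Theta /= (vanish (bq k) xD) mul0r.
split.
- by move=> x Dx; exact: fockZ.
- rewrite vE; exact: (fock_fock_integral mu_ fu BuE).
exists s; split.
- by apply: aeW => x Dx; have := Nc x; rewrite /r (uE x Dx).
- suff E k : (\int[mu]_(x in D) (fock_norm (fun z => f x * Psi (p x) z - step_fun (s k) x z))%:E)%E
      = dk k by rewrite (funext E).
  rewrite integral_mkcond; apply: eq_integral => x _; rewrite patchE.
  case: ifPn => xD; first by rewrite /r (uE x (set_mem xD)).
  congr EFin; rewrite (_ : r k x = (fun z => 0 * 0)); first by rewrite fock_normZ ?cmod0 ?mul0r//; exact: fock0.
  by apply/funext => z; rewrite /r step0// /u /f0 /crestrict (negbTE xD) !mul0r subr0.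
have Ek k : fock_norm (fun z => step_integral (s k) z -
    cintegral mu D (fun x => f x * Psi (p x) z)) =
    fock_norm (fun z => cintegral mu setT (fun x => r k x z)).
  rewrite fock_normBC; congr fock_norm; apply/funext => z.
  have -> := congr1 (fun g : C -> C => g z) vE.
  have [I1 <-] := step_fun_integral mD (s k) z.
  have I2 : cintegrable mu setT (fun x => step_fun (s k) x z).
    move/(cintegrable_mkcond _ _ mD): I1; apply: eq_cintegrable => // x _.
    by rewrite /crestrict; case: ifPn => // xD; rewrite step0.
  rewrite cintegralB//; last exact: (fock_section_integrable mu_ fu BuE).
  congr (_ - _); rewrite cintegral_mkcond; apply: eq_cintegral => x _.
  by rewrite /crestrict; case: ifPn => // xD; rewrite step0.
rewrite (funext Ek); apply/cvgrPdist_lt => e e0.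
have /fine_cvgP[_ H] := DC.
have e20 : 0 < e / 2 by rewrite divr_gt0.
have {}H : \forall k \near \oo, `|0 - fine (dk k)| < e / 2 by exact: (cvgrPdist_lt _ _).1 H _ e20.
move: H.
apply: filterS => k; rewrite /= !sub0r !normrN (ger0_norm (fock_norm_ge0 _)).
rewrite ger0_norm ?fine_ge0//.
by have := fock_norm_fock_integral_le (mr k) (fr k) (dkE k); lra.
Qed.

End bochner_exists.

                                          

(** * Comparison of two fundamental domains *)

Section fundamental_domains.
Context d (X : measurableType d) (R : realType).
Variables (mu : {measure set X -> \bar R}) (phi : int -> X -> X).
Hypothesis mphi : forall j, mpres mu mu (phi j).

(** Countable additivity is indexed by nat, so integer labels are enumerated by [pickle_inv]; an n
    that codes no integer gives the empty fibre. *)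
Let fiber (c : X -> int) (n : nat) : set X := [set x | pickle_inv n = Some (c x)].

Let measurable_fiber (c : X -> int) n : (forall j, measurable (c @^-1` [set j])) ->
  measurable (fiber c n).
Proof.
move=> mc; rewrite /fiber; case: (pickle_inv n) => [j|].
  rewrite (_ : [set _ | _] = c @^-1` [set j])//.
  by apply/seteqP; split=> x /= => [[->]|->].
by rewrite (_ : [set _ | _] = set0)//; apply/seteqP; split.
Qed.

Let integral_fibers (c : X -> int) (D : set X) (k : X -> \bar R) :
  (forall j, measurable (c @^-1` [set j])) -> measurable D ->
  measurable_fun setT k -> (forall x, 0 <= k x)%E ->
  (\int[mu]_(x in D) k x = \sum_(n <oo) \int[mu]_(x in D `&` fiber c n) k x)%E.
Proof.
move=> mc mD mk k0.
have U : D = \bigcup_n (D `&` fiber c n).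
  apply/seteqP; split=> [x Dx|x [n _ []]//].
  by exists (pickle (c x)) => //; split => //; rewrite /fiber /= pickleK_inv.
rewrite [in LHS]U ge0_integral_bigcup//.
- by move=> n; apply: measurableI => //; exact: measurable_fiber.
- exact: measurable_funTS.
- by move=> i j _ _ [x [[_ /= xi] [_ /= xj]]];
    rewrite -(@pickle_invK int i) -(@pickle_invK int j) xi xj.
Qed.

Variables c1 c2 : X -> int.
Hypothesis mc1 : forall j, measurable (c1 @^-1` [set j]).
Hypothesis mc2 : forall j, measurable (c2 @^-1` [set j]).
Hypothesis c1E : forall j x, c1 (phi j x) = c1 x + j.
Hypothesis c2E : forall j x, c2 (phi j x) = c2 x + j.

                                                                                
                   
(** Cut {c1 = 0} along c2 = -j and {c2 = 0} along c1 = j. The map [phi j] raises both labels by j,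
    so it carries the first piece onto the second, preserving the measure and k. *)
Lemma ge0_fundamental_integral (k : X -> \bar R) :
  measurable_fun setT k -> (forall x, 0 <= k x)%E -> (forall j x, k (phi j x) = k x) ->
  (\int[mu]_(x in c1 @^-1` [set (0%R : int)]) k x = \int[mu]_(x in c2 @^-1` [set (0%R : int)]) k x)%E.
Proof.
move=> mk k0 kphi.
have mc2N j : measurable ((fun x => - c2 x) @^-1` [set j]).
  rewrite (_ : _ @^-1` _ = c2 @^-1` [set - j])//.
  by apply/seteqP; split=> x /= => [<-|->]; rewrite opprK.
rewrite (integral_fibers mc2N (mc1 0) mk k0) (integral_fibers mc1 (mc2 0) mk k0).
apply: eq_eseriesr => n _.
case E : (@pickle_inv int n) => [j|]; last first.
  have f0 c : fiber c n = set0 by apply/seteqP; split => x //; rewrite /fiber /= E.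
  by rewrite !f0 !setI0 !integral_set0.
rewrite integral_mkcond [RHS]integral_mkcond.
set g2 := (_ \_ (_ @^-1` _ `&` fiber c1 n))%E.
rewrite -((mphi j).2 g2); last 2 first.
- apply/(measurable_restrictT _ _).1; last exact: measurable_funTS.
  by apply: measurableI => //; exact: measurable_fiber.
- by move=> y; rewrite /g2 patchE; case: ifP.
apply: eq_integral => x _; rewrite /g2 !patchE kphi.
congr (if _ then _ else _); apply/idP/idP; rewrite !inE /fiber /= E c1E c2E.
  by move=> [-> [->]]; rewrite subrr add0r.
by move=> [/eqP]; rewrite addrC addr_eq0 => /eqP -> [/eqP];
  rewrite addrC -subr_eq0 opprD addNKr oppr_eq0 => /eqP ->.
Qed.

Lemma fundamental_cintegral (k : X -> R[i]) :
  cmeasurable setT k -> (forall j x, k (phi j x) = k x) ->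
  cintegral mu (c1 @^-1` [set (0%R : int)]) k = cintegral mu (c2 @^-1` [set (0%R : int)]) k.
Proof.
move=> [m1 m2] kphi.
have H (g : X -> R) : measurable_fun setT g -> (forall j x, g (phi j x) = g x) ->
    Rintegral mu (c1 @^-1` [set (0%R : int)]) g = Rintegral mu (c2 @^-1` [set (0%R : int)]) g.
  move=> mg gphi; rewrite /Rintegral integralE [in RHS]integralE.
  rewrite !ge0_fundamental_integral//.
  - by apply: measurable_funeneg; exact/measurable_EFinP.
  - by move=> j x; rewrite !funenegE /= gphi.
  - by apply: measurable_funepos; exact/measurable_EFinP.
  - by move=> j x; rewrite !funeposE /= gphi.
by rewrite /cintegral (H _ m1) ?(H _ m2)// => j x; rewrite kphi.
Qed.

End fundamental_domains.

(** * Invariance of Haar measure and weighted Fubini *)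

Section heisenberg_measure.
Variable R : realType.
Local Notation R1 := (measurableTypeR R).
Local Notation R3 := (R1 * R1 * R1)%type.
Local Notation hmul3 := (@hmul R : R3 -> R3 -> R3).

(** Right multiplication translates the plane and then translates t by an amount depending on the
    plane point: a skew product of translations. *)
Lemma mpres_hmulr (a : heis R) : mpres (leb3 R) (leb3 R) (fun q => hmul3 q a).
Proof.
have := @mpres_skew _ _ _ _ R (sleb2 R) (sleb1 R) (fun z => (z.1 + a.1.1, z.2 + a.1.2))
  (fun z t => t + (a.2 + 2^-1 * (z.1 * a.1.2 - z.2 * a.1.1))) (mpres_translation2 a.1)
  (fun z => mpres_translation _).
have -> : (fun p : R3 => ((p.1.1 + a.1.1, p.1.2 + a.1.2),
    p.2 + (a.2 + 2^-1 * (p.1.1 * a.1.2 - p.1.2 * a.1.1)))) = (fun q => hmul3 q a).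
  by apply/funext => q; rewrite /hmul addrA.
apply; apply: measurable_funD => //; apply: measurable_funD; first exact: measurable_cst.
apply: measurable_funM; first exact: measurable_cst.
apply: measurable_funB; apply: measurable_funM; try exact: measurable_cst.
  by apply: measurableT_comp.
by apply: measurableT_comp.
Qed.

Lemma measurable_hmul d (T : measurableType d) (u v : T -> R3) :
  measurable_fun setT u -> measurable_fun setT v ->
  measurable_fun setT (fun x => hmul3 (u x) (v x)).
Proof.
move=> mu_ mv.
have u1 := measurableT_comp (@measurable_fst _ _ (R1 * R1)%type R1) mu_.
have v1 := measurableT_comp (@measurable_fst _ _ (R1 * R1)%type R1) mv.
have u11 := measurableT_comp (@measurable_fst _ _ R1 R1) u1.
have u12 := measurableT_comp (@measurable_snd _ _ R1 R1) u1.
have v11 := measurableT_comp (@measurable_fst _ _ R1 R1) v1.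
have v12 := measurableT_comp (@measurable_snd _ _ R1 R1) v1.
have u2 := measurableT_comp (@measurable_snd _ _ (R1 * R1)%type R1) mu_.
have v2 := measurableT_comp (@measurable_snd _ _ (R1 * R1)%type R1) mv.
apply/measurable_fun_pairP; split => /=.
  by apply/measurable_fun_pairP; split => /=; exact: measurable_funD.
apply: measurable_funD; first exact: measurable_funD.
apply: measurable_funM; first exact: measurable_cst.
by apply: measurable_funB; exact: measurable_funM.
Qed.

End heisenberg_measure.

Lemma fubini_ae_cintegrable d1 d2 (X : measurableType d1) (Y : measurableType d2)
    (R : realType) (m1 : {sigma_finite_measure set X -> \bar R})
    (m2 : {sigma_finite_measure set Y -> \bar R}) (f : X * Y -> R[i]) :
  cintegrable (m1 \x m2)%E setT f ->
  {ae m1, forall x, cintegrable m2 setT (fun y => f (x, y))}.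
Proof.
move=> /cintegrableP -/(_ measurableT)[mf If].
have mcf : measurable_fun setT (fun p => (cmod (f p))%:E).
  by apply/measurable_EFinP; exact: measurable_cmod.
have c0 p : (0 <= (cmod (f p))%:E)%E by rewrite lee_fin cmod_ge0.
have IF : m1.-integrable setT (fubini_F m2 (fun p => (cmod (f p))%:E)).
  apply/integrableP; split; first exact: measurable_fun_fubini_tonelli_F.
  rewrite fubini_tonelli1// in If; apply: le_lt_trans If.
  rewrite le_eqVlt; apply/orP; left; apply/eqP; apply: eq_integral => x _.
  by rewrite gee0_abs//; apply: integral_ge0.
have := integrable_ae measurableT IF; apply: filterS => x /= /(_ I) fx.
apply/cintegrableP => //; split; first exact: (cmeasurable_comp mf (measurable_pair1 x)).
by rewrite ltey_eq fx.
Qed.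

(** Sections of K are integrable only almost everywhere, so pulling the weight out of the inner
    integral is an almost-everywhere identity. *)
Lemma cintegral_fubini_weight d1 d2 (X : measurableType d1) (Y : measurableType d2)
    (R : realType) (m1 : {sigma_finite_measure set X -> \bar R})
    (m2 : {sigma_finite_measure set Y -> \bar R}) (w : X -> R[i]) (K : X * Y -> R[i]) (M : R) :
  cmeasurable setT w -> (forall x, cmod (w x) <= M) -> cintegrable (m1 \x m2)%E setT K ->
  cintegral m1 setT (fun x => w x * cintegral m2 setT (fun y => K (x, y))) =
  cintegral (m1 \x m2)%E setT (fun p => w p.1 * K p).
Proof.
move=> mw wM IK.
have mK : cmeasurable setT K by have [] := (cintegrableP _ _ measurableT).1 IK.
have IwK : cintegrable (m1 \x m2)%E setT (fun p => w p.1 * K p).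
  apply: (le_cintegrable measurableT (g := fun p => M * cmod (K p))).
  - by apply: cmeasurableM => //; exact: (cmeasurable_comp mw measurable_fst).
  - have [_ Ic] := (cintegrableP _ _ measurableT).1 IK.
    apply: (eq_integrable measurableT (fun p => (M%:E * (cmod (K p))%:E)%E)) => //.
    apply: integrableZl => //; apply/integrableP; split.
      by apply/measurable_EFinP; exact: measurable_cmod.
    by under eq_integral do rewrite /= (ger0_norm (cmod_ge0 _)).
  - by move=> p _; rewrite cmodM ler_wpM2r ?cmod_ge0.
have [I1 <-] := cintegral_fubini IwK.
have [I2 _] := cintegral_fubini IK.
apply: ae_eq_cintegral => //.
- by apply: cmeasurableM => //; have [] := (cintegrableP _ _ measurableT).1 I2.
- by have [] := (cintegrableP _ _ measurableT).1 I1.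
by apply: filterS (fubini_ae_cintegrable IK) => x Ix _ /=; rewrite cintegralZl.
Qed.

(** * Periodicity of the geodesic and unfolding *)

Section geodesic_flow.
Variable R : realType.
Local Notation C := R[i].
Local Notation R1 := (measurableTypeR R).
Local Notation R3 := (R1 * R1 * R1)%type.
Local Notation hmul3 := (@hmul R : R3 -> R3 -> R3).
Variables (eps lam : R).
Hypothesis lam0 : 0 < lam.
Local Notation P := (period eps lam).
Local Notation geo := (geodesic eps lam : R1 -> R3).
Local Notation L := (2 * pi / lam).
Local Notation arc := (`[0, L[%classic : set R1).

Definition central (t : R) : heis R := ((0, 0), t).

Lemma hmul_centralC (t : R) (q : heis R) : hmul (central t) q = hmul q (central t).
Proof. by case: q => [[x y] s]; rewrite /hmul /=; congr (_, _, _); ring. Qed.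

Lemma period_gt0 : 0 < P.
Proof. by rewrite mulr_gt0 ?pi_gt0// ltr_wpDr ?exprn_gt0 ?invr_gt0// mulr_ge0 ?sqr_ge0. Qed.

Let L0 : 0 < L. Proof. by rewrite divr_gt0// mulr_gt0// pi_gt0. Qed.

Lemma cos_sinDint (x : R) (j : int) :
  cos (x + j%:~R * (2 * pi)) = cos x /\ sin (x + j%:~R * (2 * pi)) = sin x.
Proof.
have H (y : R) : cexp ('i%C * y%:C) = cos y +i* sin y.
  by rewrite /cexp !ReImE /=; rewrite !(mul0r, mul1r, subr0, addr0, add0r, mulr0, sub0r, oppr0, expR0).
have : cos (x + j%:~R * (2 * pi)) +i* sin (x + j%:~R * (2 * pi)) = cos x +i* sin x.
  rewrite -!H -[RHS]mulr1 -(cexp_2piZ j) -cexpD; congr cexp.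
  by apply: complex_ext; rewrite !ReImE /=; ring.
by case=> -> ->.
Qed.

(** One turn of the projected circle has length L and raises t by exactly [period]. *)
Lemma geodesic_periodic (s : R) (j : int) :
  geo (s + j%:~R * L) = hmul (geo s) (central (j%:~R * P)).
Proof.
have lamN0 : lam != 0 by rewrite gt_eqF.
have E : (s + j%:~R * L) / lam^-1 = s / lam^-1 + j%:~R * (2 * pi).
  by rewrite invrK; field.
rewrite /geodesic E; have [-> ->] := cos_sinDint (s / lam^-1) j.
rewrite /hmul /central /period /= !addr0 !mulr0 subrr mulr0 addr0; congr (_, _).
by field.
Qed.

Lemma measurable_geodesic : measurable_fun setT geo.
Proof.
have m1 : measurable_fun setT (fun s : R1 => s / lam^-1).
  by apply: measurable_funM => //; exact: measurable_cst.
apply/measurable_fun_pairP; split => /=; last first.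
  by apply: measurable_funM => //; exact: measurable_cst.
apply/measurable_fun_pairP; split => /=; apply: measurable_funM;
  try exact: measurable_cst; apply: measurableT_comp m1;
  apply: continuous_measurable_fun; [exact: continuous_cos|exact: continuous_sin].
Qed.

Let X := (R3 * R1)%type.
(** The central translation of q and the backward shift of s compensate each other, so q times the
    geodesic at s is invariant. *)
Let phi (j : int) (p : X) : X := (hmul3 p.1 (central (j%:~R * P)), p.2 - j%:~R * L).
Let c1 (p : X) : int := Num.floor (p.1.2 / P).
(** The sign makes this label grow by j under [phi j], like [c1]. The zero sets of the two labels
    are the quotient domain times the line and the group times one turn. *)
Let c2 (p : X) : int := - Num.floor (p.2 / L).

Let mphi j : mpres (sleb3 R \x sleb1 R)%E (sleb3 R \x sleb1 R)%E (phi j).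
Proof.
apply: (@mpres_skew _ _ _ _ R (sleb3 R) (sleb1 R) (fun q => hmul3 q (central (j%:~R * P)))
  (fun _ s => s - j%:~R * L)).
- exact: mpres_hmulr.
- by move=> _; exact: mpres_translation.
- by apply: measurable_funB => //; exact: measurable_cst.
Qed.

Let measurable_floor (g : X -> R) j : measurable_fun setT g ->
  measurable ((fun x => Num.floor (g x)) @^-1` [set j]).
Proof.
move=> mg; rewrite (_ : _ @^-1` _ = g @^-1` `[j%:~R, (j + 1)%:~R[).
  by rewrite -[_ @^-1` _]setTI; apply: mg => //; exact: measurable_itv.
apply/seteqP; split=> x /=; rewrite in_itv /=; last exact: floor_def.
by move=> <-; exact: floor_itv.
Qed.

Let mc1 j : measurable (c1 @^-1` [set j]).
Proof.
apply: measurable_floor; apply: measurable_funM; last exact: measurable_cst.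
by apply: measurableT_comp => //.
Qed.

Let mc2 j : measurable (c2 @^-1` [set j]).
Proof.
rewrite (_ : _ @^-1` _ = (fun p => Num.floor (p.2 / L)) @^-1` [set - j]).
  by apply: measurable_floor; apply: measurable_funM => //; exact: measurable_cst.
by apply/seteqP; split=> x /= => [<-|E]; rewrite ?opprK // /c2 E opprK.
Qed.

Let c1E j p : c1 (phi j p) = c1 p + j.
Proof.
rewrite /c1 /phi /hmul /central /= !mulr0 subrr mulr0 addr0 mulrDl mulfK ?gt_eqF ?period_gt0//.
by rewrite real_floorDrz ?num_real ?intr_int// intrKfloor.
Qed.

Let c2E j p : c2 (phi j p) = c2 p + j.
Proof.
rewrite /c2 /phi /= mulrBl mulfK ?gt_eqF// -mulrNz.
by rewrite real_floorDrz ?num_real ?intr_int// intrKfloor opprD opprK.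
Qed.

Let quot_domE : c1 @^-1` [set (0%R : int)] = quot_dom eps lam `*` setT.
Proof.
apply/seteqP; split=> p; rewrite /c1 /quot_dom /=.
  move=> E; have := floor_itv (p.1.2 / P); rewrite E add0r.
  by rewrite ler_pdivlMr ?ltr_pdivrMr ?period_gt0// mul0r mul1r.
move=> [/andP[h1 h2] _]; apply: floor_def.
by rewrite add0r ler_pdivlMr ?ltr_pdivrMr ?period_gt0// mul0r mul1r h1.
Qed.

Let arc_domE : c2 @^-1` [set (0%R : int)] = setT `*` `[0, L[.
Proof.
apply/seteqP; split=> p; rewrite /c2 /=.
  move=> /eqP; rewrite oppr_eq0 => /eqP E; split => //.
  have := floor_itv (p.2 / L); rewrite E add0r.
  by rewrite ler_pdivlMr// ltr_pdivrMr// mul0r mul1r in_itv.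
move=> [_]; rewrite in_itv /= => /andP[h1 h2].
by rewrite (@floor_def _ _ 0) ?oppr0// add0r ler_pdivlMr// ltr_pdivrMr// mul0r mul1r h1.
Qed.

Lemma measurable_quot_dom : measurable (quot_dom eps lam : set R3).
Proof.
have m2 := @measurable_snd _ _ (R1 * R1)%type R1.
rewrite (_ : quot_dom _ _ = snd @^-1` `[0, P[); last first.
  by apply/seteqP; split=> q; rewrite /quot_dom /= in_itv.
by rewrite -[_ @^-1` _]setTI; apply: m2 => //; exact: measurable_itv.
Qed.

(** Both sides are integrals over fundamental domains for [phi], namely the zero sets of [c1] and
    [c2]. *)
Lemma ge0_geodesic_unfold (k : X -> \bar R) :
  measurable_fun setT k -> (forall p, 0 <= k p)%E ->
  (forall j q s, k (hmul3 q (central (j%:~R * P)), s - j%:~R * L) = k (q, s)) ->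
  (\int[sleb3 R \x sleb1 R]_(p in quot_dom eps lam `*` setT) k p =
   \int[sleb3 R \x sleb1 R]_(p in setT `*` arc) k p)%E.
Proof.
move=> mk k0 kphi; rewrite -quot_domE -arc_domE.
by apply: (ge0_fundamental_integral mphi) => // j [q s]; exact: kphi.
Qed.

Lemma geodesic_unfold (k : X -> C) : cmeasurable setT k ->
  (forall j q s, k (hmul3 q (central (j%:~R * P)), s - j%:~R * L) = k (q, s)) ->
  cintegral (sleb3 R \x sleb1 R)%E (quot_dom eps lam `*` setT) k =
  cintegral (sleb3 R \x sleb1 R)%E (setT `*` arc) k.
Proof.
move=> mk kphi; rewrite -quot_domE -arc_domE.
by apply: (fundamental_cintegral mphi) => // j [q s]; exact: kphi.
Qed.

End geodesic_flow.

(** * The orbital integral along geodesics *)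

Section geodesic_integral.
Variable R : realType.
Local Notation C := R[i].
Local Notation R1 := (measurableTypeR R).
Local Notation R3 := (R1 * R1 * R1)%type.
Local Notation hmul3 := (@hmul R : R3 -> R3 -> R3).
Variables (eps lam : R).
Hypothesis lam0 : 0 < lam.
Local Notation P := (period eps lam).
Local Notation geo := (geodesic eps lam : R1 -> R3).
Local Notation L := (2 * pi / lam).
Local Notation arc := (`[0, L[%classic : set R1).
Local Notation quot := (quot_dom eps lam : set R3).
Local Notation X := (R3 * R1)%type.
Local Notation mX := (sleb3 R \x sleb1 R)%E.

Let mquot : measurable (quot `*` setT : set X).
Proof. by apply: measurableX => //; exact: measurable_quot_dom. Qed.

Let marc : measurable (setT `*` arc : set X).
Proof. by apply: measurableX => //; exact: measurable_itv. Qed.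

Lemma hmulK (q g : heis R) : hmul (hmul q g) (hinv g) = q.
Proof.
by case: q g => [[a b] c] [[a' b'] c']; rewrite /hinv /hmul /=; congr (_, _, _); ring.
Qed.

Let flow (f : R3 -> C) (p : X) : C := f (hmul3 p.1 (geo p.2)).

Let measurable_flow f : cmeasurable setT f -> cmeasurable setT (flow f).
Proof.
move=> mf; apply: (cmeasurable_comp mf); apply: measurable_hmul => //.
by apply: measurableT_comp; [exact: measurable_geodesic|exact: measurable_snd].
Qed.

Lemma hmul_central_geodesic (q : heis R) (s : R) (j : int) :
  hmul (hmul q (central (j%:~R * P))) (geo s) = hmul q (geo (s + j%:~R * L)).
Proof. by rewrite geodesic_periodic// -hmulA hmul_centralC. Qed.

Let flow_inv f j (q : R3) (s : R1) :
  flow f (hmul3 q (central (j%:~R * P)), s - j%:~R * L) = flow f (q, s).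
Proof. by rewrite /flow /= hmul_central_geodesic subrK. Qed.

(** A central translation of q amounts to a shift of s, which Lebesgue measure does not see. *)
Lemma geo_int_invariant f : cmeasurable setT f -> quot_fun eps lam (geo_int eps lam f).
Proof.
move=> mf q _ [j _ <-]; rewrite /geo_int.
rewrite -(mpres_cintegral (mpres_translation (j%:~R * L))
  (g := fun s : R1 => f (hmul q (geo s)))).
  by apply: eq_cintegral => s _; rewrite hmul_central_geodesic.
exact: (cmeasurable_comp (measurable_flow mf) (measurable_pair1 q)).
Qed.

Let flow_quot f : X -> C := crestrict (quot `*` setT) (flow f).

Let flow_quotE f (q : R3) :
  cintegral (sleb1 R) setT (fun s => flow_quot f (q, s)) =
  crestrict quot (geo_int eps lam f) q.
Proof.
rewrite /crestrict; have [qD|qD] := boolP (q \in quot).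
  apply: eq_cintegral => s _; rewrite /flow_quot /crestrict mem_set//.
  by split => //=; exact: set_mem.
rewrite (eq_cintegral _ (g := fun=> 0)); first by rewrite /cintegral /Rintegral !integral0.
move=> s _; rewrite /flow_quot /crestrict memNset// => -[/= Dq _].
by move: qD; rewrite mem_set.
Qed.

(** Unfold to the group times one turn; for each s on the turn right invariance gives the L1 norm of
    f, and the turn has length L. *)
Let integral_flow f : cmeasurable setT f ->
  (\int[mX]_p (cmod (flow_quot f p))%:E = L%:E * \int[leb3 R]_q (cmod (f q))%:E)%E.
Proof.
move=> mf; have mF := measurable_flow mf.
transitivity (\int[mX]_(p in quot `*` setT) (cmod (flow f p))%:E)%E.
  rewrite [RHS]integral_mkcond; apply: eq_integral => p _.
  by rewrite patchE /flow_quot /crestrict; case: ifP => //; rewrite cmod0.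
rewrite ge0_geodesic_unfold//; last 3 first.
- by apply/measurable_EFinP; exact: measurable_cmod.
- by move=> p; rewrite lee_fin cmod_ge0.
- by move=> j q s; rewrite flow_inv.
rewrite integral_mkcond fubini_tonelli2; last 2 first.
- apply/(measurable_restrictT _ _).1 => //.
  by apply: measurable_funTS; apply/measurable_EFinP; exact: measurable_cmod.
- by move=> p; rewrite patchE; case: ifP; rewrite ?lee_fin ?cmod_ge0.
transitivity (\int[sleb1 R]_(s in arc) \int[leb3 R]_q (cmod (f q))%:E)%E.
  rewrite [RHS]integral_mkcond; apply: eq_integral => s _.
  rewrite /fubini_G patchE; case: ifPn => sarc.
    rewrite -((mpres_hmulr (geo s)).2 (fun q => (cmod (f q))%:E)); last 2 first.
    - by apply/measurable_EFinP; exact: measurable_cmod.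
    - by move=> q; rewrite lee_fin cmod_ge0.
    apply: eq_integral => q _; rewrite patchE mem_set//.
    by split => //=; exact: set_mem.
  apply: integral0_eq => q _; rewrite patchE memNset// => -[_ /= s1].
  by move: sarc; rewrite mem_set.
rewrite integral_cst; last exact: measurable_itv.
have E : (@lebesgue_measure R) arc = L%:E.
  rewrite lebesgue_measure_itv/= lte_fin divr_gt0 ?mulr_gt0 ?pi_gt0//.
  by rewrite -EFinB subr0.
by rewrite muleC -E.
Qed.

Let cintegrable_flow f : cintegrable (leb3 R) setT f -> cintegrable mX setT (flow_quot f).
Proof.
move=> /cintegrableP -/(_ measurableT)[mf If]; apply/cintegrableP => //; split.
  by apply/(cmeasurable_mkcond _ _).1 => //; apply: cmeasurableT; exact: measurable_flow.
rewrite integral_flow// lte_mul_pinfty// lee_fin.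
by rewrite ltW// divr_gt0// mulr_gt0// pi_gt0.
Qed.

Lemma cintegrable_geo_int f : cintegrable (leb3 R) setT f ->
  cintegrable (leb3 R) quot (geo_int eps lam f).
Proof.
move=> If; apply/cintegrable_mkcond; first exact: measurable_quot_dom.
have [+ _] := cintegral_fubini (cintegrable_flow If).
by apply: eq_cintegrable => // q _; exact: flow_quotE.
Qed.

Lemma geo_int_L1_le f : cmeasurable setT f ->
  (\int[leb3 R]_(q in quot) (cmod (geo_int eps lam f q))%:E <=
   2%:E * (L%:E * \int[leb3 R]_q (cmod (f q))%:E))%E.
Proof.
move=> mf; have mF : cmeasurable setT (flow_quot f).
  by apply/(cmeasurable_mkcond _ _).1 => //; apply: cmeasurableT; exact: measurable_flow.
have mcF : measurable_fun setT (fun p => (cmod (flow_quot f p))%:E).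
  by apply/measurable_EFinP; exact: measurable_cmod.
have c0 p : (0 <= (cmod (flow_quot f p))%:E)%E by rewrite lee_fin cmod_ge0.
have E := @fubini_tonelli1 _ _ _ _ _ (sleb3 R) (sleb1 R) _ mcF c0.
rewrite -(integral_flow mf) E -ge0_integralZl//; last 2 first.
- exact: measurable_fun_fubini_tonelli_F.
- by move=> q _; apply: integral_ge0 => s _; rewrite lee_fin cmod_ge0.
rewrite [leLHS]integral_mkcond; apply: ge0_le_lower_integral => q _.
  by rewrite patchE; case: ifP => // _; rewrite lee_fin cmod_ge0.
have -> : ((fun q => (cmod (geo_int eps lam f q))%:E) \_ quot)%E q =
    (cmod (cintegral (sleb1 R) setT (fun s => flow_quot f (q, s))))%:E.
  by rewrite patchE flow_quotE /crestrict; case: ifP => //; rewrite cmod0.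
apply: cmod_cintegral_le => //; exact: (cmeasurable_comp mF (measurable_pair1 q)).
Qed.

(** Linearity is available where both orbital integrals converge absolutely, which by Fubini is
    almost everywhere. *)
Lemma geo_intB_ae f g : cintegrable (leb3 R) setT f -> cintegrable (leb3 R) setT g ->
  ae_eq (leb3 R) quot (geo_int eps lam (fun p => f p - g p))
    (fun q => geo_int eps lam f q - geo_int eps lam g q).
Proof.
move=> If Ig; have aef := fubini_ae_cintegrable (cintegrable_flow If).
have aeg := fubini_ae_cintegrable (cintegrable_flow Ig).
apply: filterS2 aef aeg => q fq gq Dq.
have sec h : cintegrable (sleb1 R) setT (fun s => flow_quot h (q, s)) ->
    cintegrable (sleb1 R) setT (fun s => h (hmul q (geo s))).
  by apply: eq_cintegrable => // s _; rewrite /flow_quot /crestrict mem_set.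
by rewrite /geo_int cintegralB//; exact: sec.
Qed.

(** The heart of the argument in scalar form: Fubini writes the left side as an integral over the
    quotient times the line, unfolding moves it to the group times one turn, and Fubini in the other
    order allows a change of variable for each s. *)
Lemma geo_int_weight f (w : R3 -> C) (M : R) : cintegrable (leb3 R) setT f ->
  cmeasurable setT w -> (forall q, cmod (w q) <= M) ->
  (forall j q, w (hmul3 q (central (j%:~R * P))) = w q) ->
  cintegral (leb3 R) quot (fun q => geo_int eps lam f q * w q) =
  cintegral (leb1 R) arc (fun s => cintegral (leb3 R) setT
    (fun p => f p * w (hmul3 p (hinv (geo s))))).
Proof.
move=> If mw wM winv; have [mf _] := (cintegrableP _ _ measurableT).1 If.
have mF := measurable_flow mf.
pose wF (p : X) : C := w p.1 * flow f p.
have mwF : cmeasurable setT wF.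
  by apply: cmeasurableM => //; exact: (cmeasurable_comp mw measurable_fst).
have wF_inv j (q : R3) (s : R1) :
    wF (hmul3 q (central (j%:~R * P)), s - j%:~R * L) = wF (q, s).
  by rewrite /wF /= flow_inv winv.
rewrite cintegral_mkcond.
transitivity (cintegral mX setT (fun p => w p.1 * flow_quot f p)).
  rewrite -(cintegral_fubini_weight mw wM (cintegrable_flow If)).
  apply: eq_cintegral => q _; rewrite flow_quotE /crestrict.
  by case: ifP => _; rewrite ?mulr0// mulrC.
transitivity (cintegral mX (quot `*` setT) wF).
  rewrite [RHS]cintegral_mkcond; apply: eq_cintegral => p _.
  by rewrite /crestrict /flow_quot /crestrict; case: ifP => _; rewrite ?mulr0.
rewrite geodesic_unfold// cintegral_mkcond [RHS]cintegral_mkcond.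
have Ia : cintegrable mX setT (crestrict (setT `*` arc) wF).
  apply: (cintegrable_mkcond _ _ marc).1; apply/cintegrableP => //.
  split; first exact: (cmeasurableT _ mwF).
  have mcF : measurable_fun setT (fun p => (cmod (flow f p))%:E).
    by apply/measurable_EFinP; exact: measurable_cmod.
  (* Unfolding is used backwards: finiteness over the arc side is inherited from the quotient
     side. *)
  have IF : (\int[mX]_(p in setT `*` arc) (cmod (flow f p))%:E < +oo)%E.
    rewrite -(@ge0_geodesic_unfold _ eps)//; last 2 first.
    - by move=> p; rewrite lee_fin cmod_ge0.
    - by move=> j q s; rewrite flow_inv.
    have [_] := (cintegrableP _ _ measurableT).1 (cintegrable_flow If).
    apply: le_lt_trans; rewrite le_eqVlt; apply/orP; left; apply/eqP.
    rewrite [LHS]integral_mkcond; apply: eq_integral => p _.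
    by rewrite patchE /flow_quot /crestrict; case: ifP => //; rewrite cmod0.
  have M0 : 0 <= M by rewrite (le_trans _ (wM (0, 0, 0)))// cmod_ge0.
  apply: (@le_lt_trans _ _ (M%:E * \int[mX]_(p in setT `*` arc) (cmod (flow f p))%:E)%E).
    rewrite -ge0_integralZl_EFin//; last 2 first.
    - by move=> p _; rewrite lee_fin cmod_ge0.
    - exact: measurable_funTS.
    apply: ge0_le_lower_integral => p _; first by rewrite lee_fin cmod_ge0.
    by rewrite -EFinM lee_fin /wF cmodM ler_wpM2r ?cmod_ge0.
  by rewrite lte_mul_pinfty.
have [_ <-] := cintegral_fubini_swap Ia.
apply: eq_cintegral => s _; rewrite /crestrict; case: ifPn => sarc; last first.
  rewrite (eq_cintegral _ (g := fun=> 0)); first by rewrite /cintegral /Rintegral !integral0.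
  move=> q _; rewrite memNset// => -[_ /= s1].
  by move: sarc; rewrite mem_set.
(* The substitution p = q gamma(s), which preserves Haar measure. *)
rewrite -(mpres_cintegral (mpres_hmulr (geo s))
  (g := fun p => f p * w (hmul3 p (hinv (geo s))))); last first.
  apply: cmeasurableM => //; apply: (cmeasurable_comp mw).
  by apply: measurable_hmul => //; exact: measurable_cst.
apply: eq_cintegral => q _; rewrite mem_set; last by split => //=; exact: set_mem.
by rewrite /wF /flow /= hmulK mulrC.
Qed.

End geodesic_integral.

(** * Density of compactly supported continuous functions in L1 *)

Lemma integrable_indicator d (T : measurableType d) (R : realType)
    (mu : {measure set T -> \bar R}) (A : set T) : measurable A -> (mu A < +oo)%E ->
  mu.-integrable setT (EFin \o (\1_A : T -> R)).
Proof.
move=> mA fA; apply/integrableP; split.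
  by apply/measurable_EFinP; exact: measurable_indic.
under eq_integral do rewrite /= ger0_norm ?indicE ?ler0n//.
by rewrite integral_indic// setIT.
Qed.

                                                 

Section L1_approximation.
Context d (T : measurableType d) (R : realType).
Variables (mu : {measure set T -> \bar R}) (C : set (T -> R)).
Hypothesis mC : forall phi, C phi -> measurable_fun setT phi.
Hypothesis C0 : C (fun=> 0).
Hypothesis CD : forall phi psi, C phi -> C psi -> C (fun x => phi x + psi x).
Hypothesis CZ : forall (c : R) phi, C phi -> C (fun x => c * phi x).

Definition L1_approx (f : T -> R) : Prop := forall e : R, 0 < e ->
  exists2 phi, C phi & (\int[mu]_x (`|f x - phi x|)%:E <= e%:E)%E.

Let measurable_absB (f g : T -> R) : measurable_fun setT f -> measurable_fun setT g ->
  measurable_fun setT (fun x => (`|f x - g x|)%:E).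
Proof.
by move=> mf mg; apply/measurable_EFinP; apply: measurableT_comp => //; exact: measurable_funB.
Qed.

Let absB0 (f g : T -> R) x : (0 <= (`|f x - g x|)%:E)%E. Proof. by rewrite lee_fin. Qed.

Lemma L1_approx_lim (f : T -> R) : measurable_fun setT f ->
  (forall e : R, 0 < e -> exists g, [/\ measurable_fun setT g, L1_approx g &
    (\int[mu]_x (`|f x - g x|)%:E <= e%:E)%E]) -> L1_approx f.
Proof.
move=> mf H e e0; have e20 : 0 < e / 2 by rewrite divr_gt0.
have [g [mg ag fg]] := H _ e20; have [phi Cphi gphi] := ag _ e20.
exists phi => //; have mphi := mC Cphi.
apply: (@le_trans _ _ (\int[mu]_x ((`|f x - g x|)%:E + (`|g x - phi x|)%:E))%E).
  apply: ge0_le_lower_integral => x _; first exact: absB0.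
  rewrite -EFinD lee_fin (_ : f x - phi x = (f x - g x) + (g x - phi x)); last by ring.
  exact: ler_normD.
rewrite ge0_integralD//; try exact: measurable_absB.
have -> : (e%:E = (e / 2)%:E + (e / 2)%:E)%E by rewrite -EFinD -splitr.
exact: leeD.
Qed.

Lemma L1_approxD f g : measurable_fun setT f -> measurable_fun setT g ->
  L1_approx f -> L1_approx g -> L1_approx (fun x => f x + g x).
Proof.
move=> mf mg af ag e e0; have e20 : 0 < e / 2 by rewrite divr_gt0.
have [phi Cphi fphi] := af _ e20; have [psi Cpsi gpsi] := ag _ e20.
exists (fun x => phi x + psi x); first exact: CD.
have mphi := mC Cphi; have mpsi := mC Cpsi.
apply: (@le_trans _ _ (\int[mu]_x ((`|f x - phi x|)%:E + (`|g x - psi x|)%:E))%E).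
  apply: ge0_le_lower_integral => x _; first by rewrite lee_fin.
  rewrite -EFinD lee_fin.
  rewrite (_ : _ - _ = (f x - phi x) + (g x - psi x)); last by ring.
  exact: ler_normD.
rewrite ge0_integralD//; try exact: measurable_absB.
have -> : (e%:E = (e / 2)%:E + (e / 2)%:E)%E by rewrite -EFinD -splitr.
exact: leeD.
Qed.

Lemma L1_approxZ (c : R) f : measurable_fun setT f -> L1_approx f -> L1_approx (fun x => c * f x).
Proof.
move=> mf af e e0; have c0 : 0 < `|c| + 1 by rewrite ltr_wpDl.
have ec0 : 0 < e / (`|c| + 1) by rewrite divr_gt0.
have [phi Cphi fphi] := af _ ec0.
exists (fun x => c * phi x); first exact: CZ.
have mphi := mC Cphi.
apply: (@le_trans _ _ (\int[mu]_x ((`|c| + 1)%:E * (`|f x - phi x|)%:E))%E).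
  apply: ge0_le_lower_integral => x _; first by rewrite lee_fin.
  by rewrite -mulrBr normrM -EFinM lee_fin ler_wpM2r// lerDl.
rewrite ge0_integralZl_EFin ?(ltW c0)//; last exact: measurable_absB.
have -> : (e%:E = (`|c| + 1)%:E * (e / (`|c| + 1))%:E)%E.
  by rewrite -EFinM; congr EFin; field; rewrite gt_eqF.
by rewrite lee_pmul2l.
Qed.

Lemma L1_approx0 : L1_approx (fun=> 0).
Proof.
move=> e e0; exists (fun=> 0) => //.
by under eq_integral do rewrite subrr normr0; rewrite integral0 lee_fin ltW.
Qed.

Lemma L1_approx_sum (I : Type) (l : seq I) (f : I -> T -> R) :
  (forall i, measurable_fun setT (f i)) -> (forall i, L1_approx (f i)) ->
  L1_approx (fun x => \sum_(i <- l) f i x).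
Proof.
move=> mf af; elim: l => [|i l IH].
  by under eq_fun do rewrite big_nil; exact: L1_approx0.
under eq_fun do rewrite big_cons; apply: L1_approxD => //.
exact: measurable_sum.
Qed.

(** Approximability survives dominated limits; this carries it from rectangles to measurable sets
    and then to integrable functions. *)
Lemma L1_approx_dominated (g : nat -> T -> R) (f h : T -> R) :
  measurable_fun setT f -> mu.-integrable setT (EFin \o h) ->
  (forall n, measurable_fun setT (g n)) -> (forall n, L1_approx (g n)) ->
  (forall x, (fun n => g n x) @ \oo --> f x) -> (forall n x, `|g n x| <= h x) ->
  L1_approx f.
Proof.
move=> mf Ih mg ag cg gh; apply: L1_approx_lim => // e e0.
have [|||||_ + _] := @dominated_convergence _ _ R mu setT measurableT
    (fun n x => (g n x)%:E) (fun x => (f x)%:E) (EFin \o h).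
- by move=> n; exact/measurable_EFinP.
- exact/measurable_EFinP.
- by apply: aeW => x _; apply: cvg_EFin; [exact: nearW|exact: cg].
- exact: Ih.
- by apply: aeW => x n _ /=; rewrite lee_fin.
move=> /fine_cvgP[fin /cvgrPdist_lt/(_ _ e0) H].
have : \forall n \near \oo, (\int[mu]_x `|(g n x)%:E - (f x)%:E| <= e%:E)%E.
  near=> n; have fn : (\int[mu]_x `|(g n x)%:E - (f x)%:E|)%E \is a fin_num by near: n.
  have : `|0 - fine (\int[mu]_x `|(g n x)%:E - (f x)%:E|)%E| < e by near: n.
  rewrite sub0r normrN ger0_norm; last by rewrite fine_ge0// integral_ge0.
  by rewrite -(fineK fn) lee_fin => /ltW.
move=> [n _ /(_ n (leqnn _)) gn]; exists (g n); split => //.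
apply: le_trans gn; rewrite le_eqVlt; apply/orP; left; apply/eqP.
by apply: eq_integral => x _; rewrite -EFinB /= distrC.
Unshelve. all: by end_near.
Qed.

End L1_approximation.

Section L1_approximation_product.
Context d1 d2 (X : measurableType d1) (Y : measurableType d2) (R : realType).
Variables (m1 : {sigma_finite_measure set X -> \bar R}).
Variables (m2 : {sigma_finite_measure set Y -> \bar R}).
Variables (C1 : set (X -> R)) (C2 : set (Y -> R)) (C : set (X * Y -> R)).
Local Notation mu := (m1 \x m2)%E.
Hypothesis IC1 : forall phi, C1 phi -> m1.-integrable setT (EFin \o phi).
Hypothesis IC2 : forall phi, C2 phi -> m2.-integrable setT (EFin \o phi).
Hypothesis mC : forall phi, C phi -> measurable_fun setT phi.
Hypothesis C0 : C (fun=> 0).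
Hypothesis CD : forall phi psi, C phi -> C psi -> C (fun x => phi x + psi x).
Hypothesis CZ : forall (c : R) phi, C phi -> C (fun x => c * phi x).
Hypothesis C12 : forall phi psi, C1 phi -> C2 psi -> C (fun p => phi p.1 * psi p.2).
Hypothesis dense1 : forall f : X -> R, m1.-integrable setT (EFin \o f) -> L1_approx m1 C1 f.
Hypothesis dense2 : forall f : Y -> R, m2.-integrable setT (EFin \o f) -> L1_approx m2 C2 f.

Let mC1 phi : C1 phi -> measurable_fun setT phi.
Proof. by move=> /IC1 /integrableP[/measurable_EFinP]. Qed.
Let mC2 phi : C2 phi -> measurable_fun setT phi.
Proof. by move=> /IC2 /integrableP[/measurable_EFinP]. Qed.

Let tensor_norm (f : X -> R) (g : Y -> R) :
  measurable_fun setT f -> measurable_fun setT g -> (forall x, 0 <= f x) -> (forall y, 0 <= g y) ->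
  (\int[mu]_p (f p.1 * g p.2)%:E = (\int[m1]_x (f x)%:E) * (\int[m2]_y (g y)%:E))%E.
Proof.
move=> mf mg f0 g0.
rewrite fubini_tonelli1; last 2 first.
- apply/measurable_EFinP; apply: measurable_funM.
    exact: measurableT_comp mf measurable_fst.
  exact: measurableT_comp mg measurable_snd.
- by move=> p; rewrite lee_fin mulr_ge0.
rewrite -ge0_integralZr//; last 3 first.
- exact/measurable_EFinP.
- by move=> x _; rewrite lee_fin.
- by apply: integral_ge0 => y _; rewrite lee_fin.
apply: eq_integral => x _; rewrite /fubini_F -ge0_integralZl_EFin//; last exact/measurable_EFinP.
by move=> y _; rewrite lee_fin.
Qed.

(** Approximate each indicator separately and split the error as (1_A - phi) 1_B + phi (1_B - psi);
    hence psi is chosen after the norm of phi is known. *)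
Let rectangle_approx (A : set X) (B : set Y) : measurable A -> measurable B ->
  (m1 A < +oo)%E -> (m2 B < +oo)%E ->
  L1_approx mu C (fun p => \1_A p.1 * \1_B p.2).
Proof.
move=> mA mB fA fB e e0.
have iA : m1.-integrable setT (EFin \o (\1_A : X -> R)) by exact: integrable_indicator.
have iB : m2.-integrable setT (EFin \o (\1_B : Y -> R)) by exact: integrable_indicator.
have mA1 : measurable_fun setT (\1_A : X -> R) by exact: measurable_indic.
have mB1 : measurable_fun setT (\1_B : Y -> R) by exact: measurable_indic.
have fBE : m2 B = (fine (m2 B))%:E by rewrite fineK// ge0_fin_numE.
set b := fine (m2 B) in fBE; have b0 : 0 <= b by rewrite fine_ge0.
(* The added 1 keeps the denominator positive when [B] is null; the same device serves for [c]
   below. *)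
have d0 : 0 < e / 2 / (b + 1) by rewrite !divr_gt0// ltr_wpDl.
have [phi Cphi Aphi] := dense1 iA d0; have mphi := mC1 Cphi.
have nphi : ((\int[m1]_x (`|phi x|)%:E) < +oo)%E by have /integrableP[] := IC1 Cphi.
have nphi0 : (0 <= \int[m1]_x (`|phi x|)%:E)%E by apply: integral_ge0 => x _; rewrite lee_fin.
have nphiE : (\int[m1]_x (`|phi x|)%:E = (fine (\int[m1]_x (`|phi x|)%:E))%:E)%E.
  by rewrite fineK// ge0_fin_numE.
set c := fine _ in nphiE; have c0 : 0 <= c by rewrite fine_ge0.
have d'0 : 0 < e / 2 / (c + 1) by rewrite !divr_gt0// ltr_wpDl.
have [psi Cpsi Bpsi] := dense2 iB d'0; have mpsi := mC2 Cpsi.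
exists (fun p => phi p.1 * psi p.2); first exact: C12.
have mN1 : measurable_fun setT (fun x => `|\1_A x - phi x| : R).
  by apply: measurableT_comp => //; exact: measurable_funB.
have mN2 : measurable_fun setT (fun y => `|\1_B y - psi y| : R).
  by apply: measurableT_comp => //; exact: measurable_funB.
have mP : measurable_fun setT (fun x => `|phi x|) by exact: measurableT_comp.
apply: (@le_trans _ _ (\int[mu]_p ((`|\1_A p.1 - phi p.1| * \1_B p.2)%:E +
    (`|phi p.1| * `|\1_B p.2 - psi p.2|)%:E))%E).
  apply: ge0_le_lower_integral => p _; first by rewrite lee_fin.
  rewrite -EFinD lee_fin (_ : _ * _ - _ = (\1_A p.1 - phi p.1) * \1_B p.2 +
    phi p.1 * (\1_B p.2 - psi p.2)); last by ring.
  rewrite (le_trans (ler_normD _ _))// !normrM.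
  by rewrite (ger0_norm (_ : 0 <= \1_B p.2))// indicE ler0n.
rewrite ge0_integralD//; last 2 first.
- apply/measurable_EFinP; apply: measurable_funM.
    exact: measurableT_comp mN1 measurable_fst.
  exact: measurableT_comp mB1 measurable_snd.
- apply/measurable_EFinP; apply: measurable_funM.
    exact: measurableT_comp mP measurable_fst.
  exact: measurableT_comp mN2 measurable_snd.
rewrite (tensor_norm mN1 mB1)//.
rewrite (tensor_norm mP mN2)// nphiE (_ : (\int[m2]_y (\1_B y : R)%:E)%E = b%:E); last first.
  by rewrite integral_indic// setIT.
have -> : (e%:E = (e / 2 / (b + 1))%:E * (b + 1)%:E + (c + 1)%:E * (e / 2 / (c + 1))%:E)%E.
  rewrite -!EFinM -EFinD; congr EFin; field.
  by rewrite !gt_eqF// ltr_wpDl.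
apply: leeD.
  apply: lee_pmul => //; rewrite ?lee_fin//; last by rewrite lerDl.
  by apply: integral_ge0 => x _; rewrite lee_fin.
apply: lee_pmul => //; rewrite ?lee_fin//; last by rewrite lerDl.
by apply: integral_ge0 => x _; rewrite lee_fin.
Qed.

(** Dynkin's pi-lambda argument with rectangles as the pi-system. Intersecting with a box of finite
    measure keeps all indicators integrable, so that complements and disjoint unions can be
    handled. *)
Let box_approx (A : set X) (B : set Y) (S : set (X * Y)) : measurable A -> measurable B ->
  (m1 A < +oo)%E -> (m2 B < +oo)%E -> measurable S ->
  L1_approx mu C (\1_(S `&` (A `*` B))).
Proof.
move=> mA mB fA fB mS.
have rect (A' : set X) (B' : set Y) : measurable A' -> measurable B' ->
    (m1 A' < +oo)%E -> (m2 B' < +oo)%E -> L1_approx mu C (\1_(A' `*` B') : X * Y -> R).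
  move=> mA' mB' fA' fB'.
  rewrite (_ : \1_(A' `*` B') = (fun p => \1_A' p.1 * \1_B' p.2)); first exact: rectangle_approx.
  apply/funext => -[x y]; rewrite !indicE /= -natrM mulnb; congr (_%:R).
  by congr nat_of_bool; apply/idP/idP; rewrite ?inE; [move=> [a b]; apply/andP; split; exact/mem_set|move=> /andP[/set_mem ? /set_mem ?]].
have mAB : measurable (A `*` B) by exact: measurableX.
have mI (S' : set (X * Y)) : measurable S' -> measurable_fun setT (\1_S' : X * Y -> R).
  by move=> mS'; exact: measurable_indic.
move: mS; rewrite measurable_prod_measurableType; move: S.
pose Q (S : set (X * Y)) : Prop := L1_approx mu C (\1_(S `&` (A `*` B))).
pose rects := [set A' `*` B' | A' in @measurable _ X & B' in @measurable _ Y].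
apply: (@dynkin_induction _ (X * Y)%type rects Q); rewrite /Q.
- by rewrite measurable_prod_measurableType.
- move=> _ _ [A1 mA1 [B1 mB1 <-]] [A2 mA2 [B2 mB2 <-]].
  exists (A1 `&` A2); first exact: measurableI.
  exists (B1 `&` B2); first exact: measurableI.
  by rewrite setXI.
- by rewrite setTI; exact: rect.
- move=> _ [A1 mA1 [B1 mB1 <-]]; rewrite -setXI; apply: rect.
  + exact: measurableI.
  + exact: measurableI.
  + by apply: le_lt_trans fA; apply: le_measure; rewrite ?inE//; (exact: measurableI || exact: subIsetr).
  + by apply: le_lt_trans fB; apply: le_measure; rewrite ?inE//; (exact: measurableI || exact: subIsetr).
- move=> S mS aS.
  rewrite (_ : \1_(~` S `&` (A `*` B)) = (fun p => \1_(A `*` B) p + (-1) * \1_(S `&` (A `*` B)) p)).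
    apply: (@L1_approxD _ _ _ mu C mC CD (\1_(A `*` B)) (fun p => (-1) * \1_(S `&` (A `*` B)) p)).
    - exact: mI.
    - by apply: measurable_funM; [exact: measurable_cst|apply: mI; exact: measurableI].
    - exact: rect.
    - by apply: (L1_approxZ mC CZ) => //; apply: mI; exact: measurableI.
  apply/funext => p; rewrite !indicE !in_setI in_setC.
  by case: (p \in S); case: (p \in A `*` B); rewrite /= ?mulr0n ?mulr1n; ring.
move=> F mF tF aF.
(* For a disjoint union the partial sums of indicators are dominated by the indicator of the box. *)
apply: (@L1_approx_dominated _ _ _ mu C mC
  (fun n p => \sum_(i < n) \1_(F i `&` (A `*` B)) p) _ (\1_(A `*` B))).
- by apply: mI; apply: measurableI => //; exact: bigcup_measurable.
- apply: integrable_indicator => //.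
  have fAB : ((m1 \x m2)%E (A `*` B) < +oo)%E.
    by rewrite product_measure1E// lte_mul_pinfty// ge0_fin_numE.
  exact: fAB.
- by move=> n; apply: measurable_sum => i; apply: mI; exact: measurableI.
- move=> n; rewrite (_ : (fun p => _) = (fun p => \sum_(i <- index_enum 'I_n) \1_(F i `&` (A `*` B)) p))//.
  apply: (L1_approx_sum mC C0 CD _ (f := fun (i : 'I_n) p => \1_(F i `&` (A `*` B)) p)) => i //.
  by apply: mI; exact: measurableI.
- move=> p; have [[k _ Fk]|nF] := pselect ((\bigcup_k F k) p); last first.
    rewrite (_ : (fun n => _) = (fun=> 0)); last first.
      apply/funext => n; apply: big1 => i _; rewrite indicE memNset// => -[Fi _].
      by apply: nF; exists (i : nat).
    by rewrite indicE memNset => [|[/nF]//]; exact: cvg_cst.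
  have Up : p \in \bigcup_k F k by apply/mem_set; exists k.
  have E n : (k < n)%N -> \sum_(i < n) (\1_(F i `&` (A `*` B)) p : R) = \1_(\bigcup_k F k `&` (A `*` B)) p.
    move=> kn; rewrite (bigD1 (Ordinal kn))//= big1 ?addr0.
      by rewrite !indicE !in_setI (mem_set Fk) Up.
    move=> i ik; rewrite indicE memNset// => -[Fi _]; move/eqP: ik; apply.
    apply/val_inj => /=; apply: (tF i k) => //; exists p; split => //.
  apply: cvg_near_cst; exists k.+1 => // n /= kn; exact: E.
- move=> n p; rewrite ger0_norm; last by apply: sumr_ge0 => i _; rewrite indicE.
  have [[i Fi]|nF] := pselect (exists i : 'I_n, F i p).
    rewrite (bigD1 i)//= big1 ?addr0.
      by rewrite !indicE ler_nat in_setI; case: (p \in A `*` B); rewrite ?andbF ?andbT ?leq_b1.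
    move=> j ji; rewrite indicE memNset// => -[Fj _]; move/eqP: ji; apply.
    by apply/val_inj => /=; apply: (tF j i) => //; exists p; split.
  rewrite big1 ?indicE// => i _; rewrite indicE memNset// => -[Fi _].
  by apply: nF; exists i.
Qed.

(** Simple approximants of f, cut off to an exhausting sequence of boxes, are finite combinations of
    the sets treated by [box_approx] and are dominated by |f|. *)
Lemma L1_approx_product (A : nat -> set X) (B : nat -> set Y) (f : X * Y -> R) :
  (forall n, measurable (A n) /\ (m1 (A n) < +oo)%E) ->
  (forall n, measurable (B n) /\ (m2 (B n) < +oo)%E) ->
  (forall x, \forall n \near \oo, A n x) -> (forall y, \forall n \near \oo, B n y) ->
  mu.-integrable setT (EFin \o f) -> L1_approx mu C f.
Proof.
move=> mA mB nA nB If; have /integrableP[/measurable_EFinP mf _] := If.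
have [q [sq bq cq]] := simple_approx mf.
have mbox n : measurable (A n `*` B n) by apply: measurableX; [exact: (mA n).1|exact: (mB n).1].
have mq n : measurable_fun setT (q n) by exact: simple_map_measurable.
have mI n : measurable_fun setT (\1_(A n `*` B n) : X * Y -> R) by exact: measurable_indic.
apply: (@L1_approx_dominated _ _ _ mu C mC (fun n p => q n p * \1_(A n `*` B n) p) f
  (fun p => `|f p|)) => //.
- exact: integrable_norm.
- by move=> n; exact: measurable_funM.
- move=> n; have [/finite_seqP[l0 rl0] mqv] := sq n.
  pose g v p : R := v * \1_(q n @^-1` [set v] `&` (A n `*` B n)) p.
  rewrite (_ : (fun p => _) = (fun p => \sum_(v <- undup l0) g v p)).
    apply: (L1_approx_sum mC C0 CD) => v.
      by apply: measurable_funM; [exact: measurable_cst|apply: measurable_indic; exact: measurableI].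
    apply: (L1_approxZ mC CZ); first by apply: measurable_indic; exact: measurableI.
    by apply: box_approx => //; first [exact: (mA n).1|exact: (mB n).1|exact: (mA n).2|exact: (mB n).2].
  apply/funext => p; have ql : q n p \in undup l0.
    by rewrite mem_undup; have : range (q n) (q n p) by [exists p]; rewrite rl0.
  rewrite (bigD1_seq (q n p)) ?undup_uniq//= big1 ?addr0 /g.
    by rewrite !indicE in_setI [in RHS]mem_set.
  by move=> v vq; rewrite indicE memNset ?mulr0// => -[/= qv _]; rewrite qv eqxx in vq.
- move=> p; rewrite -[X in _ --> X]mulr1; apply: cvgM; first exact: cq.
  apply: cvg_near_cst; near=> n; rewrite indicE mem_set//; split => /=.
    by near: n; exact: nA.
  by near: n; exact: nB.
- move=> n p; rewrite normrM (le_trans _ (bq n p))// ler_piMr//.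
  by rewrite indicE; case: (p \in _); rewrite ?normr1 ?normr0.
Unshelve. all: by end_near.
Qed.

End L1_approximation_product.

Section boxed_functions.
Context {R : realType}.

(** Compact support expressed by an exhaustion [K]; for increasing [K] this is visibly stable under
    sums and tensor products. *)
Definition boxed (V : topologicalType) (K : nat -> set V) : set (V -> R) :=
  [set phi | continuous phi /\ exists n, forall x, ~ K n x -> phi x = 0].

Lemma boxed0 (V : topologicalType) (K : nat -> set V) : boxed K (fun=> 0).
Proof. by split; [move=> x; exact: cvg_cst|exists 0%N]. Qed.

Lemma boxedD (V : topologicalType) (K : nat -> set V) phi psi :
  {homo K : m n / (m <= n)%N >-> m `<=` n} ->
  boxed K phi -> boxed K psi -> boxed K (fun x => phi x + psi x).
Proof.
move=> Kmn [cphi [n phi0]] [cpsi [m psi0]]; split.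
  by move=> x; apply: cvgD; [exact: cphi|exact: cpsi].
exists (maxn n m) => x nKx; rewrite phi0 ?psi0 ?addr0// => Kx; apply: nKx.
  by apply: Kmn Kx; exact: leq_maxr.
by apply: Kmn Kx; exact: leq_maxl.
Qed.

Lemma boxedZ (V : topologicalType) (K : nat -> set V) (c : R) phi :
  boxed K phi -> boxed K (fun x => c * phi x).
Proof.
move=> [cphi [n phi0]]; split; last by exists n => x /phi0 ->; rewrite mulr0.
by move=> x; apply: cvgMr; exact: cphi.
Qed.

Lemma boxedM (V W : topologicalType) (K : nat -> set V) (L : nat -> set W) phi psi :
  {homo K : m n / (m <= n)%N >-> m `<=` n} -> {homo L : m n / (m <= n)%N >-> m `<=` n} ->
  boxed K phi -> boxed L psi ->
  boxed (fun n => K n `*` L n) (fun p : V * W => phi p.1 * psi p.2).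
Proof.
move=> Kmn Lmn [cphi [n phi0]] [cpsi [m psi0]]; split.
  move=> p; apply: cvgM.
    by apply: (cvg_comp _ phi); [exact: cvg_fst|exact: cphi].
  by apply: (cvg_comp _ psi); [exact: cvg_snd|exact: cpsi].
exists (maxn n m) => -[x y] /= nK; have [Kx|/phi0 ->] := pselect (K n x); last by rewrite mul0r.
rewrite psi0 ?mulr0// => Ly; apply: nK; split => /=.
  by apply: Kmn Kx; exact: leq_maxl.
by apply: Lmn Ly; exact: leq_maxr.
Qed.

                                                                     
                                             
(** The map [j] reads a point of the measurable type as a point of the topological space; it is the
    identity in all uses. A continuous function is bounded on a compact box of finite measure. *)
Lemma boxed_integrable d (T : measurableType d) (mu : {measure set T -> \bar R})
    (V : topologicalType) (K : nat -> set V) (j : T -> V) (phi : V -> R) :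
  approximable j -> (forall n, compact (K n)) ->
  (forall n, measurable (j @^-1` K n) /\ (mu (j @^-1` K n) < +oo)%E) ->
  boxed K phi -> mu.-integrable setT (EFin \o (fun x => phi (j x))).
Proof.
move=> aj cK mK [cphi [n phi0]].
have [M M0 phiM] : exists2 M : R, 0 <= M & forall x, K n x -> `|phi x| <= M.
  have /compact_bounded[M [_ HM]] : compact (phi @` K n : set R^o).
    by apply: continuous_compact => //; exact: continuous_subspaceT.
  exists (Num.max 0 (M + 1)); first by rewrite le_max lexx.
  move=> x Kx; apply: HM; last by exists x.
  by rewrite lt_max ltrDl ltr01 orbT.
have mphi : measurable_fun setT (fun x => phi (j x)) by exact: measurable_cont_comp.
apply: (@le_integrable _ _ _ mu setT measurableT _
  (EFin \o (fun x => M * \1_(j @^-1` K n) x))).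
- exact/measurable_EFinP.
- move=> x _ /=; rewrite lee_fin.
  have [Kx|/phi0 ->] := pselect (K n (j x)); last by rewrite normr0 normr_ge0.
  by rewrite indicE mem_set// mulr1 (le_trans (phiM _ Kx))// ler_norm.
have := integrableZl measurableT M (integrable_indicator (mK n).1 (mK n).2).
by apply: eq_integrable => // x _; rewrite /= EFinM.
Qed.

End boxed_functions.

Section density.
Variable R : realType.
Local Notation R1 := (measurableTypeR R).
Local Notation C := R[i].

Definition box1 (n : nat) : set R := `[- n%:R, n%:R].
Definition box2 (n : nat) : set (R * R) := box1 n `*` box1 n.
Definition box3 (n : nat) : set (R * R * R) := box2 n `*` box1 n.

Lemma box1_homo : {homo box1 : m n / (m <= n)%N >-> m `<=` n}.
Proof.
move=> m n mn x; rewrite /box1 /= !in_itv /= => /andP[h1 h2].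
have := mn; rewrite -(ler_nat R) => mn'.
by rewrite (le_trans h2)// andbT (le_trans _ h1)// lerN2.
Qed.

Lemma box2_homo : {homo box2 : m n / (m <= n)%N >-> m `<=` n}.
Proof. by move=> m n mn [x y] [/= h1 h2]; split; exact: box1_homo mn _ _. Qed.

Lemma box3_homo : {homo box3 : m n / (m <= n)%N >-> m `<=` n}.
Proof.
by move=> m n mn [x y] [/= h1 h2]; split; [exact: box2_homo mn _ _|exact: box1_homo mn _ _].
Qed.

Lemma box1_compact n : compact (box1 n). Proof. exact: segment_compact. Qed.

Lemma box2_compact n : compact (box2 n).
Proof. by apply: compact_setX; exact: box1_compact. Qed.

Lemma box3_compact n : compact (box3 n).
Proof. by apply: compact_setX; [exact: box2_compact|exact: box1_compact]. Qed.

Lemma box1_finite n : measurable (box1 n : set R1) /\ (leb1 R (box1 n) < +oo)%E.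
Proof.
split; first exact: measurable_itv.
have : (@lebesgue_measure R [set` `[- n%:R, n%:R]%R] < +oo)%E.
  by rewrite lebesgue_measure_itv /=; case: ifP => _; rewrite -?EFinB ltry.
exact.
Qed.

Lemma box2_finite n : measurable (box2 n : set (R1 * R1)) /\ (leb2 R (box2 n) < +oo)%E.
Proof.
have [m1 f1] := box1_finite n; split; first exact: measurableX.
have : ((sleb1 R \x sleb1 R)%E (box1 n `*` box1 n : set (R1 * R1)) < +oo)%E.
  by rewrite product_measure1E// lte_mul_pinfty// ge0_fin_numE.
exact.
Qed.

Lemma box3_finite n : measurable (box3 n : set (R1 * R1 * R1)) /\ (leb3 R (box3 n) < +oo)%E.
Proof.
have [m1 f1] := box1_finite n; have [m2 f2] := box2_finite n.
split; first exact: measurableX.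
have : ((sleb2 R \x sleb1 R)%E (box2 n `*` box1 n : set (R1 * R1 * R1)) < +oo)%E.
  by rewrite product_measure1E// lte_mul_pinfty// ge0_fin_numE.
exact.
Qed.

Lemma box1_near x : \forall n \near \oo, box1 n x.
Proof.
near=> n; rewrite /box1 /= in_itv /= -ler_norml.
have xn : (Num.truncn `|x| < n)%N by near: n; exact: nbhs_infty_gt.
by rewrite ltW// (lt_le_trans (truncnS_gt _))// ler_nat.
Unshelve. all: by end_near.
Qed.

Lemma box2_near x : \forall n \near \oo, box2 n x.
Proof. by apply: filterS2 (box1_near x.1) (box1_near x.2) => n. Qed.

Lemma approximable_id1 : approximable (fun x : R1 => x : R).
Proof. exact: approximable_real. Qed.

Lemma approximable_id2 : approximable (fun x : R1 * R1 => x : R * R).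
Proof.
have := approximable_pair (approximable_real (@measurable_fst _ _ R1 R1))
  (approximable_real (@measurable_snd _ _ R1 R1)).
by under eq_fun do rewrite -surjective_pairing.
Qed.

Lemma approximable_id3 : approximable (fun x : R1 * R1 * R1 => x : R * R * R).
Proof.
have m1 := @measurable_fst _ _ (R1 * R1)%type R1.
have := approximable_pair (approximable_pair
  (approximable_real (measurableT_comp (@measurable_fst _ _ R1 R1) m1))
  (approximable_real (measurableT_comp (@measurable_snd _ _ R1 R1) m1)))
  (approximable_real (@measurable_snd _ _ (R1 * R1)%type R1)).
by congr approximable; apply/funext => -[[x y] t].
Qed.

Let integrable1 phi : boxed box1 phi -> (sleb1 R).-integrable setT (EFin \o (phi : R1 -> R)).
Proof. exact: (boxed_integrable approximable_id1 box1_compact box1_finite). Qed.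

Let integrable2 phi : boxed box2 phi ->
  (sleb2 R).-integrable setT (EFin \o (phi : R1 * R1 -> R)).
Proof. exact: (boxed_integrable approximable_id2 box2_compact box2_finite). Qed.

Let integrable3 phi : boxed box3 phi ->
  (sleb3 R).-integrable setT (EFin \o (phi : R1 * R1 * R1 -> R)).
Proof. exact: (boxed_integrable approximable_id3 box3_compact box3_finite). Qed.

Let measurable1 phi : boxed box1 phi -> measurable_fun setT (phi : R1 -> R).
Proof. by move=> /integrable1 /integrableP[/measurable_EFinP]. Qed.

Let measurable2 phi : boxed box2 phi -> measurable_fun setT (phi : R1 * R1 -> R).
Proof. by move=> /integrable2 /integrableP[/measurable_EFinP]. Qed.

Let measurable3 phi : boxed box3 phi -> measurable_fun setT (phi : R1 * R1 * R1 -> R).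
Proof. by move=> /integrable3 /integrableP[/measurable_EFinP]. Qed.

(** Truncations of f to [-n, n] tend to f under domination. Each truncation is approximated by
    continuous functions on a slightly larger interval, and these are then cut off. *)
Lemma L1_approx1 (f : R1 -> R) : (sleb1 R).-integrable setT (EFin \o f) ->
  L1_approx (sleb1 R) (boxed box1) f.
Proof.
move=> If; have /integrableP[/measurable_EFinP mf _] := If.
have mI n : measurable_fun setT (\1_(box1 n) : R1 -> R).
  by apply: measurable_indic; exact: (box1_finite n).1.
have g_le n x : `|f x * \1_(box1 n) x| <= `|f x|.
  by rewrite normrM ler_piMr// indicE; case: (x \in _); rewrite ?normr1 ?normr0.
apply: (@L1_approx_dominated _ _ _ (sleb1 R) (boxed box1) measurable1
  (fun n x => f x * \1_(box1 n) x) f (fun x => `|f x|)) => //.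
- exact: integrable_norm.
- by move=> n; exact: measurable_funM.
- move=> n e e0.
  have [mE fE] := box1_finite n.+1.
  have Ig : (@lebesgue_measure R).-integrable (box1 n.+1) (EFin \o (fun x => f x * \1_(box1 n) x)).
    apply: (integrableS measurableT) => //.
    apply: (@le_integrable _ _ _ _ setT measurableT _ (EFin \o f)) => //.
      by apply/measurable_EFinP; exact: measurable_funM.
    by move=> x _; rewrite /= lee_fin.
  have [g [cg _ +]] := @approximation_continuous_integrable R (box1 n.+1) (fun x => f x * \1_(box1 n) x) mE fE Ig.
  move=> /fine_cvgP[fin /cvgrPdist_lt/(_ _ e0) H].
  have : \forall k \near \oo, (\int[@lebesgue_measure R]_(x in box1 n.+1)
      `|((f x * \1_(box1 n) x) - g k x)%:E| <= e%:E)%E.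
    near=> k; have fn : (\int[@lebesgue_measure R]_(x in box1 n.+1)
      `|((f x * \1_(box1 n) x) - g k x)%:E|)%E \is a fin_num by near: k.
    have : `|0 - fine (\int[@lebesgue_measure R]_(x in box1 n.+1)
      `|((f x * \1_(box1 n) x) - g k x)%:E|)%E| < e by near: k.
    rewrite sub0r normrN ger0_norm; last by rewrite fine_ge0// integral_ge0.
    by rewrite -(fineK fn) lee_fin => /ltW.
  move=> [k _ /(_ k (leqnn _)) gk].
  (* Trapezoidal cutoff, 1 on [-n, n] and 0 outside [-n-1, n+1]. It fixes the truncated f, so
     multiplying by it does not increase the error. *)
  pose chi (x : R) : R := Num.max 0 (Num.min 1 (n.+1%:R - `|x|)).
  have chi0 x : 0 <= chi x by rewrite le_max lexx.
  have chi1 x : chi x <= 1 by rewrite ge_max ler01 ge_min lexx.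
  have chi_in x : box1 n x -> chi x = 1.
    rewrite /box1 /= in_itv /= -ler_norml => xn.
    have h : 1 <= n.+1%:R - `|x| by rewrite -natr1; lra.
    by rewrite /chi (min_idPl h) (max_idPr ler01).
  have chi_out x : ~ box1 n.+1 x -> chi x = 0.
    rewrite /box1 /= in_itv /= -ler_norml => /negP; rewrite -ltNge => xn.
    have h : n.+1%:R - `|x| <= 0 by lra.
    by rewrite /chi (max_idPl _)// ge_min h orbT.
  have cchi : continuous chi.
    move=> x.
    have c0 (a : R) : {for x, continuous (fun=> a : R^o)} by exact: cvg_cst.
    have c1 : {for x, continuous (fun y : R => n.+1%:R - `|y| : R^o)}.
      by apply: cvgB; [exact: cvg_cst|exact: norm_continuous].
    exact: continuous_max (c0 0) (continuous_min (c0 1) c1).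
  exists (fun x => g k x * chi x).
    split; first by move=> x; apply: cvgM; [exact: cg|exact: cchi].
    by exists n.+1 => x /chi_out ->; rewrite mulr0.
  apply: le_trans gk; rewrite [leRHS]integral_mkcond.
  apply: ge0_le_lower_integral => x _; first by rewrite lee_fin.
  rewrite patchE; case: ifPn => [_|/negP xE].
    have -> : f x * \1_(box1 n) x = f x * \1_(box1 n) x * chi x.
      rewrite indicE; have [/set_mem/chi_in ->|_] := boolP (x \in box1 n); first by rewrite mulr1.
      by rewrite mulr0 mul0r.
    rewrite lee_fin -mulrBl normrM (ger0_norm (chi0 x)).
    by rewrite indicE; have [/set_mem/chi_in ->|_] := boolP (x \in box1 n);
      rewrite ?mulr1// mulr0 mul0r ler_piMr.
  have nx : ~ box1 n.+1 x by move=> /mem_set.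
  rewrite chi_out// mulr0 subr0 indicE memNset ?mulr0 ?normr0// => h.
  by apply: nx; apply: box1_homo h.
- move=> x; rewrite -[X in _ --> X]mulr1; apply: cvgMr.
  apply: cvg_near_cst; near=> n; rewrite indicE mem_set//.
  by near: n; exact: box1_near.
Unshelve. all: by end_near.
Qed.

Lemma L1_approx2 (f : R1 * R1 -> R) : (sleb2 R).-integrable setT (EFin \o f) ->
  L1_approx (sleb2 R) (boxed box2) f.
Proof.
move=> If; have H := (@L1_approx_product _ _ R1 R1 R (sleb1 R) (sleb1 R) (boxed box1) (boxed box1)
  (boxed box2) integrable1 integrable1 measurable2 (boxed0 _) (fun u v => @boxedD _ _ _ u v box2_homo)
  (@boxedZ _ _ _) (fun u v => @boxedM R R R box1 box1 u v box1_homo box1_homo) L1_approx1 L1_approx1 box1 box1 f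
  box1_finite box1_finite box1_near box1_near If).
exact: H.
Qed.

Lemma L1_approx3 (f : R1 * R1 * R1 -> R) : (sleb3 R).-integrable setT (EFin \o f) ->
  L1_approx (sleb3 R) (boxed box3) f.
Proof.
move=> If; have H := (@L1_approx_product _ _ (R1 * R1)%type R1 R (sleb2 R) (sleb1 R) (boxed box2) (boxed box1)
  (boxed box3) integrable2 integrable1 measurable3 (boxed0 _) (fun u v => @boxedD _ _ _ u v box3_homo)
  (@boxedZ _ _ _) (fun u v => @boxedM R (R * R)%type R box2 box1 u v box2_homo box1_homo) L1_approx2 L1_approx1 box2 box1 f
  box2_finite box1_finite box2_near box1_near If).
exact: H.
Qed.

Lemma Cc_boxed (phi psi : R * R * R -> R) : boxed box3 phi -> boxed box3 psi ->
  Cc (fun q : heis R => phi q +i* psi q).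
Proof.
move=> [cphi [n phi0]] [cpsi [m psi0]]; split; first by apply/cont_ReIm.
have cK : compact (box3 (maxn n m)) by exact: box3_compact.
have clK : closed (box3 (maxn n m)) by apply: compact_closed => //; exact: norm_hausdorff.
apply: (subclosed_compact (@closed_closure _ _) cK).
rewrite [X in _ `<=` X](closure_id _).1//; apply: closureS => q /=.
apply: contra_neqP => nq; apply: complex_ext => /=.
  by apply: phi0 => h; apply: nq; apply: box3_homo h; exact: leq_maxl.
by apply: psi0 => h; apply: nq; apply: box3_homo h; exact: leq_maxr.
Qed.

Lemma Cc_cintegrable (f : heis R -> C) : Cc f -> cintegrable (leb3 R) setT f.
Proof.
move=> [/cont_ReIm[c1 c2] cf].
have [M [_ HM]] := compact_bounded cf.
have [n nM] : exists n : nat, M + 1 <= n%:R.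
  by exists (Num.truncn (M + 1)).+1; rewrite ltW// truncnS_gt.
have f0 q : ~ box3 n q -> f q = 0.
  move=> nq; apply/eqP; apply: contra_notT nq => fq.
  have : `|(q : R * R * R)| <= M + 1.
    by apply: HM; [rewrite ltrDl|exact: subset_closure].
  rewrite prod_normE ge_max prod_normE /= ge_max => /andP[/andP[h1 h2] h3].
  split; last by rewrite /box1 /= in_itv /= -ler_norml (le_trans h3).
  by split; rewrite /box1 /= in_itv /= -ler_norml; [rewrite (le_trans h1)|rewrite (le_trans h2)].
split.
  by apply: integrable3; split => //; exists n => q /f0 ->.
by apply: integrable3; split => //; exists n => q /f0 ->.
Qed.

Lemma Cc_dense (f : heis R -> C) : cintegrable (leb3 R) setT f ->
  exists2 fk : nat -> heis R -> C, forall k, Cc (fk k) &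
    (fun k => L1dist (leb3 R) setT (fk k) f) @ \oo --> (0 : \bar R)%E.
Proof.
move=> If; have [[m1 m2] _] := (cintegrableP _ _ measurableT).1 If.
have H (k : nat) : exists g, Cc g /\ (L1dist (leb3 R) setT g f <= (k.+1%:R^-1)%:E)%E.
  have e0 : (0 : R) < k.+1%:R^-1 / 2 by rewrite divr_gt0.
  have [phi Bphi phiE] := L1_approx3 If.1 e0.
  have [psi Bpsi psiE] := L1_approx3 If.2 e0.
  exists (fun q => phi q +i* psi q); split; first exact: Cc_boxed.
  apply: (@le_trans _ _ (\int[leb3 R]_q ((`|Re (f q) - phi q|)%:E + (`|Im (f q) - psi q|)%:E))%E).
    apply: ge0_le_lower_integral => q _; first by rewrite lee_fin cmod_ge0.
    by rewrite cmodB -EFinD lee_fin (le_trans (cmod_le_ReIm _))// ReB ImB.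
  have mabs (u v : R1 * R1 * R1 -> R) : measurable_fun setT u -> measurable_fun setT v ->
      measurable_fun setT (fun q => (`|u q - v q|)%:E).
    move=> mu_ mv; apply/measurable_EFinP; apply: measurableT_comp => //.
    exact: measurable_funB.
  rewrite ge0_integralD//; last 2 first.
  - by apply: mabs => //; exact: measurable3.
  - by apply: mabs => //; exact: measurable3.
  have -> : ((k.+1%:R^-1 : R)%:E = (k.+1%:R^-1 / 2)%:E + (k.+1%:R^-1 / 2)%:E)%E.
    by rewrite -EFinD -splitr.
  exact: leeD phiE psiE.
have [fk fkE] := choice H; exists fk => [k|]; first exact: (fkE k).1.
apply: (@squeeze_cvge _ _ _ _ (fun=> 0%E) _ (fun k => ((k.+1%:R^-1 : R)%:E))).
- apply: nearW => k; rewrite (fkE k).2 andbT.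
  by apply: integral_ge0 => q _; rewrite lee_fin cmod_ge0.
- exact: cvg_cst.
- by apply: cvg_EFin; [exact: nearW|exact: cvg_harmonic].
Qed.

End density.

                                                         

(** * Existence and almost-everywhere uniqueness of the geodesic transform *)

Section geodesic_transform.
Variable R : realType.
Local Notation C := R[i].
Local Notation R1 := (measurableTypeR R).
Local Notation R3 := (R1 * R1 * R1)%type.
Variables (eps lam : R).
Hypothesis lam0 : 0 < lam.
Local Notation L := (2 * pi / lam).
Local Notation quot := (quot_dom eps lam : set R3).

Let mquot : measurable quot. Proof. exact: measurable_quot_dom. Qed.

Lemma geo_int_L1dist_le (f g : R3 -> C) :
  cintegrable (leb3 R) setT f -> cintegrable (leb3 R) setT g ->
  (L1dist (leb3 R) quot (geo_int eps lam f) (geo_int eps lam g) <=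
   2%:E * (L%:E * L1dist (leb3 R) setT f g))%E.
Proof.
move=> If Ig; have Ifg := cintegrableB measurableT If Ig.
have [mfg _] := (cintegrableP _ _ measurableT).1 Ifg.
apply: le_trans (geo_int_L1_le eps lam0 mfg).
have mI h : cintegrable (leb3 R) setT h -> cmeasurable quot (geo_int eps lam h).
  by move=> Ih; have [] := (cintegrableP _ _ mquot).1 (cintegrable_geo_int eps lam0 Ih).
rewrite le_eqVlt; apply/orP; left; apply/eqP; rewrite /L1dist.
apply: ae_eq_integral => //.
- apply/measurable_EFinP; apply: measurable_cmod.
  by apply: cmeasurableB; exact: mI.
- by apply/measurable_EFinP; apply: measurable_cmod; exact: mI.
by apply: filterS (geo_intB_ae eps lam0 If Ig) => q + Dq => /(_ Dq) ->.
Qed.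

(** Approximate f in L1 by functions in Cc; the L1 bound carries the approximation over to the
    orbital integrals. *)
Lemma geo_int_transform (f : R3 -> C) : cintegrable (leb3 R) setT f ->
  is_geo_transform eps lam f (geo_int eps lam f).
Proof.
move=> If; have [mf _] := (cintegrableP _ _ measurableT).1 If.
split.
  by split; [exact: geo_int_invariant|exact: cintegrable_geo_int].
have [fk Ck cfk] := Cc_dense If; exists fk; split => //.
have Ik k := Cc_cintegrable (Ck k).
apply: (@squeeze_cvge _ _ _ _ (fun=> 0%E) _
  (fun k => 2%:E * (L%:E * L1dist (leb3 R) setT (fk k) f))%E).
- apply: nearW => k; rewrite (geo_int_L1dist_le (Ik k) If) andbT.
  by apply: integral_ge0 => q _; rewrite lee_fin cmod_ge0.
- exact: cvg_cst.
- rewrite -[X in _ --> X](mule0 2%:E); apply: cvgeZl => //.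
  by rewrite -[X in _ --> X](mule0 L%:E); exact: cvgeZl.
Qed.

Lemma L1dist_triangle (D : set R3) (f g h : R3 -> C) : measurable D -> cmeasurable D f ->
  cmeasurable D g -> cmeasurable D h ->
  (L1dist (leb3 R) D f h <= L1dist (leb3 R) D g f + L1dist (leb3 R) D g h)%E.
Proof.
move=> mD mf mg mh.
rewrite /L1dist -ge0_integralD//; last 4 first.
- by move=> x _; rewrite lee_fin cmod_ge0.
- by apply/measurable_EFinP; apply: measurable_cmod; exact: cmeasurableB.
- by move=> x _; rewrite lee_fin cmod_ge0.
- by apply/measurable_EFinP; apply: measurable_cmod; exact: cmeasurableB.
apply: ge0_le_lower_integral => q _; first by rewrite lee_fin cmod_ge0.
rewrite -EFinD lee_fin (cmodB (g q)).
by rewrite (_ : f q - h q = (f q - g q) + (g q - h q)) ?cmodD//; ring.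
Qed.

(** Both g and the orbital integral of f are L1 limits of the same sequence of orbital integrals, so
    their L1 distance is 0. *)
Lemma is_geo_transform_ae (f g : R3 -> C) : cintegrable (leb3 R) setT f ->
  is_geo_transform eps lam f g -> ae_eq (leb3 R) quot g (geo_int eps lam f).
Proof.
move=> If [[_ Ig] [fk [Ck cfk cgk]]].
have Ik k := Cc_cintegrable (Ck k).
have mI h : cintegrable (leb3 R) setT h -> cmeasurable quot (geo_int eps lam h).
  by move=> Ih; have [] := (cintegrableP _ _ mquot).1 (cintegrable_geo_int eps lam0 Ih).
have [mg _] := (cintegrableP _ _ mquot).1 Ig.
have H : ae_eq (leb3 R) quot (fun q => g q - geo_int eps lam f q) (fun=> 0).
  apply: cmeasurable_ae_eq0 => //; first by apply: cmeasurableB => //; exact: mI.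
  apply/eqP; rewrite eq_le; apply/andP; split; last first.
    by apply: integral_ge0 => q _; rewrite lee_fin cmod_ge0.
  have cv : (fun k => L1dist (leb3 R) quot (geo_int eps lam (fk k)) g +
      2%:E * (L%:E * L1dist (leb3 R) setT (fk k) f))%E @ \oo --> (0 : \bar R)%E.
    rewrite -[X in _ --> X](adde0 0%E); apply: cvgeD => //.
    rewrite -[X in _ --> X](mule0 2%:E); apply: cvgeZl => //.
    by rewrite -[X in _ --> X](mule0 L%:E); exact: cvgeZl.
  rewrite -(cvg_lim (@ereal_hausdorff _) cv); apply: lime_ge; first by apply/cvg_ex; exists 0%E.
  apply: nearW => k.
  apply: (le_trans (L1dist_triangle mquot mg (mI _ (Ik k)) (mI _ If))).
  by apply: leeD => //; exact: geo_int_L1dist_le.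
by apply: filterS H => q + Dq => /(_ Dq) /eqP; rewrite subr_eq0 => /eqP.
Qed.

Lemma geo_transformP (f : R3 -> C) : cintegrable (leb3 R) setT f ->
  is_geo_transform eps lam f (geo_transform eps lam f).
Proof.
move=> If; apply: (@xgetPex _ (fun=> 0 : C) [set g | is_geo_transform eps lam f g]).
by exists (geo_int eps lam f); exact: geo_int_transform.
Qed.

End geodesic_transform.

(** * Dilations, and Bochner integrals of beta *)

Section scaling.
Variable R : realType.
Local Notation C := R[i].
Local Notation leb := (@lebesgue_measure R).

Lemma cintegrable_bounded d (T : measurableType d) (mu : {measure set T -> \bar R})
    (D : set T) (f : T -> C) (M : R) : measurable D -> (mu D < +oo)%E ->
  cmeasurable D f -> (forall x, cmod (f x) <= M) -> cintegrable mu D f.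
Proof.
move=> mD fD mf fM; apply: (le_cintegrable mD mf (g := fun=> M)) => [|x _]; last exact: fM.
apply/integrableP; split; first exact: measurable_cst.
rewrite (eq_integral (cst `|M|%:E))// integral_cst//.
by rewrite lte_mul_pinfty// lee_fin.
Qed.

Lemma ge0_integral_dilation (k : {nonneg R}) (g : measurableTypeR R -> \bar R) :
  0 < k%:num -> measurable_fun setT g -> (forall x, 0 <= g x)%E ->
  (\int[leb]_x g x = k%:num%:E * \int[leb]_x g (k%:num * x)%R)%E.
Proof.
move=> k0 mg g0.
have mt : measurable_fun setT
    (fun x : measurableTypeR R => (k%:num * x)%R : measurableTypeR R).
  by apply: measurable_funM => //; exact: measurable_cst.
pose phi : {mfun measurableTypeR R >-> measurableTypeR R} :=
  HB.pack (fun x : measurableTypeR R => (k%:num * x)%R : measurableTypeR R)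
    (isMeasurableFun.Build _ _ _ _ _ mt).
(* Again uniqueness of Lebesgue measure: the scaled pushforward has the right value on half-open
   intervals. *)
have E A : measurable A -> leb A = mscale k (pushforward leb phi) A.
  apply: lebesgue_measure_unique => //= _ [[b c]] _ <-.
  have -> : mscale k (pushforward leb phi) [set` `]b, c]%R] =
      (k%:num%:E * leb [set` `]b / k%:num, c / k%:num]%R])%E.
    rewrite -(_ : phi @^-1` [set` `]b, c]%R] = [set` `]b / k%:num, c / k%:num]%R])//.
    by apply/seteqP; split => x /=; rewrite !in_itv/= ltr_pdivrMr// ler_pdivlMr// mulrC.
  rewrite !lebesgue_measure_itv/= !lte_fin ltr_pM2r ?invr_gt0//.
  case: ifP => _; last by rewrite mule0.
  by rewrite -!EFinB -EFinM; congr EFin; field; rewrite gt_eqF.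
rewrite [LHS](@eq_measure_integral _ _ _ _ (mscale k (pushforward leb phi))); last first.
  by move=> A mA _; exact: E.
rewrite ge0_integral_mscale// ge0_integral_pushforward//.
Qed.

Lemma cintegral_dilation (k : R) (g : measurableTypeR R -> C) : 0 < k ->
  cintegrable leb setT (fun x => g (k * x)) -> cmeasurable setT g ->
  cintegral leb setT g = k%:C * cintegral leb setT (fun x => g (k * x)).
Proof.
move=> k0 [I1 I2] [m1 m2].
have H (u : measurableTypeR R -> R) : measurable_fun setT u ->
    leb.-integrable setT (EFin \o (fun x => u (k * x))) ->
    Rintegral leb setT u = k * Rintegral leb setT (fun x => u (k * x)).
  move=> mu_ Iu; pose kn := NngNum (ltW k0).
  have mE : measurable_fun setT (EFin \o u) by exact/measurable_EFinP.
  have kn0 : 0 < kn%:num by [].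
  rewrite /Rintegral integralE.
  rewrite (ge0_integral_dilation kn0 (measurable_funepos mE))//.
  rewrite (ge0_integral_dilation kn0 (measurable_funeneg mE))//.
  rewrite [X in _ = _ * fine X]integralE.
  have fp := integrable_pos_fin_num measurableT Iu.
  have fn := integrable_neg_fin_num measurableT Iu.
  pose v : measurableTypeR R -> \bar R := EFin \o (fun x => u (k * x)).
  have -> : (\int[leb]_x ((EFin \o u)^\+ (kn%:num * x)%R) = \int[leb]_x v^\+ x)%E.
    by apply: eq_integral => x _; rewrite !funeposE.
  have -> : (\int[leb]_x ((EFin \o u)^\- (kn%:num * x)%R) = \int[leb]_x v^\- x)%E.
    by apply: eq_integral => x _; rewrite !funenegE.
  by rewrite -(fineK fp) -(fineK fn) -!EFinM -!EFinB /= mulrBr.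
rewrite /cintegral (H _ m1 I1) (H _ m2 I2).
by apply: complex_ext; rewrite !ReImE /=; ring.
Qed.

End scaling.

Section beta_integrals.
Variable R : realType.
Local Notation C := R[i].
Local Notation R1 := (measurableTypeR R).
Local Notation R3 := (R1 * R1 * R1)%type.

Lemma beta_le (h : R) (q : heis R) (F : C -> C) (zeta : C) : fock F ->
  cmod (beta h q F zeta) <= 2 * expR (cmod zeta ^+ 2 / 2) * fock_norm F.
Proof. by move=> fF; rewrite -(fock_norm_beta h q fF); apply: fock_eval_le; exact: fock_beta. Qed.

Section bochner_beta.
Context d (T : measurableType d) (mu : {sigma_finite_measure set T -> \bar R}) (D : set T).
Hypothesis mD : measurable D.
Variables (f : T -> C) (p : T -> R3) (h : R) (F : C -> C).
Hypothesis If : cintegrable mu D f.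
Hypothesis mp : measurable_fun setT p.
Hypothesis fF : fock F.

Let is_bochner_beta : is_bochner mu D (fun x zeta => f x * beta h (p x) F zeta)
  (fun zeta => cintegral mu D (fun x => f x * beta h (p x) F zeta)).
Proof.
have m1 := measurableT_comp (@measurable_fst _ _ (R1 * R1)%type R1) mp.
have ap : approximable (p : T -> R * R * R).
  have := approximable_pair (approximable_pair
    (approximable_real (measurableT_comp (@measurable_fst _ _ R1 R1) m1))
    (approximable_real (measurableT_comp (@measurable_snd _ _ R1 R1) m1)))
    (approximable_real (measurableT_comp (@measurable_snd _ _ (R1 * R1)%type R1) mp)).
  by congr approximable; apply/funext => x /=; case: (p x) => -[].
apply: (@bochner_exists _ T R mu D mD f p (fun v => beta h v F) (fock_norm F) If ap).
- by move=> v; exact: fock_beta.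
- by move=> v; exact: fock_norm_beta.
- by move=> v v0 zeta cv; exact: cvg_beta.
- apply: cmeasurable_beta => //; first exact: measurableT_comp mp measurable_fst.
  exact: (cmeasurable_comp (@cmeasurable_pt R) measurable_snd).
Qed.

Lemma cintegrable_beta zeta : cintegrable mu D (fun x => f x * beta h (p x) F zeta).
Proof.
have [mf If'] := (cintegrableP _ _ mD).1 If.
pose M := 2 * expR (cmod zeta ^+ 2 / 2) * fock_norm F.
have mb : cmeasurable D (fun x => beta h (p x) F zeta).
  by apply: cmeasurableT; apply: cmeasurable_beta => //; exact: cmeasurable_cst.
apply: (le_cintegrable mD (g := fun x => M * cmod (f x))).
- exact: cmeasurableM.
- apply: (eq_integrable mD (fun x => (M%:E * (cmod (f x))%:E)%E)) => //.
  apply: integrableZl => //; apply/integrableP; split.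
    by apply/measurable_EFinP; exact: measurable_cmod.
  by under eq_integral do rewrite /= (ger0_norm (cmod_ge0 _)).
- by move=> x _; rewrite cmodM mulrC ler_wpM2r ?cmod_ge0// beta_le.
Qed.

Lemma bochner_beta : bochner mu D (fun x zeta => f x * beta h (p x) F zeta) =
  (fun zeta => cintegral mu D (fun x => f x * beta h (p x) F zeta)).
Proof.
apply: bochnerE is_bochner_beta => // zeta.
by have [] := (cintegrableP _ _ mD).1 (cintegrable_beta zeta).
Qed.

Lemma fock_cintegral_beta :
  fock (fun zeta => cintegral mu D (fun x => f x * beta h (p x) F zeta)).
Proof. by case: is_bochner_beta. Qed.

(** Evaluated at zeta, [beta h g] is a scalar times evaluation at a displaced point, so it commutes
    with pointwise integration. *)
Lemma beta_cintegral (g : heis R) (zeta : C) :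
  cintegral mu D (fun x => f x * beta h g (beta h (p x) F) zeta) =
  beta h g (fun xi => cintegral mu D (fun x => f x * beta h (p x) F xi)) zeta.
Proof.
rewrite [in RHS](betaE h g) /wshift -cintegralZl//; last exact: cintegrable_beta.
by apply: eq_cintegral => x _; rewrite (betaE h g) /wshift; ring.
Qed.

End bochner_beta.

Lemma measurable_hinv : measurable_fun setT (@hinv R : R3 -> R3).
Proof.
have m1 := @measurable_fst _ _ (R1 * R1)%type R1.
apply/measurable_fun_pairP; split; last first.
  by apply: measurable_funN; exact: measurable_snd.
apply/measurable_fun_pairP; split; apply: measurable_funN.
  exact: (measurableT_comp (@measurable_fst _ _ R1 R1) m1).
exact: (measurableT_comp (@measurable_snd _ _ R1 R1) m1).
Qed.

Lemma hinvK (q : heis R) : hinv (hinv q) = q.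
Proof. by case: q => [[x y] t]; rewrite /hinv /= !opprK. Qed.

Lemma heis_fourierE (f : R3 -> C) (h : R) (F : C -> C) :
  cintegrable (leb3 R) setT f -> fock F ->
  heis_fourier f h F =
    (fun zeta => cintegral (leb3 R) setT (fun q => f q * beta h (hinv q) F zeta)).
Proof.
move=> If fF; rewrite /heis_fourier.
under eq_fun do under eq_fun do rewrite adjoint_beta//.
exact: (@bochner_beta _ R3 (sleb3 R) setT measurableT f _ h F If measurable_hinv fF).
Qed.

(** A central element has zero displacement and acts by the phase e^(2iht), which is 1 here. *)
Lemma beta_central_period (h t : R) (j : int) (F : C -> C) (zeta : C) :
  h * t = j%:~R * pi -> beta h (central t) F zeta = F zeta.
Proof.
move=> ht.
have c0 : beta_shift h (central t) = 0.
  rewrite /beta_shift /central /= oppr0.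
  by apply: complex_ext; case: ifP => _; rewrite !ReImE /= !(mulr0, mul0r) ?subr0 ?addr0.
have J0 : conjc (0 : C) = 0 by apply: complex_ext; rewrite ?ReJ ?ImJ /= ?oppr0.
rewrite betaE /wshift c0 J0 cmod0 expr0n mul0r mulr0 !subr0 addr0.
rewrite (_ : 0 +i* _ = 2 * 'i%C * (j%:~R * pi)%:C) ?cexp_2piZ ?mul1r//.
by rewrite -ht; apply: complex_ext; rewrite !ReImE /=; ring.
Qed.

End beta_integrals.

(** * The projection-slice identity *)

Section main.
Variable R : realType.
Local Notation C := R[i].
Local Notation R1 := (measurableTypeR R).
Local Notation R3 := (R1 * R1 * R1)%type.
Variables (eps lam : R) (n : int).
Hypothesis lam0 : 0 < lam.
Local Notation D := (1 + 2 * eps ^+ 2 * lam ^+ 2).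
Local Notation h := (n%:~R * lam ^+ 2 / D).
Local Notation rho := (1 / Num.sqrt D).
Local Notation L := (2 * pi / lam).
Local Notation geo := (geodesic eps lam).
Local Notation quot := (quot_dom eps lam : set R3).

Let D0 : 0 < D.
Proof. by rewrite ltr_pwDl// mulr_ge0 ?sqr_ge0// mulr_ge0 ?sqr_ge0. Qed.

(** This is why the quotient transform is sampled at n lam^2 / (1 + 2 eps^2 lam^2): exactly then
    beta_h is trivial on the central subgroup. *)
Let hperiod (j : int) : h * (j%:~R * period eps lam) = (n * j)%:~R * pi.
Proof.
rewrite /period intrM; have D1 : D != 0 by rewrite gt_eqF.
have l1 : lam != 0 by rewrite gt_eqF.
by field; rewrite l1 D1.
Qed.

Lemma beta_hinv_central (F : C -> C) (zeta : C) (j : int) (q : heis R) :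
  beta h (hinv (hmul q (central (j%:~R * period eps lam)))) F zeta = beta h (hinv q) F zeta.
Proof.
rewrite hinvM -beta_comp.
have -> : hinv (central (j%:~R * period eps lam)) = central ((- j)%:~R * period eps lam).
  by rewrite /hinv /central /= oppr0 mulrNz mulNr.
exact: (@beta_central_period _ _ _ (n * - j)).
Qed.

(** Replace the transform by the orbital integral, take the matrix coefficient q -> beta_h(q^-1) F
    (zeta) as weight in [geo_int_weight], and use that the inverse of p gamma(s)^-1 is gamma(s) p^-1
    to factor out beta_h(gamma(s)). *)
Lemma quot_fourierE (f : R3 -> C) (F : C -> C) : cintegrable (leb3 R) setT f -> fock F ->
  quot_fourier eps lam (geo_transform eps lam f) n F =
  (fun zeta => cintegral (leb1 R) `[0, L[%classic
    (fun s => beta h (geo s) (heis_fourier f h F) zeta)).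
Proof.
move=> If fF; have gP := geo_transformP eps lam0 If.
have [[_ Ig] _] := gP; have mq : measurable quot by exact: measurable_quot_dom.
have [mg _] := (cintegrableP _ _ mq).1 Ig.
rewrite /quot_fourier; under eq_fun do under eq_fun do rewrite adjoint_beta//.
rewrite (@bochner_beta _ _ R3 (sleb3 R) quot mq _ _ h F Ig (@measurable_hinv R) fF).
apply/funext => zeta.
pose w (q : R3) : C := beta h (hinv q) F zeta.
have mw : cmeasurable setT w.
  by apply: cmeasurable_beta => //; exact: measurable_hinv.
have Igeo := cintegrable_geo_int eps lam0 If.
have [mgeo _] := (cintegrableP _ _ mq).1 Igeo.
transitivity (cintegral (leb3 R) quot (fun q => geo_int eps lam f q * w q)).
  apply: ae_eq_cintegral => //.
  - by apply: cmeasurableM => //; exact: (cmeasurableT _ mw).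
  - by apply: cmeasurableM => //; exact: (cmeasurableT _ mw).
  by apply: filterS (is_geo_transform_ae lam0 If gP) => q + Dq => /(_ Dq) ->.
rewrite (geo_int_weight lam0 If mw (M := 2 * expR (cmod zeta ^+ 2 / 2) * fock_norm F)).
- apply: eq_cintegral => s _; rewrite heis_fourierE//.
  rewrite -(@beta_cintegral _ _ R3 (sleb3 R) setT measurableT f (@hinv R) h F If
    (@measurable_hinv R) fF).
  by apply: eq_cintegral => p _; rewrite /w hinvM hinvK beta_comp.
- by move=> q; exact: beta_le.
- by move=> j q; exact: beta_hinv_central.
Qed.

(** At s = theta / lam the height is theta D / (2 lam^2), so h times it is n theta / 2; the
    displacement has modulus sqrt|h| / lam, which is sqrt|n| / sqrt D. *)
Lemma beta_geodesic (G : C -> C) (theta : R) :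
  beta h (geo (lam^-1 * theta)) G =
  beta n%:~R ((rho * cos theta, rho * sin theta), theta / 2) G.
Proof.
have D1 : D != 0 by rewrite gt_eqF.
have l1 : lam != 0 by rewrite gt_eqF.
have kap0 : 0 < lam ^+ 2 / D by rewrite divr_gt0// exprn_gt0.
rewrite !betaE; apply: eq_wshift.
  by rewrite /geodesic /=; field; rewrite l1 D1.
have sgn : (0 < h) = (0 < n%:~R :> R) by rewrite -mulrA pmulr_lgt0.
rewrite /beta_shift sgn -mulrA normrM (ger0_norm (ltW kap0)) sqrtrM ?normr_ge0//.
have -> : Num.sqrt (lam ^+ 2 / D) = lam / Num.sqrt D.
  by rewrite sqrtrM ?sqr_ge0// sqrtr_sqr (gtr0_norm lam0) sqrtrV// ltW.
have s0 : Num.sqrt D != 0 by rewrite gt_eqF// sqrtr_gt0.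
have E : lam^-1 * theta / lam^-1 = theta by field.
rewrite /geodesic /= E.
by apply: complex_ext; case: ifP => _; rewrite !ReImE /=; field; rewrite s0 l1.
Qed.

(** The dilation s = theta / lam, applied to the extensions by zero, maps the turn [0, L) to [0, 2
    pi). *)
Lemma arc_integral (G : C -> C) (zeta : C) : fock G ->
  cintegral (leb1 R) `[0, L[%classic (fun s => beta h (geo s) G zeta) =
  (lam^-1)%:C * cintegral (leb1 R) `[0, 2 * pi]%classic
    (fun theta => beta n%:~R ((rho * cos theta, rho * sin theta), theta / 2) G zeta).
Proof.
move=> fG; pose K := 2 * expR (cmod zeta ^+ 2 / 2) * fock_norm G.
pose psi (theta : R1) : C :=
  beta n%:~R ((rho * cos theta, rho * sin theta), theta / 2) G zeta.
have psiE : psi = (fun theta => beta h (geo (lam^-1 * theta)) G zeta).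
  by apply/funext => theta; rewrite beta_geodesic.
have lamV : 0 < lam^-1 by rewrite invr_gt0.
have marc : measurable (`[0, L[%classic : set R1) by exact: measurable_itv.
have mg : cmeasurable setT (fun s : R1 => beta h (geo s) G zeta).
  by apply: cmeasurable_beta => //; exact: measurable_geodesic.
have mpsi : cmeasurable setT psi.
  rewrite psiE; apply: (cmeasurable_comp mg (phi := fun theta : R1 => lam^-1 * theta : R1)).
  by apply: measurable_funM => //; exact: measurable_cst.
have fin2 : (leb1 R `[0%R, (2 * pi)%R[%classic < +oo)%E.
  have : (@lebesgue_measure R [set` `[0, 2 * pi[%R] < +oo)%E.
    by rewrite lebesgue_measure_itv /=; case: ifP => _; rewrite -?EFinB ltry.
  exact.
have Ipsi : cintegrable (leb1 R) `[0, 2 * pi[%classic psi.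
  apply: (cintegrable_bounded (M := K)) => //.
  - exact: (cmeasurableT _ mpsi).
  - by move=> theta; exact: beta_le.
have m2 : measurable (`[0, 2 * pi[%classic : set R1) by exact: measurable_itv.
have E (theta : R1) : crestrict `[0, L[%classic (fun s : R1 => beta h (geo s) G zeta)
    (lam^-1 * theta) = crestrict `[0, 2 * pi[%classic psi theta.
  have eqv : (lam^-1 * theta < L) = (theta < 2 * pi) by rewrite mulrC ltr_pM2r.
  rewrite /crestrict psiE; congr (if _ then _ else _).
  by apply/idP/idP; rewrite !inE /= !in_itv /= pmulr_rge0// eqv.
rewrite cintegral_mkcond (cintegral_dilation lamV); first last.
- by apply/(cmeasurable_mkcond _ _).1 => //; exact: (cmeasurableT _ mg).
- by rewrite (funext E); apply: (cintegrable_mkcond _ _ m2).1.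
congr (_ * _); rewrite (funext E) -cintegral_mkcond.
(* Unfolding yields a half-open interval while [Jop] uses a closed one; the endpoint is a null
   set. *)
have [I1 I2] := Ipsi; rewrite /cintegral; congr (_ +i* _).
  exact: Rintegral_itv_bndo_bndc.
exact: Rintegral_itv_bndo_bndc.
Qed.

Lemma JopE (G : C -> C) : fock G ->
  Jop n rho G = (fun zeta => ((2 * pi)^-1)%:C * cintegral (leb1 R) `[0, 2 * pi]%classic
    (fun theta => beta n%:~R ((rho * cos theta, rho * sin theta), theta / 2) G zeta)).
Proof.
move=> fG; apply/funext => zeta; rewrite /Jop; congr (_ * _).
have m2 : measurable (`[0, 2 * pi]%classic : set R1) by exact: measurable_itv.
pose p (theta : R1) : R3 := ((rho * cos theta, rho * sin theta), theta / 2).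
have mp : measurable_fun setT p.
  apply/measurable_fun_pairP; split => /=; last first.
    by apply: measurable_funM => //; exact: measurable_cst.
  apply/measurable_fun_pairP; split => /=; apply: measurable_funM;
    try exact: measurable_cst; apply: continuous_measurable_fun;
    [exact: continuous_cos|exact: continuous_sin].
have fin2 : (leb1 R `[0%R, (2 * pi)%R]%classic < +oo)%E.
  have : (@lebesgue_measure R [set` `[0, 2 * pi]%R] < +oo)%E.
    by rewrite lebesgue_measure_itv /=; case: ifP => _; rewrite -?EFinB ltry.
  exact.
(* [bochner_beta] expects a scalar factor, taken here to be the constant 1, integrable on the
   bounded interval. *)
have I1 : cintegrable (leb1 R) `[0, 2 * pi]%classic (fun=> 1 : C).
  by apply: (cintegrable_bounded (M := 1)) => //; move=> _; rewrite cmod1.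
have B := @bochner_beta _ _ R1 (sleb1 R) _ m2 _ p n%:~R G I1 mp fG.
have E1 (u : R1 -> C -> C) : (fun x xi => 1 * u x xi) = u.
  by apply/funext => x; apply/funext => xi; rewrite mul1r.
rewrite E1 in B; rewrite [LHS](congr1 (fun u : C -> C => u zeta) B).
by apply: eq_cintegral => theta _; rewrite mul1r.
Qed.

End main.

Theorem theorem3 (R : realType) (f : heis R -> R[i]) (eps : R)
    (Hf : heis_L1 f) (Heps : 0 < eps) (n : int) (Hn : n != 0)
    (lam : R) (Hlam : 0 < lam) (F : R[i] -> R[i]) (HF : fock F) :
  quot_fourier eps lam (geo_transform eps lam f) n F =
  (fun zeta : R[i] =>
     (2 * pi / lam)%:C *
     (Jop n (1 / Num.sqrt (1 + 2 * eps ^+ 2 * lam ^+ 2)) \o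
      heis_fourier f (n%:~R * lam ^+ 2 / (1 + 2 * eps ^+ 2 * lam ^+ 2)))
       F zeta).
Proof.
rewrite (@quot_fourierE _ eps lam n Hlam _ _ Hf HF); apply/funext => zeta /=.
set h := n%:~R * lam ^+ 2 / _.
have fG : fock (heis_fourier f h F).
  rewrite heis_fourierE//.
  exact: (@fock_cintegral_beta _ _ _ (sleb3 R) setT measurableT f (@hinv R) h F Hf
    (@measurable_hinv R) HF).
rewrite (@arc_integral _ eps lam n Hlam _ zeta fG) JopE// mulrA; congr (_ * _).
have p0 : (pi : R) != 0 by rewrite gt_eqF// pi_gt0.
have l0 : lam != 0 by rewrite gt_eqF.
(* What remains is the scalar identity 1 / lam = (2 pi / lam) / (2 pi). *)
rewrite -rmorphM; congr (_%:C); move: (pi : R) p0 => c c0; field.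
by rewrite c0 l0.
Qed.
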